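(* Let $(Y,\nu,\mathcal{T})$ be the Kakutani tower and $f:Y\to\mathbb{C}$ the function described in the context, determined by the exponent $\beta\in(0,1)$, the partitions $\mathcal{B}=\{B_i\}_{i\in\mathbb{Z}^+}$ and $\mathcal{C}=\{C_j\}_{j\in\mathbb{J}}$ of $[0,1)$, and the unimodular numbers $\{\gamma_j\}_{j\in\mathbb{J}}$. Interpret the Birkhoff sum $\mathcal{S}_nf=\sum_{k=0}^{n-1}f\circ\mathcal{T}^k$ as a random variable for the probability measure $\nu_0:=\nu(\,\cdot\,|L_0)$, where $L_0=\Sigma\times\{0\}$ (that is, $\mathcal{S}_nf(y)$ depends on the initial condition $y=(x,0)$, with $x$ chosen randomly in $\Sigma=[0,1)\times[0,1)$ according to the Lebesgue measure). Then the process $$\left(L_n(t)\right)_{t\ge0}:=\left(\frac{\mathcal{S}_{\lfloor nt\rfloor}f}{n}\right)_{t\ge0}$$ converges in distribution as $n\to\infty$, w.r.t. the topology of uniform convergence on all intervals $[0,T]$, to a continuous $\mathbb{C}$-valued process $(L(t))_{t\ge0}$. If moreover not all $\gamma_j$ are equal (assuming that the Lebesgue measure of $C_j$ is positive for all $j\in\mathbb{J}$), then for every $t>0$ the random variable $L(t)$ is non-constant (i.e. it is not almost surely equal to a constant); in particular $$\mathcal{A}_nf=\frac{\mathcal{S}_nf}{n}$$ converges in distribution to a non-constant random variable.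
   Context: Let $m$ denote the Lebesgue measure, $\mathbb{N}=\{0,1,2,\dots\}$, $\mathbb{Z}^+=\{1,2,\dots\}$. Base map. Let $\Sigma:=[0,1)\times[0,1)$, with points $x=(x_1,x_2)$ and Lebesgue measure $\rho$. Let $\mathcal{B}=\{B_i\}_{i\in\mathbb{Z}^+}$ be a partition of $[0,1)$ into right-open intervals ordered from left to right, with $m(B_i)\sim c\,i^{-\beta-1}$ as $i\to\infty$ (ratio tends to $1$), for some $c>0$ and $\beta\in(0,1)$. Let $\mathcal{C}=\{C_j\}_{j\in\mathbb{J}}$ be another partition of $[0,1)$ into right-open intervals ordered from left to right, where $\mathbb{J}$ is either $\{1,\dots,N\}$ for some positive integer $N$, or $\mathbb{Z}^+$. Let $S_{\mathcal{B}}:[0,1)\to[0,1)$ be the map that sends each $B_i$ affinely and increasingly onto $[0,1)$ (with derivative $1/m(B_i)$), and let $S_{\mathcal{C}}:[0,1)\to[0,1)$ be the map defined in the same way from $\mathcal{C}$. Set $S(x_1,x_2):=(S_{\mathcal{B}}(x_1),S_{\mathcal{C}}(x_2))$; $S$ preserves $\rho$. Tower. Let $\varphi:\Sigma\to\mathbb{N}$ be given by $\varphi\equiv i-1$ on $B_i\times[0,1)$. Put $$Y:=\{(x,k)\in\Sigma\times\mathbb{N}: 0\le k\le\varphi(x)\},$$ with the $\sigma$-algebra generated by the sets $A\times\{k\}$, $A\subseteq\{\varphi\ge k\}$ measurable, and the measure $\nu(A\times\{k\}):=\rho(A)$. The tower map is $$\mathcal{T}(x,k):=\begin{cases}(x,k-1),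 & k\ge1,\\ (S(x),\varphi(S(x))), & k=0.\end{cases}$$ It preserves $\nu$, which is an infinite measure. Observable. Let $\{\gamma_j\}_{j\in\mathbb{J}}\subset\mathbb{C}$ with $|\gamma_j|=1$, and define $f((x_1,x_2),k):=\gamma_j$ whenever $x_2\in C_j$ (for any level $k$). *)

(* Defs.v *)
From HB Require Import structures.
From mathcomp Require Import all_boot all_order all_algebra.
From mathcomp Require Import all_classical all_reals all_analysis.
From mathcomp Require Import finmap complex.
Set Implicit Arguments.
Unset Strict Implicit.
Unset Printing Implicit Defensive.
Import Order.TTheory GRing.Theory Num.Theory.
Import numFieldNormedType.Exports.
Local Open Scope classical_set_scope.
Local Open Scope ring_scope.

(* The library registers [counting] on nat as sigma-finite but not as s-finite;
   the product measure needs the join of both. *)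
HB.instance Definition _ (R : realType) :=
  Measure_isSigmaFinite.Build _ _ R (@counting nat R)
    (sigma_finite_counting R).

Definition Zplus : set nat := [set i | (0 < i)%N].

(* Blocks may be empty: [a, b[ is empty when b <= a. *)
Record interval_partition (R : realType) (J : set nat) := IntervalPartition {
  block :> nat -> set R ;
  block_itv : forall j, J j -> exists a b : R, block j = `[a, b[%classic ;
  block_cover : \bigcup_(j in J) block j = `[0, 1[%classic ;
  block_trivIset : trivIset J block ;
  block_lt : forall i j, J i -> J j -> (i < j)%N ->
    forall x y, block i x -> block j y -> x < y }.

Section tower.
Context {R : realType}.

Notation T1 := (measurableTypeR R).
Notation base := (T1 * T1)%type.
Notation tower := (T1 * T1 * nat)%type.
Notation leb := (@lebesgue_measure R).

Section block_map.
Context (J : set nat) (P : interval_partition R J).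

(* Outside [0, 1[ the index is the junk value 0. *)
Definition block_index (x : R) : nat := xget 0%N [set j | J j /\ P j x].

(* On the nonempty block [a, b[ this is x |-> (x - a) / (b - a). *)
Definition block_map (x : R) : R :=
  let A := P (block_index x) in (x - inf A) / fine (leb A).

End block_map.

Definition Sigma : set base := `[0, 1[%classic `*` `[0, 1[%classic.

Lemma measurable_Sigma : measurable Sigma.
Proof. by apply: measurableX; exact: measurable_itv. Qed.

Definition rho : {measure set base -> \bar R} :=
  mrestr (leb \x leb)%E measurable_Sigma.

Context (B : interval_partition R Zplus).

Definition phi (x : base) : nat := (block_index B x.1).-1.

Definition Y : set tower := [set y | Sigma y.1 /\ (y.2 <= phi y.1)%N].

Definition L0 : set tower := Sigma `*` [set 0%N].

Lemma measurable_L0 : measurable L0.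
Proof. by apply: measurableX => //; exact: measurable_Sigma. Qed.

Lemma measurable_block J (P : interval_partition R J) j :
  J j -> measurable (P j : set T1).
Proof. by move=> /(block_itv P)[a [b ->]]; exact: measurable_itv. Qed.

Lemma block_indexP J (P : interval_partition R J) x j :
  J j -> P j x -> block_index P x = j.
Proof.
move=> Jj Pjx; rewrite /block_index; case: xgetP => [i _ [Ji Pix]|/(_ j)].
  by apply: (@block_trivIset _ _ P i j Ji Jj); exists x.
by case.
Qed.

Lemma YE : Y = \bigcup_(i in Zplus)
  ((B i `*` `[0, 1[%classic) `*` [set k | (k < i)%N]).
Proof.
apply/seteqP; split=> [[[x1 x2] k]|[[x1 x2] k] [i i0 /= [[Bix x2I] ki]]].
  move=> [/= [/= x1I x2I] kphi].
  have : (\bigcup_(j in Zplus) B j) x1 by rewrite (block_cover B).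
  move=> [i i0 Bix]; exists i => //; split=> //=.
  by move: kphi; rewrite /phi/= (block_indexP i0 Bix) -ltnS prednK.
split; last by rewrite /= /phi/= (block_indexP i0 Bix) -ltnS prednK.
have x1I : (`[0, 1[%classic : set R) x1 by rewrite -(block_cover B); exists i.
by split.
Qed.

Lemma measurable_Y : measurable Y.
Proof.
rewrite YE; apply: bigcup_measurable => i i0.
apply: measurableX => //; apply: measurableX; last exact: measurable_itv.
exact: measurable_block.
Qed.

Definition nu : {measure set tower -> \bar R} :=
  mrestr (rho \x @counting nat R)%E measurable_Y.

(* nu( . | L0); the Dirac default of [mnormalize] is not used, as nu L0 = 1. *)
Definition nu0 : probability tower R :=
  mnormalize (mrestr nu measurable_L0) (dirac point).

Lemma nu_level (A : set base) k : measurable A ->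
  A `<=` [set x | Sigma x /\ (k <= phi x)%N] -> nu (A `*` [set k]) = rho A.
Proof.
move=> mA Aphi; rewrite /nu/= /mrestr setIidl; last first.
  by move=> [x l] /= [/Aphi[Sx kx] ->].
apply: etrans (product_measure1E rho (@counting nat R) mA _) _ => //.
by rewrite /= /counting asboolT// fset_set1 cardfs1 mule1.
Qed.

Lemma nu_L0 : nu L0 = 1%E.
Proof.
have leb01 : leb (`[0, 1[%classic : set R) = 1%E.
  by rewrite lebesgue_measure_itv/= lte_fin ltr01 -EFinB subr0.
rewrite nu_level; [|exact: measurable_Sigma|by move=> x Sx; split].
rewrite /rho/= /mrestr setIid.
apply: etrans (product_measure1E leb leb _ _) _; do ?exact: measurable_itv.
by rewrite /= leb01 mule1.
Qed.

Lemma nu0E A : nu0 A = nu (A `&` L0).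
Proof.
have nuT : mrestr nu measurable_L0 setT = 1%E by rewrite /mrestr setTI nu_L0.
change ((if (mrestr nu measurable_L0 setT == 0%E) ||
   (mrestr nu measurable_L0 setT == +oo%E) then fun U => dirac point U else
   fun U => (nu (U `&` L0) * (fine (mrestr nu measurable_L0 setT))^-1%:E)%E) A
   = nu (A `&` L0)).
by rewrite nuT onee_eq0/= invr1 mule1.
Qed.

Definition tower_map (J : set nat) (C : interval_partition R J) (y : tower) :
    tower :=
  let: (x, k) := y in
  if k is k'.+1 then (x, k')
  else let Sx := (block_map B x.1, block_map C x.2) in (Sx, phi Sx).

Definition observable (J : set nat) (C : interval_partition R J)
    (gamma : nat -> R[i]) (y : tower) : R[i]^o :=
  gamma (block_index C y.1.2).

End tower.

Definition birkhoff_sum (T : Type) (V : nmodType) (g : T -> T) (f : T -> V)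
    (n : nat) (y : T) : V := \sum_(k < n) f (iter k g y).

(* Functions on R with the topology of uniform convergence on every [0, t]:
   points that agree on [0, +oo[ are topologically indistinguishable, so that
   this stands for the space of all functions [0, +oo[ -> C. *)
Definition segments0 (R : realType) : set (set R) :=
  [set `[0, t]%classic | t in [set t : R | 0 <= t]].

Notation path_space R := {family @segments0 R, R -> R[i]^o}.

Definition borel_rv d (W : measurableType d) (X : topologicalType)
    (Z : W -> X) := forall U : set X, open U -> measurable (Z @^-1` U).

Definition cvg_in_distribution (R : realType) (X : topologicalType)
    d (W : measurableType d) (mu : probability W R) (Z_ : nat -> W -> X)
    d' (W' : measurableType d') (P : probability W' R) (Z : W' -> X) :=
  [/\ forall n, borel_rv (Z_ n), borel_rv Z &
      forall F : X -> R, continuous F ->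
        (exists M : R, forall x, `|F x| <= M) ->
        (\int[mu]_w (F (Z_ n w))%:E)%E @[n --> \oo] -->
        (\int[P]_w (F (Z w))%:E)%E].

Definition as_constant (R : realType) d (W : measurableType d)
    (P : probability W R) (X : Type) (Z : W -> X) :=
  exists z : X, {ae P, forall w, Z w = z}.

(* Main.v *)
Require Import Defs.
From HB Require Import structures.
From mathcomp Require Import all_boot all_order all_algebra.
From mathcomp Require Import all_classical all_reals all_analysis.
From mathcomp Require Import measurable_realfun complex ring lra zify.
Import Order.TTheory GRing.Theory Num.Theory.
Import numFieldNormedType.Exports.
Local Open Scope classical_set_scope.
Local Open Scope ring_scope.

(** Started at the base, an orbit goes down one column of the tower after the
other, and [f] is constant on each column.  The Birkhoff sum is therefore
obtained by laying end to end intervals whose lengths are the sojourn times in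
the columns, giving each interval the label of its column, and integrating the
label up to time [n] ([tower_birkhoff]).  Both coordinates of [S] are full
affine branch maps, so that sojourn times and labels are independent sequences
of independent identically distributed variables ([nu0_cylinder]).

The sojourn times have a tail of order [i^-beta] with [beta < 1].  After
division by [n] only the few largest matter: among the first [n^beta] sojourn
times the rescaled values look like the jumps of a [beta]-stable subordinator,
and the limit process integrates up to time [t] the label of the jump that
covers each instant.

This convergence is made pathwise by a coupling.  One sample [w.1] carries a
Poisson process of unit intensity on the quarter plane, with points
(time, height); an independent sample [w.2] carries a sequence of labels, one
for each point.  For each [n] the time axis is cut into cells of length [1/N],
where [N] is about [n^beta].  The lowest point of the [k]-th cell provides the
[k]-th sojourn time, as the image of its height under the quantile function,
and the [k]-th label.  The void probabilities of the Poisson process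
([lam_void_event]) show that for each fixed [n] these digits have exactly the
law of the digits of the tower ([coupled_cylinder]), the lowest heights
of distinct cells being independent exponential variables.

Along almost every sample the coupled walks converge.  The rescaled sojourn
time attached to a point of height [a] tends to a multiple of [a^(-1/beta)],
and because [1/beta > 1] these values are summable over the points with time
in a bounded strip ([ae_sum_upper]); so the rescaled weights converge in l^1 on
each strip ([weights_l1]).  A walk is a Lipschitz function of its weights,
uniformly in the labels ([layout_lip]), and the limit weights of all points sum
to infinity, so that every time is eventually covered; hence the coupled walks
are uniformly Cauchy on compact sets ([config_walk_cauchy]).  Equality of
laws for each [n] and dominated convergence then give convergence in
distribution ([path_converges]).

For the last assertion, fix [w.1].  Up to an error [e], the value of the limit
at [t] depends on the labels of finitely many points only.  With positive
probability all these labels equal any prescribed [j], and then the value is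
within [e] of [gamma j * t].  A constant limit would force all [gamma j] to be
equal ([limit_not_constant]). *)

Set Implicit Arguments.
Unset Strict Implicit.
Unset Printing Implicit Defensive.

(** * Integrating labels along intervals laid end to end *)

Section layout.
Context {R : realType}.
Implicit Types (w x : nat -> R) (l : seq nat) (t : R).

(** The integral up to time [t] of the step function with value [x p] on an
interval of length [w p], the intervals following each other in the order of
[l]. It is defined by recursion on [l] rather than by sums of lengths because
every estimate below is an induction that consumes the first interval. *)
Fixpoint layout w x l t : R :=
  if l is p :: l' then x p * Num.min (w p) t + layout w x l' (Num.max (t - w p) 0)
  else 0.

Lemma eq_layout w x w' x' l t : {in l, w =1 w'} -> {in l, x =1 x'} ->
  layout w x l t = layout w' x' l t.
Proof.
elim: l t => //= p l IH t ww xx.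
rewrite ww ?mem_head// xx ?mem_head//; congr (_ + _); apply: IH => q ql.
  by apply: ww; rewrite inE ql orbT.
by apply: xx; rewrite inE ql orbT.
Qed.

Lemma layout_map w x (f : nat -> nat) l t :
  layout w x (map f l) t = layout (w \o f) (x \o f) l t.
Proof. by elim: l t => //= p l IH t; rewrite IH. Qed.

Lemma layout0 w x l : (forall p, 0 <= w p) -> layout w x l 0 = 0.
Proof.
move=> w0; elim: l => //= p l IH.
rewrite min_r// mulr0 add0r max_r ?IH//.
by rewrite subr_le0.
Qed.

Lemma layout_scale (c : R) w x l t : 0 < c ->
  layout (fun p => c * w p) x l (c * t) = c * layout w x l t.
Proof.
move=> c0; elim: l t => [|p l IH] t /=; first by rewrite mulr0.
rewrite -minr_pMr ?ltW// -mulrBr -[X in Num.max _ X](mulr0 c) -maxr_pMr ?ltW// IH.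
by rewrite mulrDr mulrCA.
Qed.

Lemma layout_cat w x l1 l2 t : 0 <= t -> (forall p, 0 <= w p) ->
  layout w x (l1 ++ l2) t =
  layout w x l1 t + layout w x l2 (Num.max (t - \sum_(p <- l1) w p) 0).
Proof.
move=> + w0; elim: l1 t => [|p l1 IH] t t0 /=.
  by rewrite big_nil subr0 add0r max_l.
rewrite IH ?le_max ?lexx ?orbT// addrA big_cons; congr (_ + layout _ _ _ _).
have s0 : 0 <= \sum_(j <- l1) w j by apply: sumr_ge0.
rewrite opprD addrA.
case: (leP (t - w p) 0) => h; last by [].
rewrite !max_r//; lra.
Qed.

(** Intervals beyond time [t] contribute nothing, so that the number of
intervals in a layout can be changed freely once they cover [t]. *)
Lemma layout_saturated w x l1 l2 t : 0 <= t -> (forall p, 0 <= w p) ->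
  t <= \sum_(p <- l1) w p -> layout w x (l1 ++ l2) t = layout w x l1 t.
Proof.
by move=> t0 w0 tl; rewrite layout_cat// max_r ?subr_le0// layout0// addr0.
Qed.

Lemma layout_drop0 w x l t : 0 <= t -> (forall p, 0 <= w p) ->
  layout w x [seq p <- l | w p != 0] t = layout w x l t.
Proof.
move=> + w0; elim: l t => //= p l IH t t0; case: ifPn => [|/negPn/eqP->] /=.
  by move=> _; rewrite IH// le_max lexx orbT.
by rewrite min_l// mulr0 add0r subr0 max_l// IH.
Qed.

Lemma layout_cst w x a l t : 0 <= t -> (forall p, 0 <= w p) ->
  {in l, forall p, w p != 0 -> x p = a} ->
  layout w x l t = a * Num.min (\sum_(p <- l) w p) t.
Proof.
move=> + w0; elim: l t => [|p l IH] t t0 xa /=.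
  by rewrite big_nil min_l// mulr0.
have s0 : 0 <= \sum_(j <- l) w j by apply: sumr_ge0.
rewrite big_cons IH ?le_max ?lexx ?orbT//; last first.
  by move=> q ql; apply: xa; rewrite inE ql orbT.
have -> : x p * Num.min (w p) t = a * Num.min (w p) t.
  have [wp0|wp0] := eqVneq (w p) 0; first by rewrite wp0 min_l// !mulr0.
  by rewrite xa// mem_head.
rewrite -mulrDr; congr (_ * _); have := w0 p.
by case: (leP (w p) t); case: (leP (t - w p) 0) => ? ? ?; case: (leP _ t);
  case: (leP (\sum_(j <- l) w j) _); lra.
Qed.

(** The estimate behind the convergence of walks: the bound does not involve the
order of the intervals nor, apart from their size, the labels. Moving the
end of one interval by [d] costs [d] inside that interval and shifts the
remaining time by at most [d], whence the factor 2. *)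
Lemma layout_lip w w' x l t t' : (forall p, `|x p| <= 1) ->
  `|layout w x l t - layout w' x l t'| <=
    `|t - t'| + 2 * \sum_(p <- l) `|w p - w' p|.
Proof.
move=> x1; elim: l t t' => [|p l IH] t t' /=.
  by rewrite subrr normr0 big_nil mulr0 addr0.
rewrite big_cons mulrDr addrA.
set u := Num.min (w p) t - Num.min (w' p) t'.
set v := Num.max (t - w p) 0 - Num.max (t' - w' p) 0.
have uv : `|u| + `|v| <= `|t - t'| + 2 * `|w p - w' p|.
  have h1 := ler_norm (t - t'); have h2 := ler_norm (t' - t).
  have h3 := ler_norm (w p - w' p); have h4 := ler_norm (w' p - w p).
  rewrite distrC in h2; rewrite distrC in h4.
  case: (ger0P u); case: (ger0P v); rewrite /u /v;
  case: (leP (w p) t); case: (leP (w' p) t') => ? ?;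
  case: (leP (t - w p) 0); case: (leP (t' - w' p) 0) => ? ? ? ?; lra.
rewrite opprD addrACA -mulrBr.
apply: le_trans (ler_normD _ _) _; rewrite normrM.
apply: (@le_trans _ _ (`|u| + (`|v| + 2 * \sum_(j <- l) `|w j - w' j|))).
  by apply: lerD (IH _ _); rewrite -[leRHS]mul1r ler_wpM2r.
by rewrite addrA lerD2r.
Qed.

End layout.

(** * Walks whose intervals are indexed by points in cells *)

Section cells.
Context {R : realType}.
Variables (pr : pred nat) (s x : nat -> R) (N : nat -> nat).
Variables (idx : nat -> nat -> nat) (v : nat -> nat -> R).

Definition cell n p := Num.truncn ((N n)%:R * s p).

(** The weights [v n k] are indexed by cells; here they are carried over to the
points, a point that does not represent its cell having weight 0. This gives
walks at different levels [n] a common index set. *)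
Definition pointw n p : R :=
  if pr p && (idx n (cell n p) == p) then v n (cell n p) else 0.

Definition strip (m : nat) (p : nat) := pr p && (s p < m%:R).

Definition points m K := sort (fun p q => s p <= s q) [seq p <- iota 0 K | strip m p].

Hypothesis N0 : forall n, (0 < N n)%N.
Hypothesis s0 : forall p, pr p -> 0 <= s p.
Hypothesis s_inj : forall p q, pr p -> pr q -> s p = s q -> p = q.
Hypothesis pr_idx : forall n k, pr (idx n k).
Hypothesis cell_idx : forall n k, cell n (idx n k) = k.
Hypothesis v_gt0 : forall n k, (0 < n)%N -> 0 < v n k.
Hypothesis x_ge0 : forall p, 0 <= x p.

Lemma pointw_idx n k : pointw n (idx n k) = v n k.
Proof. by rewrite /pointw pr_idx cell_idx eqxx. Qed.

Lemma pointw_ge0 n p : (0 < n)%N -> 0 <= pointw n p.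
Proof. by move=> n0; rewrite /pointw; case: ifP => // _; exact/ltW/v_gt0. Qed.

Lemma mem_points m K p : (p \in points m K) = strip m p && (p < K)%N.
Proof. by rewrite mem_sort mem_filter mem_iota. Qed.

Lemma sum_points m K (F : nat -> R) :
  \sum_(p <- points m K) F p = \sum_(0 <= p < K | strip m p) F p.
Proof.
rewrite /points (perm_big [seq p <- iota 0 K | strip m p]) ?big_filter//.
  by rewrite /index_iota subn0.
by rewrite perm_sort.
Qed.

Lemma points_sorted m K : sorted (fun p q => s p < s q) (points m K).
Proof.
have -> : (fun p q => s p < s q) = relpre s <%R by [].
rewrite -sorted_map lt_sorted_uniq_le; apply/andP; split.
  rewrite map_inj_in_uniq ?sort_uniq ?filter_uniq ?iota_uniq// => p q.
  rewrite !mem_points => /andP[/andP[pp _] _] /andP[/andP[pq _] _].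
  exact: s_inj.
rewrite sorted_map; apply: sort_sorted => p q; exact: le_total.
Qed.

Lemma cell_strip n m p : pr p -> (cell n p < m * N n)%N = (s p < m%:R).
Proof.
move=> pp; rewrite /cell truncn_lt_nat ?mulr_ge0 ?s0//.
by rewrite natrM mulrC ltr_pM2r// ltr0n.
Qed.

(** Points representing distinct cells come in the order of their times, which is
the order of the cells, and the others have weight zero: a layout over cells
is thus a layout over points sorted by time. *)
Lemma layout_cells n m K (xi : nat -> R) t : (0 < n)%N -> 0 <= t ->
  (forall k, (k < m * N n)%N -> (idx n k < K)%N) ->
  layout (v n) (xi \o idx n) (iota 0 (m * N n)) t =
  layout (pointw n) xi (points m K) t.
Proof.
move=> n0 t0 idxK.
rewrite -[RHS]layout_drop0//; last by move=> p; exact: pointw_ge0.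
rewrite (@eq_layout _ _ _ (pointw n \o idx n) (xi \o idx n))//; last first.
  by move=> k _ /=; rewrite pointw_idx.
rewrite -layout_map; congr (layout _ _ _ _).
apply: (@irr_sorted_eq _ (fun p q => s p < s q)).
- by move=> p q r; exact: lt_trans.
- by move=> p; rewrite ltxx.
- apply: (homo_sorted (e := ltn)); last exact: iota_ltn_sorted.
  move=> j k /= jk; rewrite ltNge; apply/negP => sji.
  move: jk; rewrite ltnNge => /negP; apply.
  rewrite -[leqRHS](cell_idx n) -[leqLHS](cell_idx n).
  by apply: le_truncn; rewrite ler_wpM2l.
- apply: sorted_filter; last exact: points_sorted.
  by move=> p q r; exact: lt_trans.
- move=> p; rewrite mem_filter mem_points; apply/mapP/idP => [[k]|].
    rewrite mem_iota/= add0n => km ->.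
    rewrite pointw_idx lt0r_neq0 ?v_gt0//= idxK// andbT /strip pr_idx/=.
    by rewrite -(cell_strip n)// cell_idx.
  move=> /andP[+ /andP[/andP[pp sm] _]]; rewrite /pointw pp/=.
  case: ifP => [/eqP pk _|]; last by rewrite eqxx.
  by exists (cell n p) => //; rewrite mem_iota/= add0n cell_strip.
Qed.

Hypothesis v_ge : forall n k, (0 < n)%N -> n%:R^-1 <= v n k.
Hypothesis l1 : forall m (e : R), 0 < e -> exists n0, forall n K, (n0 <= n)%N ->
  \sum_(0 <= p < K | strip m p) `|pointw n p - x p| <= e.
Hypothesis x_summable : forall m, exists C : R, forall K,
  \sum_(0 <= p < K | strip m p) x p <= C.
Hypothesis x_unbounded : forall t : R, exists m K,
  t < \sum_(0 <= p < K | strip m p) x p.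

(** The time is rounded to a multiple of [1/n] because a Birkhoff sum has an
integer number of terms; [M] intervals suffice, each having length at least
[1/n]. *)
Definition walk n (xi : nat -> R) (t : R) : R :=
  let M := Num.truncn (n%:R * t) in
  layout (v n) (xi \o idx n) (iota 0 M) (M%:R / n%:R).

Lemma walkE n xi (t : R) K : (0 < n)%N -> (Num.truncn (n%:R * t) <= K)%N ->
  walk n xi t = layout (v n) (xi \o idx n) (iota 0 K)
    ((Num.truncn (n%:R * t))%:R / n%:R).
Proof.
move=> n0 MK; rewrite /walk; set M := Num.truncn _ in MK *.
rewrite -(subnKC MK) iotaD layout_saturated ?divr_ge0// => [k|].
  exact/ltW/v_gt0.
have -> : M%:R / n%:R = \sum_(0 <= k < M) (n%:R^-1 : R).
  by rewrite big_const_nat iter_addr addr0 subn0 mulr_natl.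
by rewrite /index_iota subn0; apply: ler_sum => k _; exact: v_ge.
Qed.

Lemma max_idx n K0 : exists K, forall k, (k < K0)%N -> (idx n k < K)%N.
Proof.
exists (\max_(k < K0) (idx n k)).+1 => k kK.
by rewrite ltnS; apply: (@leq_bigmax_cond _ xpredT (fun k : 'I_K0 => idx n k) (Ordinal kK)).
Qed.

Lemma sum_strip_le m (F : nat -> R) K K' : (forall p, 0 <= F p) -> (K <= K')%N ->
  \sum_(0 <= p < K | strip m p) F p <= \sum_(0 <= p < K' | strip m p) F p.
Proof.
move=> F0 KK; rewrite (big_cat_nat _ KK)//= lerDl.
by apply: sumr_ge0.
Qed.

Lemma x_tail m (e : R) : 0 < e -> exists K0, forall K, (K0 <= K)%N ->
  \sum_(K0 <= p < K | strip m p) x p <= e.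
Proof.
move=> e0; have [C HC] := x_summable m.
pose A := [set y | exists K, y = \sum_(0 <= p < K | strip m p) x p].
have hA : has_sup A.
  split; first by exists (\sum_(0 <= p < 0 | strip m p) x p); exists 0%N.
  by exists C => _ [K ->].
have [_ [K0 ->] AK] := sup_adherent e0 hA.
exists K0 => K KK.
have : \sum_(0 <= p < K | strip m p) x p <= sup A by apply: ub_le_sup; [exact: hA.2|exists K].
rewrite (big_cat_nat _ KK)//=; lra.
Qed.

(** A strip whose limit weights cover [T] with some room covers it at every large
level too, by l^1 convergence of the weights. The bound [K0] depends on [n]: it
must exceed the indices of all points that represent a cell of the strip at
level [n]. *)
Lemma walk_approx (T e : R) : 0 < e -> exists m K1,
  T < \sum_(0 <= p < K1 | strip m p) x p /\
  exists n0, forall n, (n0 <= n)%N -> exists K0, forall K, (K0 <= K)%N -> forall xi, (forall p, `|xi p| <= 1) ->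
  forall t, 0 <= t <= T ->
  `|walk n xi t - layout x xi (points m K) t| <= e.
Proof.
move=> e0; have e4 : 0 < e / 4 by rewrite divr_gt0.
have [m [K1 HK1]] := x_unbounded (T + e / 4).
have [n1 Hn1] := l1 m e4.
pose n2 := (Num.truncn (e / 4)^-1).+1.
exists m, K1; split; first by lra.
exists (maxn n1 n2).+1 => n nn.
have n0 : (0 < n)%N by apply: leq_ltn_trans nn.
have nn1 : (n1 <= n)%N by lia.
have ne : n%:R^-1 <= e / 4.
  rewrite -[e / 4]invrK lef_pV2 ?posrE ?invr_gt0 ?ltr0n//.
  apply: (le_trans (ltW (truncnS_gt _))).
  by rewrite ler_nat -/n2; lia.
have [K2 HK2] := max_idx n (m * N n).
exists (maxn K1 K2) => K; rewrite geq_max => /andP[KK1 KK2] xi xi1 t /andP[t0 tT].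
set M := Num.truncn (n%:R * t).
have nR0 : 0 < n%:R :> R by rewrite ltr0n.
have Mt : M%:R / n%:R <= t.
  by rewrite ler_pdivrMr// mulrC truncn_le// mulr_ge0.
have tM : t - n%:R^-1 <= M%:R / n%:R.
  rewrite -[leLHS](mulfK (lt0r_neq0 nR0)) ler_pM2r ?invr_gt0//.
  rewrite mulrBl mulVf ?lt0r_neq0// lerBlDr mulrC natr1.
  exact/ltW/truncnS_gt.
have M0 : 0 <= M%:R / n%:R :> R by rewrite divr_ge0.
rewrite (@walkE n xi t (maxn M (m * N n)))//; last exact: leq_maxl.
have KK : (m * N n <= maxn M (m * N n))%N by exact: leq_maxr.
rewrite -{1}(subnKC KK) iotaD layout_saturated//; last 2 first.
- by move=> k; exact/ltW/v_gt0.
- apply: (le_trans Mt); apply: (le_trans tT).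
  have -> : \sum_(p <- iota 0 (m * N n)) v n p =
      \sum_(p <- points m K) pointw n p.
    have := @layout_cells n m K (fun=> 1) (\sum_(p <- iota 0 (m * N n)) v n p + \sum_(p <- points m K) pointw n p) n0.
    have s1 : 0 <= \sum_(p <- iota 0 (m * N n)) v n p.
      by apply: sumr_ge0 => k _; exact/ltW/v_gt0.
    have s2 : 0 <= \sum_(p <- points m K) pointw n p.
      by apply: sumr_ge0 => k _; exact: pointw_ge0.
    rewrite addr_ge0// => /(_ isT)/(_ (fun k km => leq_trans (HK2 k km) KK2)).
    rewrite !(@layout_cst _ _ _ 1)// ?addr_ge0//.
    + by rewrite !mul1r !min_l// ?lerDl ?lerDr.
    + by move=> k; exact: pointw_ge0.
    + by move=> k; exact/ltW/v_gt0.
  rewrite sum_points.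
  have : \sum_(0 <= p < K | strip m p) x p - \sum_(0 <= p < K | strip m p) pointw n p <= e / 4.
    rewrite -sumrB; apply: le_trans (Hn1 n K nn1).
    by apply: ler_sum => p _; rewrite distrC ler_norm.
  have := @sum_strip_le m x K1 K x_ge0 KK1.
  lra.
rewrite (@layout_cells n m K)//; last by move=> k km; exact: leq_trans (HK2 k km) KK2.
apply: le_trans (layout_lip _ _ _ _ _ xi1) _.
rewrite sum_points -/M.
have := Hn1 n K nn1.
have : `|M%:R / n%:R - t| <= e / 4.
  by rewrite ler_norml; apply/andP; split; lra.
lra.
Qed.

(** Walks of two levels are compared with the layout of the limit weights. As
[walk_approx] is uniform in the labels, so is this. *)
Lemma walk_cauchy (T e : R) : 0 < e -> exists n0, forall n n',
  (n0 <= n)%N -> (n0 <= n')%N -> forall xi, (forall p, `|xi p| <= 1) ->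
  forall t, 0 <= t <= T -> `|walk n xi t - walk n' xi t| <= e.
Proof.
move=> e0; have e2 : 0 < e / 2 by rewrite divr_gt0.
have [m [_ [_ [n0 Hn0]]]] := walk_approx T e2.
exists n0 => n n' nn nn' xi xi1 t tT.
have [K0 HK0] := Hn0 _ nn; have [K0' HK0'] := Hn0 _ nn'.
have := HK0 _ (leq_maxl K0 K0') xi xi1 t tT.
have := HK0' _ (leq_maxr K0 K0') xi xi1 t tT.
set b := layout _ _ _ _; move=> h1 h2.
apply: le_trans (ler_distD b _ _) _.
by rewrite (splitr e) lerD// distrC.
Qed.

(** Points of large index have a small total limit weight. Once they are given
weight 0, all remaining labels are [c], and the layout is [c] times the elapsed
time. *)
Lemma walk_const (t e : R) : 0 <= t -> 0 < e -> exists K0, forall xi c,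
  (forall p, `|xi p| <= 1) -> (forall p, (p < K0)%N -> xi p = c) ->
  exists n0, forall n, (n0 <= n)%N -> `|walk n xi t - c * t| <= e.
Proof.
move=> t0 e0; have e3 : 0 < e / 4 by rewrite divr_gt0.
have [m [K1 [HK1 [n0 Hn0]]]] := walk_approx t e3.
have [K2 HK2] := x_tail m e3.
exists (maxn K1 K2) => xi c xi1 xic; exists n0 => n nn.
have [K3 HK3] := Hn0 n nn.
set K0 := maxn K1 K2 in xic.
pose K := maxn K0 K3.
have tt : 0 <= t <= t by rewrite t0 lexx.
apply: le_trans (ler_distD (layout x xi (points m K) t) _ _) _.
(* [x'] keeps the points whose label is [c] *)
pose x' p := if (p < K0)%N then x p else 0.
have x'0 p : 0 <= x' p by rewrite /x'; case: ifP.
have sx' : \sum_(p <- points m K) x' p = \sum_(0 <= p < K0 | strip m p) x p.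
  rewrite sum_points (big_cat_nat _ (leq_maxl K0 K3))//= [X in _ + X]big1_seq; last first.
    by move=> p; rewrite mem_index_iota /x' => /andP[_ /andP[+ _]]; rewrite ltnNge => ->.
  rewrite addr0 big_nat_cond [RHS]big_nat_cond; apply: eq_bigr => p /andP[/andP[_ pK] _].
  by rewrite /x' pK.
have -> : c * t = layout x' xi (points m K) t.
  rewrite (@layout_cst _ _ _ c)//.
    congr (_ * _); rewrite min_r// sx'; apply: le_trans (ltW HK1) _.
    by apply: sum_strip_le => //; exact: leq_maxl.
  by move=> p _; rewrite /x'; case: ifP => [/xic->//|]; rewrite eqxx.
have h1 := HK3 K (leq_maxr _ _) xi xi1 t tt.
have := layout_lip x x' (points m K) t t xi1.
rewrite subrr normr0 add0r sum_points.
have -> : \sum_(0 <= p < K | strip m p) `|x p - x' p| = \sum_(K0 <= p < K | strip m p) x p.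
  rewrite (big_cat_nat _ (leq_maxl K0 K3))//= [X in X + _]big1_seq ?add0r; last first.
    by move=> p; rewrite mem_index_iota /x' => /andP[_ /andP[_ ->]]; rewrite subrr normr0.
  rewrite big_nat_cond [RHS]big_nat_cond; apply: eq_bigr => p /andP[/andP[pK _] _].
  by rewrite /x' ltnNge pK/= subr0 ger0_norm.
have h3 : \sum_(K0 <= p < K | strip m p) x p <= e / 4.
  apply: le_trans (HK2 K _); last by rewrite /K /K0; lia.
  rewrite [leRHS](big_cat_nat (n := K0))//=; [|exact: leq_maxr|exact: leq_maxl].
  by rewrite lerDr sumr_ge0.
lra.
Qed.

End cells.

(** * Powers of integers *)

Section powers.
Context {R : realType}.

Lemma ler_powRN (p x y : R) : 0 <= p -> 0 < x -> x <= y -> y `^ (- p) <= x `^ (- p).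
Proof.
move=> p0 x0 xy; have y0 : 0 < y by exact: lt_le_trans xy.
by rewrite !powRN lef_pV2 ?posrE ?powR_gt0// ge0_ler_powR// nnegrE ltW.
Qed.

Lemma cvg_powR (T : Type) (F : set_system T) {FF : Filter F} (f : T -> R) (l p : R) :
  0 < l -> f x @[x --> F] --> l -> f x `^ p @[x --> F] --> l `^ p.
Proof.
move=> l0 fl; apply: (@cvg_comp _ _ _ f (fun y => y `^ p) F (nbhs l)) => //.
have : differentiable (fun y : R => y `^ p) l.
  by apply/derivable1_diffP; apply: derivable_powR; rewrite in_itv/= andbT.
by move/differentiable_continuous.
Qed.

(** Comparison of a sum with an integral, one term at a time. *)
Lemma powR_diff (p : R) (j : nat) : 0 < p -> (0 < j)%N ->
  p * j.+1%:R `^ (- p - 1) <= j%:R `^ (- p) - j.+1%:R `^ (- p)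
    <= p * j%:R `^ (- p - 1).
Proof.
move=> p0 j0; have jR0 : 0 < j%:R :> R by rewrite ltr0n.
have := @MVT R (fun x => x `^ (- p)) (fun x => - p * x `^ (- p - 1)) j%:R j.+1%:R.
rewrite ltr_nat ltnSn => /(_ isT) [x||x].
- by rewrite in_itv/= => /andP[jx _]; apply: is_derive1_powR; exact: lt_trans jx.
- apply: continuous_in_subspaceT => x; rewrite inE/= in_itv/= => /andP[jx _].
  by apply: cvg_powR => //; exact: lt_le_trans jx.
rewrite in_itv/= => /andP[jx xj] e.
have -> : j%:R `^ (- p) - j.+1%:R `^ (- p) = p * x `^ (- p - 1).
  by rewrite -[LHS]opprB e -natr1 addrAC subrr add0r mulr1 mulNr opprK.
have p1 : - p - 1 = - (p + 1) by rewrite opprD.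
have pp : 0 <= p + 1 by lra.
by rewrite !ler_pM2l// p1 !ler_powRN// ?ltW//; exact: lt_trans jx.
Qed.

Lemma zeta_bounded (p : R) : 1 < p ->
  exists C, forall n, \sum_(1 <= l < n) l%:R `^ (- p) <= C.
Proof.
move=> p1; have q0 : 0 < p - 1 by lra.
exists (1 + (p - 1)^-1) => n.
case: n => [|n]; first by rewrite big_geq// addr_ge0// invr_ge0 ltW.
have [->|n0] := posnP n; first by rewrite big_geq// addr_ge0// invr_ge0 ltW.
rewrite big_nat_recl// powR1 lerD2l.
apply: (@le_trans _ _ (\sum_(1 <= l < n) ((p - 1)^-1 * (l%:R `^ (- (p - 1)) - l.+1%:R `^ (- (p - 1)))))).
  rewrite big_nat [leRHS]big_nat; apply: ler_sum => l /andP[l0 _].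
  have /andP[+ _] := powR_diff q0 l0.
  rewrite (_ : - (p - 1) - 1 = - p); last by lra.
  by rewrite mulrC ler_pdivlMl// mulrC.
rewrite -mulr_sumr ler_piMr ?invr_ge0 ?ltW//.
under eq_bigr do rewrite -opprB.
rewrite sumrN telescope_sumr// opprB powR1.
by rewrite ltrBlDr ltrDl powR_gt0// ltr0n.
Qed.

Lemma powRN_cvg0 (p : R) : 0 < p -> (n%:R `^ (- p) : R) @[n --> \oo] --> 0.
Proof.
move=> p0; apply/cvgrPdist_le => e e0; near=> n.
rewrite sub0r normrN ger0_norm ?powR_ge0//.
have n0 : e `^ (- p^-1) <= n%:R by near: n; exact: nbhs_infty_ger.
have := ler_powRN (ltW p0) (powR_gt0 _ e0) n0.
by rewrite -powRrM mulrNN mulVf ?lt0r_neq0// powRr1// ltW.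
Unshelve. all: by end_near. Qed.

Lemma ratioS_cvg1 : (j%:R / j.+1%:R : R) @[j --> \oo] --> (1 : R).
Proof.
rewrite [X in X @ _](_ : _ = fun j : nat => 1 - (j.+1%:R)^-1 : R); last first.
  apply/funext => j; rewrite -[X in X / _](addrK 1) natr1 mulrBl divff//.
  by rewrite mul1r.
rewrite -[X in _ --> X]subr0; apply: cvgB; first exact: cvg_cst.
exact: cvg_harmonic.
Qed.

End powers.

(** * Quantiles of a regularly varying law *)

Section quantile.
Context {R : realType}.
Variables (beta c : R) (b : nat -> R).
Hypothesis beta01 : 0 < beta < 1.
Hypothesis c0 : 0 < c.
Hypothesis b_ge0 : forall i, 0 <= b i.
Hypothesis b_asymp : b i / (c * i%:R `^ (- beta - 1)) @[i --> \oo] --> (1 : R).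

Definition cumul i : R := \sum_(1 <= j < i.+1) b j.

Hypothesis cumul_cvg : cumul i @[i --> \oo] --> (1 : R).

Lemma pow1r (p : R) : 1 `^ p = 1. Proof. by rewrite powR1. Qed.

Lemma beta_gt0 : 0 < beta. Proof. by case/andP: beta01. Qed.

Lemma cumulS i : cumul i.+1 = cumul i + b i.+1.
Proof. by rewrite /cumul big_nat_recr. Qed.

Lemma cumul_ge0 i : 0 <= cumul i.
Proof. exact: sumr_ge0. Qed.

Lemma cumul_le i j : (i <= j)%N -> cumul i <= cumul j.
Proof.
move=> ij; rewrite /cumul [leRHS](@big_cat_nat _ _ _ i.+1)//= lerDl.
exact: sumr_ge0.
Qed.

Lemma cumul_le1 i : cumul i <= 1.
Proof.
have <- : limn cumul = 1 by exact/cvg_lim.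
apply: nondecreasing_cvgn_le; last by apply/cvg_ex; exists 1.
by move=> j k; exact: cumul_le.
Qed.

Definition tail_const : R := c / beta.
Local Notation A := tail_const.

Lemma tail_const_gt0 : 0 < A. Proof. exact: divr_gt0 c0 beta_gt0. Qed.

Definition power_step j : R := j%:R `^ (- beta) - j.+1%:R `^ (- beta).

(** Tails of regularly varying sums are obtained by comparison with a
telescoping series with equivalent terms. *)
Lemma increment_ratio : b j.+1 / power_step j @[j --> \oo] --> A.
Proof.
have b0 := beta_gt0; have A0 := tail_const_gt0.
have h1 : b j.+1 / (c * j.+1%:R `^ (- beta - 1)) @[j --> \oo] --> (1 : R).
  by move: b_asymp; rewrite -cvg_shiftS.
have h2 : (beta * j.+1%:R `^ (- beta - 1)) / power_step j @[j --> \oo] --> (1 : R).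
  apply: (@squeeze_cvgr _ _ _ _ (fun j => (j%:R / j.+1%:R) `^ (beta + 1)) (fun=> 1)).
  - near=> j; have j0 : (0 < j)%N by near: j; exact: nbhs_infty_gt.
    have /andP[d1 d2] := powR_diff beta_gt0 j0.
    have e : - beta - 1 = - (beta + 1) by rewrite opprD.
    have dj : 0 < power_step j.
      by apply: lt_le_trans d1; rewrite mulr_gt0// powR_gt0// ltr0n.
    rewrite ler_pdivrMr// mul1r d1 andbT ler_pdivlMr//.
    apply: (le_trans (ler_wpM2l (powR_ge0 _ _) d2)).
    rewrite mulrCA e ler_pM2l// powRM// !powRN mulrAC divff ?mul1r//.
      by rewrite -powRN -powR_inv1// -powRrM mulN1r.
    by rewrite lt0r_neq0// powR_gt0// ltr0n.
  - rewrite -[X in _ --> X](pow1r (beta + 1)).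
    by apply: cvg_powR => //; exact: ratioS_cvg1.
  - exact: cvg_cst.
rewrite [X in X @ _](_ : _ = fun j => A * ((b j.+1 / (c * j.+1%:R `^ (- beta - 1))) *
  ((beta * j.+1%:R `^ (- beta - 1)) / power_step j))); last first.
  apply/funext => j; rewrite /tail_const.
  have p0 : j.+1%:R `^ (- beta - 1) != 0 :> R by rewrite lt0r_neq0// powR_gt0// ltr0n.
  rewrite !mulrA; congr (_ / _); field.
  by rewrite p0 !lt0r_neq0.
rewrite -[X in _ --> X]mulr1; apply: cvgMr.
by rewrite -[X in _ --> X]mulr1; apply: cvgM.
Unshelve. all: by end_near. Qed.

Lemma tail_asymp : (1 - cumul i) * i%:R `^ beta @[i --> \oo] --> A.
Proof.
have b0 := beta_gt0; have A0 := tail_const_gt0.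
apply/cvgrPdist_le => e e0.
have [i0 _ Hi0] := (cvgrPdist_le _ _).1 increment_ratio e e0.
near=> i.
have i1 : (0 < i)%N by near: i; exact: nbhs_infty_gt.
have ii0 : (i0 <= i)%N by near: i; exact: nbhs_infty_ge.
have dj j : (0 < j)%N -> 0 < power_step j.
  move=> j0; have /andP[d1 _] := powR_diff beta_gt0 j0.
  by apply: lt_le_trans d1; rewrite mulr_gt0// powR_gt0// ltr0n.
have B j : (i <= j)%N -> (A - e) * power_step j <= b j.+1 <= (A + e) * power_step j.
  move=> ij; have j0 : (0 < j)%N by lia.
  have /= := Hi0 j (leq_trans ii0 ij); rewrite distrC ler_distl.
  by rewrite ler_pdivlMr ?dj// ler_pdivrMr ?dj.
have C n : (i <= n)%N ->
    (A - e) * (i%:R `^ (- beta) - n%:R `^ (- beta)) <= cumul n - cumul i <=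
    (A + e) * (i%:R `^ (- beta) - n%:R `^ (- beta)).
  elim: n => [|n IH]; first by rewrite leqn0 => /eqP ->; rewrite !subrr !mulr0 lexx.
  rewrite leq_eqVlt => /predU1P[->|]; first by rewrite !subrr !mulr0 lexx.
  rewrite ltnS => il; have := IH il; have := B _ il.
  rewrite cumulS /power_step !mulrBr => /andP[h1 h2] /andP[h3 h4]; apply/andP; split; lra.
have u0 : 0 < i%:R `^ beta :> R by rewrite powR_gt0// ltr0n.
have L1 k : (fun n => k * (i%:R `^ (- beta) - n%:R `^ (- beta)) : R) @ \oo -->
    k * (i%:R `^ (- beta) - 0).
  by apply: cvgMr; apply: cvgB; [exact: cvg_cst|exact: powRN_cvg0].
have L2 : (fun n => cumul n - cumul i) @ \oo --> 1 - cumul i.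
  by apply: cvgB; [exact: cumul_cvg|exact: cvg_cst].
have D1 : (A - e) * (i%:R `^ (- beta) - 0) <= 1 - cumul i.
  by apply: (ler_cvg_to (L1 _) L2); exists i => // n /= /C /andP[].
have D2 : 1 - cumul i <= (A + e) * (i%:R `^ (- beta) - 0).
  by apply: (ler_cvg_to L2 (L1 _)); exists i => // n /= /C /andP[].
move: D1 D2; rewrite subr0 powRN => D1 D2.
by rewrite distrC ler_distl -ler_pdivrMr// D1 -ler_pdivlMr.
Unshelve. all: by end_near. Qed.

Lemma cumul_lt1 i : cumul i < 1.
Proof.
have b0 := beta_gt0; have A0 := tail_const_gt0.
rewrite ltNge; apply/negP => c1.
have : (1 - cumul j) * j%:R `^ beta @[j --> \oo] --> (0 : R).
  apply: (@cvg_near_cst _ _ _ _ _ _); near=> j.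
  have -> : cumul j = 1; last by rewrite subrr mul0r.
  apply/eqP; rewrite eq_le cumul_le1 (le_trans c1)// cumul_le//.
  by near: j; exact: nbhs_infty_ge.
move=> /(cvg_unique _ tail_asymp) => /(_ (@norm_hausdorff _ _)) AA.
by have := tail_const_gt0; rewrite AA ltxx.
Unshelve. all: by end_near. Qed.

Lemma quantile_ex v : 0 < v -> exists i, expR (- v) <= cumul i.
Proof.
move=> v0; have e1 : expR (- v) < 1 by rewrite -expR0 ltr_expR oppr_lt0.
have : \forall i \near \oo, expR (- v) <= cumul i.
  exact: (cvgr_ge _ cumul_cvg).
by case=> i _ /(_ i (leqnn i)); exists i.
Qed.

(** The quantile function of the law with distribution function [cumul b], at
level [exp(-v)]: when [v] is an exponential variable of parameter 1, [exp(-v)] is uniform and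
[quantile v] has the law [b]. Small [v] correspond to large quantiles. *)
Definition quantile v : nat :=
  if pselect (exists i, expR (- v) <= cumul i) is left h then ex_minn h else 0%N.

Lemma quantileP v i : 0 < v -> (quantile v <= i)%N = (expR (- v) <= cumul i).
Proof.
move=> v0; rewrite /quantile; case: pselect => [h|[]]; last exact: quantile_ex.
case: ex_minnP => j hj jmin; apply/idP/idP => [ji|/jmin//].
exact: le_trans (cumul_le ji).
Qed.

Lemma quantile_gt0 v : 0 < v -> (0 < quantile v)%N.
Proof.
move=> v0; rewrite ltnNge quantileP// -ltNge.
by rewrite /cumul big_geq// expR_gt0.
Qed.

Lemma quantile_anti v v' : 0 < v -> v <= v' -> (quantile v' <= quantile v)%N.
Proof.
move=> v0 vv; have v'0 : 0 < v' by exact: lt_le_trans vv.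
rewrite quantileP//; apply: (@le_trans _ _ (expR (- v))).
  by rewrite ler_expR lerN2.
by rewrite -quantileP.
Qed.

Lemma quantile_cvgy : quantile v @[v --> 0^'+] --> \oo.
Proof.
have e0 : expR (- v) @[v --> 0^'+] --> (1 : R).
  have o0 : - v @[v --> 0^'+] --> (0 : R).
    rewrite -[X in _ --> X]oppr0; apply: cvgN.
    by apply: cvg_at_right_filter; exact: cvg_id.
  rewrite -expR0; apply: (cvg_comp _ expR o0).
  exact: continuous_expR.
apply/cvgnyPgt => i; near=> v.
have v0 : 0 < v by near: v; exact: nbhs_right_gt.
rewrite ltnNge quantileP// -ltNge.
near: v; apply: (cvgr_gt _ e0); exact: cumul_lt1.
Unshelve. all: by end_near. Qed.

(** By definition of a quantile, [1 - exp(-v)] lies between two successive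
values of the tail of the law, and is equivalent to [v]. *)
Lemma quantile_scaling : v * (quantile v)%:R `^ beta @[v --> 0^'+] --> A.
Proof.
have b0 := beta_gt0; have A0 := tail_const_gt0.
pose y v : R := 1 - expR (- v).
have yA : y v * (quantile v)%:R `^ beta @[v --> 0^'+] --> A.
  pose r j : R := ((1 - cumul j.-1) * j.-1%:R `^ beta) * (j%:R / j.-1%:R) `^ beta.
  have rA : r j @[j --> \oo] --> A.
    rewrite -cvg_shiftS /r -(mulr1 A); apply: cvgM; first exact: tail_asymp.
    rewrite -[X in _ --> X](pow1r beta); apply: cvg_powR => //.
    rewrite [X in X @ _](_ : _ = fun j : nat => (j%:R / j.+1%:R)^-1 : R); last first.
      by apply/funext => j; rewrite invfM invrK mulrC.
    rewrite -[X in _ --> X]invr1; apply: cvgV => //; exact: ratioS_cvg1.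
  apply: (@squeeze_cvgr _ _ _ _ (fun v => (1 - cumul (quantile v)) * (quantile v)%:R `^ beta)
    (fun v => r (quantile v))).
  - near=> v; have v0 : 0 < v by near: v; exact: nbhs_right_gt.
    have q1 : (1 < quantile v)%N.
      by near: v; move/cvgnyPgt: quantile_cvgy; exact.
    have qR : 0 < (quantile v).-1%:R :> R by rewrite ltr0n; lia.
    rewrite ler_wpM2r ?powR_ge0//=; last first.
      by rewrite /y lerB// -quantileP.
    rewrite /r -mulrA -powRM ?divr_ge0// mulrCA divff ?mulr1 ?lt0r_neq0//.
    rewrite ler_wpM2r ?powR_ge0// /y lerB// leNgt; apply/negP => /ltW.
    by rewrite -quantileP//; lia.
  - exact: (cvg_comp _ _ quantile_cvgy tail_asymp).
  - exact: (cvg_comp _ _ quantile_cvgy rA).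
have vy : v / y v @[v --> 0^'+] --> (1 : R).
  have y0 v : 0 < v -> 0 < y v by move=> v0; rewrite subr_gt0 -expR0 ltr_expR oppr_lt0.
  apply: (@squeeze_cvgr _ _ _ _ (fun=> 1) (fun v => 1 + v)).
  - near=> v; have v0 : 0 < v by near: v; exact: nbhs_right_gt.
    rewrite ler_pdivlMr ?y0// mul1r ler_pdivrMr ?y0// /y; apply/andP; split.
      have := expR_ge1Dx (- v); lra.
    have e1 : expR (- v) <= (1 + v)^-1.
      by rewrite expRN lef_pV2 ?posrE ?expR_gt0 ?addr_gt0//; exact: expR_ge1Dx.
    have v1 : 0 < 1 + v by lra.
    have : (1 + v) * expR (- v) <= 1 by rewrite mulrC -ler_pdivlMr// div1r.
    lra.
  - exact: cvg_cst.
  - rewrite -[X in _ --> X]addr0; apply: cvgD; first exact: cvg_cst.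
    by apply: cvg_at_right_filter; exact: cvg_id.
have vyA : (v / y v) * (y v * (quantile v)%:R `^ beta) @[v --> 0^'+] --> A.
  by rewrite -[A]mul1r; exact: cvgM vy yA.
apply: cvg_trans vyA; apply: near_eq_cvg; near=> v.
have v0 : 0 < v by near: v; exact: nbhs_right_gt.
have y0 : y v != 0 by rewrite lt0r_neq0// subr_gt0 -expR0 ltr_expR oppr_lt0.
by rewrite /= mulrA divfK.
Unshelve. all: by end_near. Qed.

(** The scaling constant of the limit: the rescaled sojourn time attached to a
point of height [a] tends to [kappa * a^(-1/beta)]. *)
Definition kappa : R := A `^ beta^-1.

Lemma kappa_gt0 : 0 < kappa. Proof. exact/powR_gt0/tail_const_gt0. Qed.

Lemma quantile_asymp : v `^ beta^-1 * (quantile v)%:R @[v --> 0^'+] --> kappa.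
Proof.
have b0 := beta_gt0; have A0 := tail_const_gt0.
have h : (v * (quantile v)%:R `^ beta) `^ beta^-1 @[v --> 0^'+] --> kappa.
  exact: cvg_powR A0 quantile_scaling.
apply: cvg_trans h; apply: near_eq_cvg; near=> v.
have v0 : 0 < v by near: v; exact: nbhs_right_gt.
by rewrite /= powRM ?powR_ge0 ?ltW// -powRrM divff ?lt0r_neq0// powRr1.
Unshelve. all: by end_near. Qed.

(** The asymptotics near 0 bound the quantile there; for larger [v] it is bounded
by monotonicity, whence the additional constant. *)
Lemma quantile_bound : exists2 C, 0 < C & forall v, 0 < v ->
  (quantile v)%:R <= C * (v `^ (- beta^-1) + 1).
Proof.
have b0 := beta_gt0; have A0 := tail_const_gt0.
have h : \forall v \near 0^'+, v `^ beta^-1 * (quantile v)%:R <= kappa + 1.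
  by apply: (cvgr_le _ quantile_asymp); rewrite ltrDl.
have [e /= e0 He] := h.
pose v1 := e / 2; have v10 : 0 < v1 by rewrite divr_gt0.
have k0 := kappa_gt0.
exists (kappa + 1 + (quantile v1)%:R); first by rewrite ltr_wpDr// addr_gt0.
move=> v v0; have p0 : 0 < v `^ (- beta^-1) by rewrite powR_gt0.
have q0 : 0 <= (quantile v1)%:R :> R by [].
have [vv|vv] := leP v v1.
  have := He v; rewrite /= sub0r normrN gtr0_norm// => /(_ _ v0) H.
  have {H} : v `^ beta^-1 * (quantile v)%:R <= kappa + 1.
    by apply: H; apply: le_lt_trans vv _; rewrite /v1; lra.
  rewrite mulrC -ler_pdivlMr ?powR_gt0// -powRN; nra.
have : (quantile v <= quantile v1)%N by apply: quantile_anti => //; exact: ltW.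
rewrite -(ler_nat R); nra.
Qed.

(** The number of cells per unit of time at level [n]. The power [n^beta] is the
number of sojourn times that fit in time [n], up to a random factor. *)
Definition ncells n : nat := (Num.truncn (n%:R `^ beta)).+1.

Lemma ncells_bounds n : n%:R `^ beta <= (ncells n)%:R <= n%:R `^ beta + 1.
Proof.
by rewrite ltW ?truncnS_gt//= -natr1 lerD2r truncn_le// powR_ge0.
Qed.

Lemma ncells_cvgy : (ncells n)%:R^-1 @[n --> \oo] --> (0 : R).
Proof.
apply: (@squeeze_cvgr _ _ _ _ (fun=> 0) (fun n => n%:R `^ (- beta))).
- near=> n; rewrite invr_ge0 ler0n/= powRN lef_pV2 ?posrE ?ltr0n//.
    by case/andP: (ncells_bounds n).
  by rewrite powR_gt0// ltr0n; near: n; exact: nbhs_infty_gt.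
- exact: cvg_cst.
- exact/powRN_cvg0/beta_gt0.
Unshelve. all: by end_near. Qed.

Lemma ncells_ratio : (ncells n)%:R `^ beta^-1 / n%:R @[n --> \oo] --> (1 : R).
Proof.
have b0 := beta_gt0; have A0 := tail_const_gt0.
have h : (ncells n)%:R / n%:R `^ beta @[n --> \oo] --> (1 : R).
  apply: (@squeeze_cvgr _ _ _ _ (fun=> 1) (fun n => 1 + n%:R `^ (- beta))).
  - near=> n; have /andP[n1 n2] := ncells_bounds n.
    have p0 : 0 < n%:R `^ beta :> R.
      by rewrite powR_gt0// ltr0n; near: n; exact: nbhs_infty_gt.
    by rewrite ler_pdivlMr// mul1r n1 ler_pdivrMr// powRN mulrDl mul1r mulVf ?lt0r_neq0.
  - exact: cvg_cst.
  - rewrite -[X in _ --> X]addr0; apply: cvgD; first exact: cvg_cst.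
    exact: powRN_cvg0.
have h' : ((ncells n)%:R / n%:R `^ beta) `^ beta^-1 @[n --> \oo] --> (1 : R).
  by rewrite -[X in _ --> X](pow1r beta^-1); exact: cvg_powR.
apply: cvg_trans h'; apply: near_eq_cvg; near=> n.
rewrite /= powRM ?invr_ge0 ?powR_ge0//; congr (_ * _).
by rewrite -powRN -powRrM mulNr divff ?lt0r_neq0// powR_inv1.
Unshelve. all: by end_near. Qed.

(** As [beta < 1], sojourn times of bounded size, one for each cell, do not
contribute in the limit. *)
Lemma ncells_small : (ncells n)%:R / n%:R @[n --> \oo] --> (0 : R).
Proof.
apply: (@squeeze_cvgr _ _ _ _ (fun=> 0) (fun n => n%:R `^ (- (1 - beta)) + n%:R `^ (- 1))).
- near=> n; have n0 : 0 < n%:R :> R by rewrite ltr0n; near: n; exact: nbhs_infty_gt.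
  rewrite divr_ge0//= ler_pdivrMr//; have /andP[_ n2] := ncells_bounds n.
  apply: (le_trans n2); rewrite mulrDl powR_inv1 ?(ltW n0)// mulVf ?lt0r_neq0// lerD2r.
  rewrite -[X in _ * X]powRr1 ?(ltW n0)// -powRD; last by rewrite lt0r_neq0// implybT.
  by rewrite le_eqVlt; apply/orP; left; apply/eqP; congr (_ `^ _); lra.
- exact: cvg_cst.
- rewrite -[X in _ --> X]addr0; apply: cvgD; apply: powRN_cvg0 => //.
  by case/andP: beta01 => _; rewrite subr_gt0.
Unshelve. all: by end_near. Qed.

Lemma powR_inv (y p : R) : 0 < y -> y^-1 `^ p = (y `^ p)^-1.
Proof.
by move=> y0; rewrite -[y^-1]powR_inv1 ?ltW// -powRrM mulN1r powRN.
Qed.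

Lemma rescaled_quantile_cvg (a : R) : 0 < a ->
  (quantile (a / (ncells n)%:R))%:R / n%:R @[n --> \oo] --> kappa * a `^ (- beta^-1).
Proof.
move=> a0.
have h0 : a / (ncells n)%:R @[n --> \oo] --> 0^'+.
  move=> P [e /= e0 He].
  have h : a / (ncells n)%:R @[n --> \oo] --> (0 : R).
    by rewrite -[X in _ --> X](mulr0 a); apply: cvgMr; exact: ncells_cvgy.
  suff : \forall n \near \oo, P (a / (ncells n)%:R) by [].
  near=> n; have an0 : 0 < a / (ncells n)%:R by rewrite divr_gt0// ltr0n.
  apply: He => //=; rewrite sub0r normrN gtr0_norm//.
  by near: n; exact: (cvgr_lt _ h).
have h1 : (a / (ncells n)%:R) `^ beta^-1 * (quantile (a / (ncells n)%:R))%:R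
    @[n --> \oo] --> kappa.
  exact: (cvg_comp _ _ h0 quantile_asymp).
have h2 : a `^ (- beta^-1) *
   (((a / (ncells n)%:R) `^ beta^-1 * (quantile (a / (ncells n)%:R))%:R) *
    ((ncells n)%:R `^ beta^-1 / n%:R)) @[n --> \oo] --> kappa * a `^ (- beta^-1).
  rewrite [X in _ --> X]mulrC; apply: cvgMr.
  by rewrite -[kappa]mulr1; apply: cvgM => //; exact: ncells_ratio.
apply: cvg_trans h2; apply: near_eq_cvg; near=> n => /=.
have N0 : 0 < (ncells n)%:R :> R by rewrite ltr0n.
rewrite powRM ?invr_ge0 ?(ltW a0) ?(ltW N0)// powRN powR_inv//.
rewrite mulrACA !mulrA; congr (_ / _).
have p1 : a `^ beta^-1 != 0 by rewrite lt0r_neq0// powR_gt0.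
have p2 : (ncells n)%:R `^ beta^-1 != 0 :> R by rewrite lt0r_neq0// powR_gt0.
by field; rewrite p1 p2.
Unshelve. all: by end_near. Qed.

Lemma rescaled_quantile_bound : exists2 C, 0 < C & forall n a, (0 < n)%N -> 0 < a ->
  (quantile (a / (ncells n)%:R))%:R / n%:R <= C * (a `^ (- beta^-1) + n%:R^-1).
Proof.
have b0 := beta_gt0.
have [C C0 HC] := quantile_bound.
have t0 : 0 < 2 `^ beta^-1 :> R by rewrite powR_gt0.
exists (C * (2 `^ beta^-1 + 1)); first by rewrite mulr_gt0// addr_gt0.
move=> n a n0 a0; have nR0 : 0 < n%:R :> R by rewrite ltr0n.
have N0 : 0 < (ncells n)%:R :> R by rewrite ltr0n.
have := HC _ (divr_gt0 a0 N0).
rewrite powRM ?invr_ge0 ?(ltW a0) ?(ltW N0)// powR_inv// -powRN opprK.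
rewrite ler_pdivrMr// => h; apply: (le_trans h); rewrite -!mulrA ler_pM2l//.
have Nn : (ncells n)%:R `^ beta^-1 <= 2 `^ beta^-1 * n%:R.
  have ne : n%:R = (n%:R `^ beta) `^ beta^-1 :> R.
    by rewrite -powRrM divff ?lt0r_neq0// powRr1// ltW.
  rewrite [X in _ * X]ne -powRM ?powR_ge0//.
  rewrite ge0_ler_powR ?invr_ge0 ?nnegrE ?mulr_ge0 ?powR_ge0 ?(ltW b0)//.
  have /andP[_ h2] := ncells_bounds n; apply: (le_trans h2).
  rewrite mulr_natl mulr2n lerD2l.
  have : n%:R `^ 0 <= n%:R `^ beta :> R by rewrite ler_powR ?(ltW b0)// ler1n.
  by rewrite powRr0.
have pa : 0 < a `^ (- beta^-1) by rewrite powR_gt0.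
rewrite [(_ + n%:R^-1) * _]mulrDl mulVf ?lt0r_neq0//.
set p := a `^ _ in pa *; set q := 2 `^ _ in t0 Nn *.
apply: (@le_trans _ _ (p * (q * n%:R) + 1)); last first.
  have : 0 <= p * n%:R by rewrite mulr_ge0 ?ltW.
  by nra.
by rewrite lerD2r ler_wpM2l// ltW.
Qed.

End quantile.

(** * Walks driven by a configuration of points *)

Section first_point.
Context {R : realType}.
Variables (pr : pred nat) (s a : nat -> R).

Definition in_cell (N k p : nat) := pr p && (Num.truncn (N%:R * s p) == k).

(** Ties in height are broken by the index, so that the lowest point of a cell is
unique for every configuration and depends measurably on it. *)
Definition is_first N k p := in_cell N k p /\
  forall q, in_cell N k q -> a p < a q \/ a p = a q /\ (p <= q)%N.

Definition first N k := xget 0%N [set p | is_first N k p].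

Lemma is_first_uniq N k p q : is_first N k p -> is_first N k q -> p = q.
Proof.
move=> [pk pm] [qk qm]; have := pm _ qk; have := qm _ pk.
move=> [h1|[h1 h2]] [h3|[h3 h4]].
- by move: (lt_trans h1 h3); rewrite ltxx.
- by move: h1; rewrite h3 ltxx.
- by move: h3; rewrite h1 ltxx.
- by apply/eqP; rewrite eqn_leq h4 h2.
Qed.

Lemma firstE N k p : is_first N k p -> first N k = p.
Proof.
move=> pf; rewrite /first; case: xgetP => [q _ qf|/(_ p)//].
exact: (is_first_uniq qf pf).
Qed.

End first_point.

Lemma big_nat_cond_recr {R : realType} (P : pred nat) (F : nat -> R) m n : (m <= n)%N ->
  \sum_(m <= i < n.+1 | P i) F i =
  \sum_(m <= i < n | P i) F i + (if P n then F n else 0).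
Proof. by move=> mn; rewrite big_mkcond big_nat_recr//= -big_mkcond. Qed.

Section configuration.
Context {R : realType}.
Variables (beta c : R) (b : nat -> R).
Hypothesis beta01 : 0 < beta < 1.
Hypothesis c0 : 0 < c.
Hypothesis b_ge0 : forall i, 0 <= b i.
Hypothesis b_asymp : b i / (c * i%:R `^ (- beta - 1)) @[i --> \oo] --> (1 : R).
Hypothesis cumul_cvg : cumul b i @[i --> \oo] --> (1 : R).
Variables (pr : pred nat) (s a : nat -> R).

(** The properties of a configuration under which its walks converge. The points
are the indices satisfying [pr], with times [s] and heights [a];
[gc_large] provides infinitely many jumps of size at least [kappa], so that
the limit weights have an infinite sum. *)
Record good_config : Prop := GoodConfig {
  gc_s : forall p, pr p -> 0 < s p;
  gc_a : forall p, pr p -> 0 < a p;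
  gc_sum : forall m, exists C : R, forall K,
    \sum_(0 <= p < K | strip pr s m p) a p `^ (- beta^-1) <= C;
  gc_inj : forall p q, pr p -> pr q -> s p = s q -> p = q;
  gc_cell : forall N k, (0 < N)%N -> exists p, in_cell pr s N k p;
  gc_large : forall m : nat, exists p, [/\ pr p, m%:R <= s p & a p <= 1] }.

Hypothesis gc : good_config.

Let N := ncells beta.

(** The first sojourn time is 1 instead of a quantile, because an orbit starts
at level 0 of the tower. *)
Definition cell_weight n k : R :=
  if k == 0%N then n%:R^-1 else
  (quantile b (a (first pr s a (N n) k) / (N n)%:R))%:R / n%:R.

Definition limit_weight p : R :=
  if pr p then kappa beta c * a p `^ (- beta^-1) else 0.

(** Low points have large limit weights, and these are summable. *)
Lemma low_points_finite m (r : R) : 0 < r ->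
  exists K, forall q, strip pr s m q -> a q <= r -> (q < K)%N.
Proof.
move=> r0; have y0 : 0 < r `^ (- beta^-1) by rewrite powR_gt0.
have [K0 HK0] := x_tail (gc_sum gc) m (divr_gt0 y0 (ltr0n _ 2)).
exists K0 => q sq aq; rewrite ltnNge; apply/negP => Kq.
have := HK0 q.+1 (leqW Kq); rewrite big_nat_cond_recr// sq leNgt => /negP; apply.
have b0 : 0 < beta by case/andP: beta01.
have : r `^ (- beta^-1) <= a q `^ (- beta^-1).
  by apply: ler_powRN => //; [rewrite invr_ge0 ltW|case/andP: sq => /(gc_a gc)].
have : 0 <= \sum_(K0 <= i < q | strip pr s m i) a i `^ (- beta^-1).
  by apply: sumr_ge0 => i _; exact: powR_ge0.
lra.
Qed.

Lemma in_cell_strip M k q : (0 < M)%N -> in_cell pr s M k q -> strip pr s (k %/ M).+1 q.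
Proof.
move=> M0 /andP[pq /eqP kq]; rewrite /strip pq/=.
have := @cell_strip _ pr s (fun=> M) (fun=> M0) (fun p pp => ltW (gc_s gc pp)) 0%N (k %/ M).+1 _ pq.
by rewrite /cell kq => <-; rewrite -ltn_divLR.
Qed.

Lemma first_exists M k : (0 < M)%N -> is_first pr s a M k (first pr s a M k).
Proof.
move=> M0; suff [p pf] : exists p, is_first pr s a M k p by rewrite (firstE pf).
have [p0 p0k] := gc_cell gc k M0.
have [K HK] := low_points_finite (k %/ M).+1 (gc_a gc (andP p0k).1).
have HK' q : in_cell pr s M k q -> a q <= a p0 -> (q < K)%N.
  by move=> /(in_cell_strip M0); exact: HK.
have p0K := HK' _ p0k (lexx _).
have [p1 p1k p1m] : exists2 p, in_cell pr s M k p &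
    forall q, in_cell pr s M k q -> a p <= a q.
  case: (@Order.TotalTheory.arg_minP _ _ _ (Ordinal p0K) (fun i : 'I_K => in_cell pr s M k i) (fun i : 'I_K => a i)) => //= i ik im.
  exists i => // q qk; case: (leP (a q) (a p0)) => h.
    exact: (im (Ordinal (HK' _ qk h)) qk).
  by apply: ltW; apply: le_lt_trans h; exact: (im (Ordinal p0K)).
pose P := [pred p | in_cell pr s M k p && `[< forall q, in_cell pr s M k q -> a p <= a q >]].
have exP : exists p, P p by exists p1; rewrite /= p1k; apply/asboolP.
case: (ex_minnP exP) => p /andP[pk /asboolP pm] pmin.
exists p; split=> // q qk; have := pm q qk; rewrite le_eqVlt => /predU1P[e|]; last by left.
right; split=> //; apply: pmin; rewrite /= qk; apply/asboolP => r rk.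
by rewrite -e; exact: pm.
Qed.

Lemma N_gt0 n : (0 < N n)%N. Proof. by []. Qed.

Lemma pr_first n k : pr (first pr s a (N n) k).
Proof. by have [/andP[]] := first_exists k (N_gt0 n). Qed.

Lemma cell_first n k : cell s N n (first pr s a (N n) k) = k.
Proof. by have [/andP[_ /eqP]] := first_exists k (N_gt0 n). Qed.

Lemma cell_weight_ge n k : (0 < n)%N -> n%:R^-1 <= cell_weight n k.
Proof.
move=> n0; rewrite /cell_weight; case: ifP => // _.
rewrite ler_peMl ?invr_ge0// ler1n quantile_gt0// divr_gt0 ?ltr0n//.
exact/(gc_a gc)/pr_first.
Qed.

Lemma cell_weight_gt0 n k : (0 < n)%N -> 0 < cell_weight n k.
Proof. by move=> n0; apply: lt_le_trans (cell_weight_ge _ n0); rewrite invr_gt0 ltr0n. Qed.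

Lemma limit_weight_ge0 p : 0 <= limit_weight p.
Proof.
rewrite /limit_weight; case: ifP => // _.
by rewrite mulr_ge0 ?powR_ge0// ltW// kappa_gt0.
Qed.

Lemma limit_weight_summable m : exists C : R, forall K,
  \sum_(0 <= p < K | strip pr s m p) limit_weight p <= C.
Proof.
have [C HC] := gc_sum gc m; exists (kappa beta c * C) => K.
have k0 := kappa_gt0 beta01 c0.
apply: le_trans (ler_wpM2l (ltW k0) (HC K)); rewrite mulr_sumr.
by apply: ler_sum => p /andP[pp _]; rewrite /limit_weight pp.
Qed.

Lemma limit_weight_unbounded (t : R) : exists m K,
  t < \sum_(0 <= p < K | strip pr s m p) limit_weight p.
Proof.
have k0 := kappa_gt0 beta01 c0.
suff H j : exists m K, j%:R * kappa beta c <= \sum_(0 <= p < K | strip pr s m p) limit_weight p.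
  have [m [K HK]] := H (Num.truncn (t / kappa beta c)).+1.
  exists m, K; apply: lt_le_trans HK.
  by rewrite -ltr_pdivrMr// truncnS_gt.
elim: j => [|j [m [K HK]]].
  by exists 0%N, 0%N; rewrite mul0r big_geq.
have [p [pp mp ap]] := gc_large gc m.
pose m' := (maxn m (Num.truncn (s p)).+1); pose K' := maxn K p.+1.
exists m', K'.
have pK : (p < K')%N by rewrite leq_maxr.
have sp : strip pr s m' p.
  rewrite /strip pp/=; apply: lt_le_trans (truncnS_gt _) _.
  by rewrite ler_nat leq_maxr.
rewrite big_mkcond (bigD1_seq p) ?iota_uniq ?mem_index_iota//= sp.
have kx : kappa beta c <= limit_weight p.
  rewrite /limit_weight pp ler_peMr ?(ltW k0)//.
  have := @ler_powRN R beta^-1 (a p) 1; rewrite powR1; apply => //.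
    by rewrite invr_ge0 ltW//; case/andP: beta01.
  exact: gc_a.
rewrite -natr1 mulrDl mul1r addrC lerD//; apply: (le_trans HK).
apply: (@le_trans _ _ (\sum_(0 <= i < K' | strip pr s m i) limit_weight i)).
  by apply: sum_strip_le; [exact: limit_weight_ge0|exact: leq_maxl].
rewrite big_mkcond (bigD1_seq p) ?iota_uniq ?mem_index_iota//=.
rewrite {1}/strip pp/= ltNge mp/= add0r; apply: ler_sum => q qp.
case: ifP => // sq; last by case: ifP => // _; exact: limit_weight_ge0.
suff -> : strip pr s m' q by [].
move: sq => /andP[pq sq]; rewrite /strip pq/=; apply: lt_le_trans sq _.
by rewrite ler_nat leq_maxl.
Qed.

Local Notation pointw := (pointw pr s N (fun n => first pr s a (N n)) cell_weight).

(** Only finitely many points of the strip are as low as [p], and their times differ from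
that of [p]: cells that are small enough separate them. *)
Lemma eventually_first p : pr p -> \forall n \near \oo,
  first pr s a (N n) (cell s N n p) = p.
Proof.
move=> pp; pose m := (Num.truncn (s p)).+1.
have [K HK] := low_points_finite m (gc_a gc pp).
have [d d0 Hd] : exists2 d : R, 0 < d & forall q, (q < K)%N -> pr q -> q != p -> d <= `|s q - s p|.
  elim: K {HK} => [|K [d d0 Hd]]; first by exists 1.
  have [/andP[pK Kp]|h] := boolP (pr K && (K != p)); last first.
    exists d => // q; rewrite ltnS leq_eqVlt => /predU1P[->|qK] pq qp; last exact: Hd.
    by move: h; rewrite pq qp.
  have e0 : 0 < `|s K - s p|.
    by rewrite normr_gt0 subr_eq0; apply: contra Kp => /eqP /(gc_inj gc pK pp) ->.
  exists (Num.min d `|s K - s p|); first by rewrite lt_min d0.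
  move=> q; rewrite ltnS leq_eqVlt => /predU1P[->|qK] pq qp; rewrite ge_min ?lexx ?orbT//.
  by rewrite Hd.
near=> n.
have N0 : 0 < (N n)%:R :> R by rewrite ltr0n.
have Nd : (N n)%:R^-1 < d.
  by near: n; apply: (cvgr_lt _ (ncells_cvgy beta01)).
apply: firstE; split; first by rewrite /in_cell pp /cell eqxx.
move=> q qk; have [->|qp] := eqVneq q p; first by right.
left; rewrite ltNge; apply/negP => aq.
have /andP[pq /eqP kq] := qk.
have sq : strip pr s m q.
  have CS := @cell_strip _ pr s N N_gt0 (fun p pp => ltW (gc_s gc pp)) n m.
  have := CS q pq.
  rewrite /strip pq/= => <-; rewrite /cell kq.
  by rewrite -/(cell s N n p) CS// truncnS_gt.
have qK := HK _ sq aq.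
have := Hd _ qK pq qp; rewrite leNgt => /negP; apply.
apply: le_lt_trans Nd; rewrite -[leLHS](mulfK (lt0r_neq0 N0)) -[leRHS]mul1r.
rewrite ler_pM2r ?invr_gt0// -[X in _ * X](gtr0_norm N0) -normrM mulrBl.
have b1 : 0 <= (N n)%:R * s q by rewrite mulr_ge0// ltW// (gc_s gc).
have b2 : 0 <= (N n)%:R * s p by rewrite mulr_ge0// ltW// (gc_s gc).
have := truncn_itv b1; have := truncn_itv b2.
rewrite kq /cell -natr1 => /andP[? ?] /andP[? ?].
by rewrite ler_norml; apply/andP; split; lra.
Unshelve. all: by end_near. Qed.

(** The exceptional weight of the cell 0 does not matter since [p] has a positive time and is
eventually in another cell. *)
Lemma pointw_cvg p : pr p -> pointw n p @[n --> \oo] --> limit_weight p.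
Proof.
move=> pp; rewrite /limit_weight pp.
apply: cvg_trans (rescaled_quantile_cvg beta01 c0 b_ge0 b_asymp cumul_cvg (gc_a gc pp)).
apply: near_eq_cvg; near=> n.
have e : first pr s a (N n) (cell s N n p) = p.
  by near: n; exact: eventually_first.
rewrite /pointw pp e eqxx/= /cell_weight e.
have Nd : (N n)%:R^-1 <= s p.
  by near: n; apply: (cvgr_le _ (ncells_cvgy beta01)); exact: gc_s.
case: ifP => // /eqP; have N0 : 0 < (N n)%:R :> R by rewrite ltr0n.
have := truncnS_gt ((N n)%:R * s p); rewrite -/(cell s N n p) => + h; rewrite h.
rewrite ltNge => /negP; case.
by rewrite -ler_pdivrMl// mulr1.
Unshelve. all: by end_near. Qed.

(** A domination of the weights at level [n]: a summable part, and a part of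
order [1/n] that only the points representing a cell receive. *)
Lemma pointw_bound : exists2 C, 0 < C & forall n p, (0 < n)%N ->
  pointw n p <= C * (a p `^ (- beta^-1)) +
    (if pr p && (first pr s a (N n) (cell s N n p) == p) then C / n%:R else 0).
Proof.
have [C C0 HC] := rescaled_quantile_bound beta01 c0 b_ge0 b_asymp cumul_cvg.
exists (C + 1); first by rewrite addr_gt0.
move=> n p n0; have p0 := powR_ge0 (a p) (- beta^-1).
have nR0 : 0 < n%:R^-1 :> R by rewrite invr_gt0 ltr0n.
rewrite /pointw; case: ifP => [/andP[pp /eqP e]|_]; last first.
  by rewrite addr0 mulr_ge0// addr_ge0// ltW.
rewrite /cell_weight; case: ifP => _.
  have : 0 <= (C + 1) * a p `^ (- beta^-1) by rewrite mulr_ge0// addr_ge0// ltW.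
  have : 0 <= C / n%:R by rewrite mulr_ge0 ?ltW.
  by rewrite mulrDl; lra.
rewrite e; apply: (le_trans (HC n _ n0 (gc_a gc pp))).
by rewrite -/(_ / _) mulrDr !mulrDl; nra.
Qed.

Lemma count_first m n K :
  \sum_(0 <= p < K | strip pr s m p)
     (if pr p && (first pr s a (N n) (cell s N n p) == p) then 1 else 0 : R)
  <= (m * N n)%:R.
Proof.
rewrite -big_mkcondr/= -big_filter.
set l := [seq _ <- _ | _].
rewrite big_const_seq iter_addr addr0 count_predT ler_nat.
rewrite -(size_map (cell s N n)) -[leqRHS](size_iota 0).
have inl p : p \in l -> [/\ pr p, s p < m%:R & first pr s a (N n) (cell s N n p) = p].
  by rewrite mem_filter => /andP[/andP[/andP[? ?] /andP[? /eqP ?]] _].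
apply: uniq_leq_size.
  rewrite map_inj_in_uniq ?filter_uniq ?iota_uniq// => p q /inl[_ _ pe] /inl[_ _ qe] h.
  by rewrite -pe -qe h.
move=> _ /mapP[p /inl[pp sp _] ->]; rewrite mem_iota/= add0n.
by rewrite (@cell_strip _ pr)// => q pq; exact/ltW/(gc_s gc).
Qed.

(** Dominated convergence for series. Finitely many points converge one by one;
on the others the summable part of [pointw_bound] is small, while the
remaining part is at most [C/n] times the number [m * N n] of cells. *)
Lemma weights_l1 m (e : R) : 0 < e -> exists n0, forall n K, (n0 <= n)%N ->
  \sum_(0 <= p < K | strip pr s m p) `|pointw n p - limit_weight p| <= e.
Proof.
move=> e0; have [C C0 HC] := pointw_bound.
have k0 := kappa_gt0 beta01 c0.
pose D := C + kappa beta c; have D0 : 0 < D by rewrite addr_gt0.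
have eD : 0 < e / 3 / D by rewrite !divr_gt0.
have [K0 HK0] := x_tail (gc_sum gc) m eD.
have fin K1 e' : 0 < e' -> \forall n \near \oo,
    \sum_(0 <= p < K1 | strip pr s m p) `|pointw n p - limit_weight p| <= e'.
  elim: K1 e' => [|K1 IH] e' e'0; first by near=> n; rewrite big_geq// ltW.
  have e2 : 0 < e' / 2 by rewrite divr_gt0.
  have [sK|sK] := boolP (strip pr s m K1); last first.
    near=> n; rewrite big_nat_cond_recr//= (negbTE sK) addr0.
    by near: n; exact: IH.
  have pK : pr K1 by case/andP: sK.
  have cK := (cvgrPdist_le _ _).1 (pointw_cvg pK) _ e2.
  near=> n; rewrite big_nat_cond_recr//= sK [leRHS]splitr lerD//.
    by near: n; exact: IH.
  by rewrite distrC; near: n; exact: cK.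
have [n1 _ Hn1] := fin K0 _ (divr_gt0 e0 (ltr0n _ 3)).
have small : C * m%:R * ((N n)%:R / n%:R) @[n --> \oo] --> (0 : R).
  by rewrite -[X in _ --> X](mulr0 (C * m%:R)); apply: cvgMr; exact: ncells_small.
have [n2 _ Hn2] := cvgr_le _ small _ (divr_gt0 e0 (ltr0n _ 3)).
exists (maxn n1 n2).+1 => n K nn.
have n0 : (0 < n)%N by lia.
have F0 p : 0 <= `|pointw n p - limit_weight p| by [].
apply: (le_trans (sum_strip_le pr s m F0 (leq_maxr K0 K))).
rewrite (big_cat_nat _ (leq_maxl K0 K))//=.
set K' := maxn K0 K.
have h1 : \sum_(0 <= p < K0 | strip pr s m p) `|pointw n p - limit_weight p| <= e / 3.
  by apply: Hn1 => /=; lia.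
have h2 : C * m%:R * ((N n)%:R / n%:R) <= e / 3 by apply: Hn2 => /=; lia.
have h3 := HK0 K' (leq_maxl _ _).
suff h4 : \sum_(K0 <= p < K' | strip pr s m p) `|pointw n p - limit_weight p| <=
    D * (\sum_(K0 <= p < K' | strip pr s m p) a p `^ (- beta^-1)) +
    C * m%:R * ((N n)%:R / n%:R).
  have : D * (\sum_(K0 <= p < K' | strip pr s m p) a p `^ (- beta^-1)) <= e / 3.
    by rewrite mulrC -ler_pdivlMr.
  lra.
pose g p : R := if pr p && (first pr s a (N n) (cell s N n p) == p) then 1 else 0.
apply: (@le_trans _ _ (\sum_(K0 <= p < K' | strip pr s m p)
    (D * a p `^ (- beta^-1) + C / n%:R * g p))).
  apply: ler_sum => p /andP[pp sp].
  apply: (le_trans (ler_normB _ _)).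
  rewrite [`|limit_weight p|]ger0_norm ?limit_weight_ge0// ger0_norm; last first.
    by rewrite /pointw; case: ifP => // _; exact/ltW/cell_weight_gt0.
  have := HC n p n0; rewrite /limit_weight /g pp /D mulrDl.
  by case: ifP => _; rewrite ?mulr1 ?mulr0; lra.
rewrite big_split/= -!mulr_sumr lerD2l -!mulrA ler_pM2l//.
rewrite [m%:R * _]mulrA -natrM mulrC ler_pM2r ?invr_gt0 ?ltr0n//.
apply: le_trans (count_first m n K').
rewrite [leRHS](big_cat_nat _ (leq_maxl K0 K))//= lerDr.
by apply: sumr_ge0 => p _; case: ifP.
Unshelve. all: by end_near. Qed.

Definition config_walk := walk (fun n => first pr s a (N n)) cell_weight.

Lemma config_walk_cauchy (T e : R) : 0 < e -> exists n0, forall n n',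
  (n0 <= n)%N -> (n0 <= n')%N -> forall xi, (forall p, `|xi p| <= 1) ->
  forall t, 0 <= t <= T -> `|config_walk n xi t - config_walk n' xi t| <= e.
Proof.
apply: (@walk_cauchy _ pr s limit_weight N).
- exact: N_gt0.
- by move=> p pp; exact/ltW/(gc_s gc).
- exact: gc_inj.
- exact: pr_first.
- exact: cell_first.
- exact: cell_weight_gt0.
- exact: limit_weight_ge0.
- exact: cell_weight_ge.
- exact: weights_l1.
- exact: limit_weight_unbounded.
Qed.

Lemma config_walk_const (t e : R) : 0 <= t -> 0 < e -> exists K0, forall xi z,
  (forall p, `|xi p| <= 1) -> (forall p, (p < K0)%N -> xi p = z) ->
  exists n0, forall n, (n0 <= n)%N -> `|config_walk n xi t - z * t| <= e.
Proof.
apply: (@walk_const _ pr s limit_weight N).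
- exact: N_gt0.
- by move=> p pp; exact/ltW/(gc_s gc).
- exact: gc_inj.
- exact: pr_first.
- exact: cell_first.
- exact: cell_weight_gt0.
- exact: limit_weight_ge0.
- exact: cell_weight_ge.
- exact: weights_l1.
- exact: limit_weight_summable.
- exact: limit_weight_unbounded.
Qed.

End configuration.

(** * Independent digits of points of the unit interval *)

(** The pushforward together with its structure of measure, which is needed
wherever two measures are compared. *)
Notation image_measure := measure_function_pushforward__canonical__measure_function_Measure.

Section basics.
Context d (T : measurableType d) {R : realType}.

Lemma measurable_fun_countable d' (S : measurableType d') (C : countType) (f : T -> C)
    (g : C -> T -> S) :
  (forall j, measurable (f @^-1` [set j])) ->
  (forall j, measurable_fun setT (g j)) ->
  measurable_fun setT (fun x => g (f x) x).
Proof.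
move=> mf mg _ E mE; rewrite setTI.
have -> : (fun x => g (f x) x) @^-1` E =
    \bigcup_n [set x | exists2 j, unpickle n = Some j & f x = j /\ E (g j x)].
  apply/seteqP; split=> [x /= Ex|x [n _ [j _ [<- ]]]//].
  by exists (pickle (f x)) => //=; exists (f x) => //; rewrite pickleK.
apply: bigcup_measurable => n _.
case e : (unpickle n) => [j|]; last first.
  by rewrite (_ : [set _ | _] = set0)//; apply/seteqP; split=> // x [].
rewrite (_ : [set _ | _] = f @^-1` [set j] `&` g j @^-1` E).
  by apply: measurableI => //; rewrite -[X in measurable X]setTI; exact: mg.
by apply/seteqP; split=> [x [i [->] [<-]]|x /= [-> ?]]//; exists j.
Qed.

Lemma measurable_fun_nat (f : T -> nat) :
  (forall j, measurable (f @^-1` [set j])) -> measurable_fun setT f.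
Proof.
move=> mf; apply: (@measurable_fun_countable _ _ _ f (fun j _ => j)) => // j.
Qed.

Lemma measurable_preimage d' (S : measurableType d') (f : T -> S) A :
  measurable_fun setT f -> measurable A -> measurable (f @^-1` A).
Proof. by move=> mf mA; rewrite -[X in measurable X]setTI; exact: mf. Qed.

Lemma measurable_forall_lt K (Q : nat -> T -> Prop) : (forall k, measurable [set w | Q k w]) ->
  measurable [set w | forall k, (k < K)%N -> Q k w].
Proof.
move=> mQ; rewrite (_ : [set _ | _] = \bigcap_(k in [set k | (k < K)%N]) [set w | Q k w]).
  by apply: bigcap_measurableType => k _.
by apply/seteqP; split=> w h k; exact: h.
Qed.

Lemma measurable_iter (f : T -> T) n :
  measurable_fun setT f -> measurable_fun setT (iter n f).
Proof. by move=> mf; elim: n => [|n]; [exact: measurable_id|exact: measurableT_comp]. Qed.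

Variable P : probability T R.

Lemma prob_fin (A : set T) : measurable A -> P A = (fine (P A))%:E.
Proof. by move=> mA; rewrite fineK// fin_num_measure. Qed.

Section bernoulli_shift.
Context d' (S : measurableType d') (X : T -> S) (th : T -> T).
Hypothesis mX : measurable_fun setT X.
Hypothesis mth : measurable_fun setT th.
Hypothesis indep : forall A E, measurable A -> measurable E ->
  P (X @^-1` A `&` th @^-1` E) = (P (X @^-1` A) * P E)%E.

Definition path_event K (A : nat -> set S) :=
  [set x | forall k, (k < K)%N -> A k (X (iter k th x))].

Lemma path_eventS K A : path_event K.+1 A =
  X @^-1` A 0%N `&` th @^-1` path_event K (fun k => A k.+1).
Proof.
apply/seteqP; split=> [x xA|x [x0 xA] [_//|k kK]].
  by split=> [|k kK]; [exact: (xA 0%N)|have := xA k.+1 kK; rewrite iterSr].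
by rewrite iterSr; exact: xA.
Qed.

Lemma measurable_path_event K A : (forall k, measurable (A k)) ->
  measurable (path_event K A).
Proof.
elim: K A => [|K IH] A mA.
  by rewrite (_ : path_event 0 A = setT)//; apply/seteqP; split.
by rewrite path_eventS; apply: measurableI; apply: measurable_preimage => //; exact: IH.
Qed.

(** A shift whose first digit is independent of the rest produces independent
identically distributed digits. The shift [th] preserves [P]: this is the
hypothesis of independence for [A] equal to the whole space. *)
Lemma prob_path_event K A : (forall k, measurable (A k)) ->
  P (path_event K A) = (\prod_(k < K) fine (P (X @^-1` A k)))%:E.
Proof.
elim: K A => [|K IH] A mA.
  rewrite big_ord0 (_ : path_event 0 A = setT) ?probability_setT//.
  by apply/seteqP; split.
rewrite path_eventS indep//; last exact: measurable_path_event.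
by rewrite IH// big_ord_recl EFinM -prob_fin//; exact: measurable_preimage.
Qed.

End bernoulli_shift.

End basics.

Section unit_interval.
Context {R : realType}.
Local Notation T1 := (measurableTypeR R).
Local Notation leb := (@lebesgue_measure R).

Lemma measurable_unit : measurable (`[0, 1[%classic : set T1).
Proof. exact: measurable_itv. Qed.

(** Lebesgue measure on the unit interval, as a probability on the whole line;
points outside the interval form a null set. *)
Definition lam : set T1 -> \bar R := mrestr leb measurable_unit.
HB.instance Definition _ := Measure.on lam.

Lemma lam_setT : lam setT = 1%E.
Proof. by rewrite /lam/= /mrestr setTI lebesgue_measure_itv/= lte_fin ltr01 -EFinB subr0. Qed.

HB.instance Definition _ := Measure_isProbability.Build _ _ _ lam lam_setT.

Lemma lebesgue_affine (a b : R) (E : set T1) : a < b -> measurable E ->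
  leb ((fun x => (x - a) / (b - a)) @^-1` E) = ((b - a)%:E * leb E)%E.
Proof.
move=> ab mE; have ba : 0 < b - a by rewrite subr_gt0.
pose f (x : T1) : T1 := (x - a) / (b - a).
have mf : measurable_fun setT f.
  by apply: measurable_funM => //; apply: measurable_funB.
have ba' : 0 <= (b - a)^-1 by rewrite invr_ge0 ltW.
pose mu : {measure set T1 -> \bar R} := mscale (NngNum ba') (image_measure leb mf).
have H : leb E = mu E.
  apply: lebesgue_measure_unique => // _ [[u v]] _ <-.
  have fE : f @^-1` `]u, v]%classic = `]a + u * (b - a), a + v * (b - a)]%classic.
    apply/seteqP; split=> x /=; rewrite !in_itv/= /f ltr_pdivlMr// ler_pdivrMr//.
      by move=> /andP[? ?]; apply/andP; split; lra.
    by move=> /andP[? ?]; apply/andP; split; lra.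
  transitivity ((b - a)^-1%:E * leb (f @^-1` `]u, v]%classic))%E; last by [].
  rewrite fE.
  rewrite !lebesgue_measure_itv/= !lte_fin ltrD2l ltr_pM2r//; case: ifP => _; last by rewrite mule0.
  rewrite -!EFinB -EFinM; congr EFin.
  by field; rewrite lt0r_neq0.
rewrite H; have -> : mu E = ((b - a)^-1%:E * leb (f @^-1` E))%E by [].
by rewrite muleA -EFinM divff ?lt0r_neq0// mul1e.
Qed.

Section partition_digits.
Variables (J : set nat) (Q : interval_partition R J).
Local Notation ind := (block_index Q).
Local Notation bmap := (block_map Q).

Lemma lamE (A : set T1) : lam A = leb (A `&` `[0, 1[).
Proof. by []. Qed.

Lemma block_unit j : J j -> Q j `<=` `[0, 1[.
Proof. by move=> Jj x Qx; rewrite -(block_cover Q); exists j. Qed.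

Lemma block_index_unit x : `[0, 1[%classic x -> J (ind x) /\ Q (ind x) x.
Proof.
rewrite -(block_cover Q) => -[j Jj Qx].
by rewrite (block_indexP Jj Qx).
Qed.

Lemma measurable_block_index_set1 j : measurable (ind @^-1` [set j] : set T1).
Proof.
have H : (ind @^-1` [set j] : set T1) =
    (if `[< J j >] then Q j else set0) `|` (if j == 0%N then ~` `[0, 1[%classic else set0).
  apply/seteqP; split=> [x /= ij|x [|]].
  - have [xI|xI] := pselect (`[0, 1[%classic x).
      have [] := block_index_unit xI; rewrite ij => Jj Qj.
      by left; rewrite asboolT.
    right; suff -> : j == 0%N by [].
    move: ij; rewrite /block_index; case: xgetP => [i _ [Ji Qi] _|_ <-//].
    by case: xI; exact: (block_unit Ji).
  - by case: asboolP => // Jj Qj /=; rewrite (block_indexP Jj Qj).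
  - case: eqP => // -> /= xI; rewrite /block_index; case: xgetP => // i _ [Ji Qi].
    by case: xI; exact: (block_unit Ji).
rewrite H; apply: measurableU.
  by case: asboolP => // Jj; exact: (measurable_block Q Jj).
by case: ifP => // _; apply: measurableC; exact: measurable_itv.
Qed.

Lemma measurable_block_index : measurable_fun setT (ind : T1 -> nat).
Proof. exact: measurable_fun_nat measurable_block_index_set1. Qed.

Lemma measurable_block_map : measurable_fun setT (bmap : T1 -> T1).
Proof.
apply: (@measurable_fun_countable _ _ _ _ _ ind
  (fun j x => (x - inf (Q j)) / fine (leb (Q j)))).
  exact: measurable_block_index_set1.
by move=> j; apply: measurable_funM => //; apply: measurable_funB.
Qed.

Lemma block_map_unit x : `[0, 1[%classic x -> `[0, 1[%classic (bmap x).
Proof.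
move=> /block_index_unit[Jj Qx]; rewrite /block_map.
have [a [b Qj]] := block_itv Q Jj.
move: Qx; rewrite Qj /= in_itv/= => /andP[ax xb].
have ab : a < b by exact: le_lt_trans xb.
rewrite inf_itv ?bnd_simp// lebesgue_measure_itv/= lte_fin ab -EFinB/=.
by rewrite in_itv/= divr_ge0 ?subr_ge0 ?(ltW ab)//= ltr_pdivrMr ?subr_gt0// mul1r ltrD2r.
Qed.

Lemma lam_blocks (A : set T1) : measurable A ->
  lam A = (\sum_(j <oo | j \in J) leb (A `&` Q j))%E.
Proof.
move=> mA; rewrite lamE -(block_cover Q) setI_bigcupr measure_bigcup//.
  by move=> j Jj; apply: measurableI => //; exact: (measurable_block Q Jj).
apply: trivIset_setIl; exact: block_trivIset.
Qed.

Lemma lebesgue_block_image j (E : set T1) : J j -> measurable E ->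
  leb (bmap @^-1` E `&` Q j) = (leb (Q j) * lam E)%E.
Proof.
move=> Jj mE; have [a [b Qj]] := block_itv Q Jj.
have [ab|ba] := ltP a b; last first.
  have -> : Q j = set0.
    rewrite Qj; apply/seteqP; split=> // x /=; rewrite in_itv/= => /andP[ax xb].
    by move: (lt_le_trans xb ba); rewrite ltNge ax.
  by rewrite setI0 measure0 mul0e.
have -> : leb (Q j) = (b - a)%:E by rewrite Qj lebesgue_measure_itv/= lte_fin ab.
rewrite lamE -lebesgue_affine//; last first.
  by apply: measurableI => //; exact: measurable_itv.
congr (leb _); apply/seteqP; split=> x /=.
  move=> [Ex Qx]; move: Ex (Qx); rewrite /block_map (block_indexP Jj Qx) {3}Qj.
  rewrite Qj inf_itv ?bnd_simp// lebesgue_measure_itv/= lte_fin ab -EFinB/=.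
  rewrite !in_itv/= => Ex /andP[ax xb]; split => //.
  by rewrite divr_ge0 ?subr_ge0 ?(ltW ab)//= ltr_pdivrMr ?subr_gt0// mul1r ltrD2r.
rewrite !in_itv/= ler_pdivlMr ?subr_gt0// mul0r subr_ge0 ltr_pdivrMr ?subr_gt0//.
rewrite mul1r ltrD2r => -[Ex axb].
have Qx : Q j x by rewrite Qj /= in_itv.
split => //; rewrite /block_map (block_indexP Jj Qx) Qj.
by rewrite inf_itv ?bnd_simp// lebesgue_measure_itv/= lte_fin ab -EFinB.
Qed.

(** On each block the map is affine onto the unit interval, so that the
conditional law of the image given the block is uniform. *)
Lemma block_digit_indep (A : set nat) (E : set T1) : measurable E ->
  lam (ind @^-1` A `&` bmap @^-1` E) = (lam (ind @^-1` A) * lam E)%E.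
Proof.
move=> mE; have mA : measurable (ind @^-1` A : set T1).
  by apply: measurable_preimage => //; exact: measurable_block_index.
have mbE : measurable (bmap @^-1` E : set T1).
  by apply: measurable_preimage => //; exact: measurable_block_map.
rewrite (lam_blocks mA) (lam_blocks (measurableI _ _ mA mbE)).
rewrite muleC (prob_fin lam mE) -nneseriesZl//.
apply: eq_eseriesr => j; rewrite inE => Jj.
have [Aj|Aj] := pselect (A j).
  have e : ind @^-1` A `&` Q j = Q j.
    by apply/seteqP; split=> [x []//|x Qx]; split => //=; rewrite (block_indexP Jj Qx).
  by rewrite setIAC e setIC lebesgue_block_image// muleC -prob_fin//.
have e0 : ind @^-1` A `&` Q j = set0.
  by apply/seteqP; split=> // x [/= + Qx]; rewrite (block_indexP Jj Qx).
by rewrite setIAC e0 set0I !measure0 mule0.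
Qed.

Lemma lam_block j : J j -> lam (ind @^-1` [set j]) = leb (Q j).
Proof.
move=> Jj; rewrite lamE; congr (leb _); apply/seteqP; split=> x /=.
  by move=> [ij /block_index_unit[]]; rewrite ij.
by move=> Qx; rewrite (block_indexP Jj Qx); split=> //; exact: (block_unit Jj).
Qed.

End partition_digits.

End unit_interval.

(** * Splitting a uniform variable into two independent ones *)

Section splitting.
Context {R : realType}.
Local Notation T1 := (measurableTypeR R).
Local Notation leb := (@lebesgue_measure R).
Local Notation lam := (@lam R).

Lemma rays_unique (m1 m2 : {measure set T1 -> \bar R}) :
  (m1 setT < +oo)%E ->
  (forall u : R, m1 `]u, +oo[%classic = m2 `]u, +oo[%classic) ->
  forall A, measurable A -> m1 A = m2 A.
Proof.
move=> m1T m12.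
apply: (@measure_unique _ R T1 (@RGenOInfty.G R) (fun n : nat => `]- n%:R, +oo[%classic)).
- exact: RGenOInfty.measurableE.
- move=> _ _ [x ->] [y ->]; exists (Num.max x y).
  by apply/seteqP; split=> z /=; rewrite !in_itv/= !andbT gt_max => /andP.
- by move=> n; exists (- n%:R).
- apply/seteqP; split=> // x _; exists (Num.truncn (- x)).+1 => //=.
  by rewrite in_itv/= andbT ltrNl truncnS_gt.
- by move=> _ [x ->].
- move=> n; apply: le_lt_trans m1T; apply: le_measure => //; rewrite inE//.
Qed.

Definition clamp (u : R) : R := Num.min (Num.max u 0) 1.

Lemma lam_ray (u : R) : lam `]-oo, u[%classic = (clamp u)%:E.
Proof.
rewrite /clamp lamE (_ : _ `&` _ = `[0, Num.min u 1[%classic); last first.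
  apply/seteqP; split=> x /=; rewrite !in_itv/= lt_min.
    by move=> [-> /andP[-> ->]].
  by move=> /andP[-> /andP[-> ->]].
rewrite lebesgue_measure_itv/= lte_fin lt_min ltr01 andbT oppr0 addr0.
by case: (ltP 0 u) => h //; rewrite min_l.
Qed.

Lemma lam_upper_ray (u : R) : lam `]u, +oo[%classic = (1 - clamp u)%:E.
Proof.
rewrite /clamp; have [u0|u0] := ltP u 0.
  rewrite min_l ?subr0// -lam_setT !lamE; congr (leb _).
  apply/seteqP; split=> x [] //= _; rewrite !in_itv/= => /andP[x0 x1].
  by rewrite (lt_le_trans u0 x0) x0 x1.
rewrite lamE (_ : _ `&` _ = `]u, 1[%classic); last first.
  apply/seteqP; split=> x /=; rewrite !in_itv/= ?andbT.
    by move=> [-> /andP[_ ->]].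
  by move=> /andP[ux ->]; rewrite ux (le_trans u0 (ltW ux)).
rewrite lebesgue_measure_itv/= lte_fin; case: ltP => u1; first by rewrite -EFinB.
by rewrite subrr.
Qed.

Lemma lam_cell N k : (k < N)%N ->
  lam (`[k%:R / N%:R, k.+1%:R / N%:R[%classic : set T1) = (N%:R^-1)%:E.
Proof.
move=> kN; have N0 : 0 < N%:R :> R by rewrite ltr0n; lia.
rewrite lamE (_ : _ `&` _ = `[k%:R / N%:R, k.+1%:R / N%:R[%classic); last first.
  apply/seteqP; split=> x /=; rewrite !in_itv/=; first by case.
  move=> /andP[x1 x2]; rewrite x1 x2; split => //.
  rewrite (le_trans _ x1) ?divr_ge0//=; apply: (lt_le_trans x2).
  by rewrite ler_pdivrMr// mul1r ler_nat.
rewrite lebesgue_measure_itv/= lte_fin ltr_pM2r ?invr_gt0// ltr_nat ltnSn.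
by rewrite -EFinD -mulrBl -natrB// subSnn mul1r.
Qed.

Definition bit (x : R) : R := if 2^-1 <= x then 1 else 0.
Definition doubling (x : T1) : T1 := 2 * x - bit x.

Lemma measurable_bit : measurable_fun setT (bit : T1 -> R).
Proof.
apply: measurable_fun_ifT => //.
by apply: measurable_fun_ler.
Qed.

Lemma measurable_doubling : measurable_fun setT doubling.
Proof.
apply: measurable_funB; last exact: measurable_bit.
exact: measurable_funM.
Qed.

Lemma lam_bit (b : R) (E : set T1) : b = 0 \/ b = 1 -> measurable E ->
  lam ((bit : T1 -> R) @^-1` [set b] `&` doubling @^-1` E) = (2^-1%:E * lam E)%E.
Proof.
move=> b01 mE; pose a := b / 2; pose a' := (b + 1) / 2.
have aa : a' - a = 2^-1 by rewrite /a /a'; lra.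
rewrite -aa [in RHS]lamE -lebesgue_affine//; first last.
- by apply: measurableI => //; exact: measurable_itv.
- by rewrite -subr_gt0 aa invr_gt0.
rewrite lamE; congr (leb _); apply/seteqP; split=> x /=; rewrite !in_itv/= aa invrK /a.
  rewrite /doubling => -[[bx Ex] /andP[x0 x1]].
  have -> : (x - b / 2) * 2 = 2 * x - bit x by rewrite bx; lra.
  split => //; rewrite /bit; case: (leP 2^-1 x) => h; lra.
move=> [Ex /andP[h1 h2]].
have bx : bit x = b.
  by rewrite /bit; case: b01 h1 h2 {Ex} => ->; case: (leP 2^-1 x) => //; lra.
rewrite /doubling bx; have -> : 2 * x - b = (x - b / 2) * 2 by lra.
by split => //; case: b01 h1 h2 {Ex bx} => ->; lra.
Qed.

Lemma lam_splitbit (E : set T1) : measurable E ->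
  lam E = (lam ((bit : T1 -> R) @^-1` [set 0%R] `&` E) +
           lam ((bit : T1 -> R) @^-1` [set 1%R] `&` E))%E.
Proof.
move=> mE.
have mb b : measurable ((bit : T1 -> R) @^-1` [set b]).
  by apply: measurable_preimage => //; exact: measurable_bit.
rewrite -measureU; first last.
- apply/seteqP; split=> // x /= [[-> _] [/esym/eqP + _]].
  by rewrite oner_eq0.
- exact: measurableI.
- exact: measurableI.
rewrite -setIUl (_ : _ `|` _ = setT) ?setTI//.
by apply/seteqP; split=> // x _ /=; rewrite /bit; case: ifP; [right|left].
Qed.

Lemma lam_doubling (E : set T1) : measurable E -> lam (doubling @^-1` E) = lam E.
Proof.
move=> mE; rewrite lam_splitbit; last first.
  by apply: measurable_preimage => //; exact: measurable_doubling.
rewrite !lam_bit//; [|by right|by left].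
rewrite (prob_fin lam mE) -EFinM -EFinD; congr EFin; lra.
Qed.

(** The number whose binary digits are the first [n] digits of even rank of [x]. *)
Fixpoint even_bits n (x : T1) : R :=
  if n is n'.+1 then (bit x + even_bits n' (doubling (doubling x))) / 2 else 0.

Lemma bit_itv x : 0 <= bit x <= 1.
Proof. by rewrite /bit; case: ifP; rewrite lexx ler01. Qed.

Lemma even_bits_itv n x : 0 <= even_bits n x <= 1.
Proof.
elim: n x => [|n IH] x /=; first by rewrite lexx ler01.
have /andP[? ?] := bit_itv x; have /andP[? ?] := IH (doubling (doubling x)).
by apply/andP; split; lra.
Qed.

Lemma even_bitsS n x : even_bits n x <= even_bits n.+1 x.
Proof.
elim: n x => [|n IH] x; first by case/andP: (even_bits_itv 1 x).
have := IH (doubling (doubling x)) => /=; lra.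
Qed.

(** The even binary digits of [x] form one number, the odd ones another; under
Lebesgue measure the two are uniform and independent ([halves_indep]). In
this way one uniform variable carries all the randomness of a Poisson
process. *)
Definition half1 (x : T1) : T1 := limn (even_bits ^~ x).
Definition half2 (x : T1) : T1 := half1 (doubling x).

Lemma half1_cvg x : even_bits ^~ x @ \oo --> half1 x.
Proof.
apply: nondecreasing_is_cvgn.
  by apply/nondecreasing_seqP => n; exact: even_bitsS.
by exists 1 => _ [n _ <-]; case/andP: (even_bits_itv n x).
Qed.

Lemma half1_itv x : 0 <= half1 x <= 1.
Proof.
have c := @half1_cvg x; apply/andP; split.
  by apply: (cvgr_to_ge c); near=> n; case/andP: (even_bits_itv n x).
by apply: (cvgr_to_le c); near=> n; case/andP: (even_bits_itv n x).
Unshelve. all: by end_near. Qed.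

Lemma half1E x : half1 x = (bit x + half1 (doubling (doubling x))) / 2.
Proof.
have h : even_bits ^~ x @ \oo --> (bit x + half1 (doubling (doubling x))) / 2.
  rewrite -cvg_shiftS /=; apply: cvgMl; apply: cvgD; first exact: cvg_cst.
  exact: half1_cvg.
exact: (cvg_unique _ (@half1_cvg x) h).
Qed.

Lemma measurable_half1 : measurable_fun setT half1.
Proof.
apply: (@measurable_fun_cvg _ _ _ _ even_bits); last by move=> x _; exact: half1_cvg.
elim=> [|n IH] /=; first exact: measurable_cst.
apply: measurable_funM => //; apply: measurable_funD; first exact: measurable_bit.
apply: (measurableT_comp IH); apply: (measurableT_comp measurable_doubling).
exact: measurable_doubling.
Qed.

Lemma measurable_half2 : measurable_fun setT half2.
Proof. exact: measurableT_comp measurable_half1 measurable_doubling. Qed.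

Lemma measurable_half1_ray u : measurable (half1 @^-1` (`]u, +oo[%classic : set T1)).
Proof. by apply: measurable_preimage => //; exact: measurable_half1. Qed.

(** The joint law of the halves is determined by the probabilities of upper
quadrants. *)
Definition tail2 u v := fine (lam (half1 @^-1` `]u, +oo[ `&` half2 @^-1` `]v, +oo[)).

Lemma half1_ray_bit b u : b = 0 \/ b = 1 ->
  (bit : T1 -> R) @^-1` [set b] `&` half1 @^-1` `]u, +oo[ =
  (bit : T1 -> R) @^-1` [set b] `&` doubling @^-1` (doubling @^-1` (half1 @^-1` `]2 * u - b, +oo[)).
Proof.
move=> b01; apply/seteqP; split=> x /= [bx]; rewrite !in_itv/= !andbT (half1E x) bx => h; split => //; lra.
Qed.

Lemma measurable_preimage_doubling (E : set T1) : measurable E -> measurable (doubling @^-1` E).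
Proof. by move=> mE; apply: measurable_preimage => //; exact: measurable_doubling. Qed.

(** Conditioning on the first two binary digits moves each half to one of two
dyadic intervals. *)
Lemma tail2E u v : tail2 u v =
  (tail2 (2 * u) (2 * v) + tail2 (2 * u) (2 * v - 1) +
   tail2 (2 * u - 1) (2 * v) + tail2 (2 * u - 1) (2 * v - 1)) / 4.
Proof.
have mr := measurable_half1_ray.
pose F (u v : R) := half1 @^-1` (`]u, +oo[%classic : set T1) `&` half2 @^-1` (`]v, +oo[%classic : set T1).
have mF a a' : measurable (F a a').
  by apply: measurableI => //; exact: (measurable_preimage_doubling (mr _)).
have step b b' : b = 0 \/ b = 1 -> b' = 0 \/ b' = 1 ->
   lam ((bit : T1 -> R) @^-1` [set b] `&` doubling @^-1` ((bit : T1 -> R) @^-1` [set b'] `&` doubling @^-1` F (2 * u - b) (2 * v - b'))) =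
   (4^-1 * tail2 (2 * u - b) (2 * v - b'))%:E.
  move=> hb hb'; rewrite !lam_bit//; last first.
    apply: measurableI; last exact: measurable_preimage_doubling.
    by apply: measurable_preimage => //; exact: measurable_bit.
  rewrite (prob_fin lam (mF _ _)) -!EFinM mulrA; congr (_ * _)%:E; lra.
have bits b : b = 0 \/ b = 1 -> lam ((bit : T1 -> R) @^-1` [set b] `&` F u v) =
   (4^-1 * tail2 (2 * u - b) (2 * v) + 4^-1 * tail2 (2 * u - b) (2 * v - 1))%:E.
  move=> hb.
  have -> : (bit : T1 -> R) @^-1` [set b] `&` F u v =
     (bit : T1 -> R) @^-1` [set b] `&` doubling @^-1`
       (doubling @^-1` (half1 @^-1` `]2 * u - b, +oo[) `&` half1 @^-1` `]v, +oo[).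
    by rewrite /F setIA half1_ray_bit// preimage_setI setIA.
  rewrite lam_bit//; last by apply: measurableI => //; exact: measurable_preimage_doubling.
  rewrite lam_splitbit; last by apply: measurableI => //; exact: measurable_preimage_doubling.
  have e b' : b' = 0 \/ b' = 1 ->
    (bit : T1 -> R) @^-1` [set b'] `&` (doubling @^-1` (half1 @^-1` `]2 * u - b, +oo[) `&` half1 @^-1` `]v, +oo[) =
    (bit : T1 -> R) @^-1` [set b'] `&` doubling @^-1` F (2 * u - b) (2 * v - b').
    by move=> hb'; rewrite setICA half1_ray_bit// setICA /F preimage_setI.
  rewrite !e//; [|by right|by left].
  rewrite !lam_bit//; [|by right|by left].
  have c2 a a' : lam (F a a') = (tail2 a a')%:E by exact: (prob_fin lam (mF a a')).
  rewrite subr0 !c2 -(EFinM 2^-1 (tail2 _ (2 * v))) -(EFinM 2^-1 (tail2 _ (2 * v - 1))) -EFinD -EFinM.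
  by congr EFin; lra.
rewrite {1}/tail2 -/(F u v) lam_splitbit// !bits; [|by right|by left].
by rewrite -EFinD /= subr0; lra.
Qed.

Lemma tail2_eq0 u v : 1 <= u \/ 1 <= v -> tail2 u v = 0.
Proof.
move=> uv; rewrite /tail2 (_ : _ `&` _ = set0) ?measure0//.
apply/seteqP; split=> // x /=; rewrite !in_itv/= !andbT /half2 => -[h1 h2].
have /andP[_ ?] := half1_itv x; have /andP[_ ?] := half1_itv (doubling x).
by case: uv => ?; lra.
Qed.

Lemma tail2_eq1 u v : u < 0 -> v < 0 -> tail2 u v = 1.
Proof.
move=> u0 v0; rewrite /tail2 (_ : _ `&` _ = setT) ?lam_setT//.
apply/seteqP; split=> // x _ /=; rewrite !in_itv/= !andbT /half2.
have /andP[h1 _] := half1_itv x; have /andP[h2 _] := half1_itv (doubling x).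
by rewrite (lt_le_trans u0 h1) (lt_le_trans v0 h2).
Qed.

Lemma clampE u : clamp u = (clamp (2 * u) + clamp (2 * u - 1)) / 2.
Proof.
have m01 : Num.min 0 1 = 0 :> R by rewrite min_l.
rewrite /clamp; case: (leP u 0) => ?; case: (leP (2 * u) 0) => ?;
case: (leP (2 * u - 1) 0) => ?; try (exfalso; lra);
rewrite ?m01; case: (leP u 1) => ?; case: (leP (2 * u) 1) => ?;
try (exfalso; lra); case: (leP (2 * u - 1) 1) => ?; lra.
Qed.

Lemma clamp_le0 u : u <= 0 -> clamp u = 0.
Proof. by move=> u0; rewrite /clamp max_r// min_l. Qed.

Lemma clamp_ge1 u : 1 <= u -> clamp u = 1.
Proof. by move=> u1; rewrite /clamp max_l ?min_r//; lra. Qed.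

Lemma clamp_itv u : 0 <= clamp u <= 1.
Proof. by rewrite /clamp le_min le_max lexx orbT ler01 ge_min lexx orbT. Qed.

(** The claimed value satisfies the functional equation of [tail2E], and so does
the difference. The latter vanishes at one of the four arguments on the
right, hence is at most [3/4] of its own bound: it is zero. *)
Lemma tail2_clamp u v : tail2 u v = (1 - clamp u) * (1 - clamp v).
Proof.
pose D u v := tail2 u v - (1 - clamp u) * (1 - clamp v).
have DE a a' : D a a' = (D (2 * a) (2 * a') + D (2 * a) (2 * a' - 1) +
    D (2 * a - 1) (2 * a') + D (2 * a - 1) (2 * a' - 1)) / 4.
  by rewrite /D tail2E (clampE a) (clampE a'); lra.
have D0 a a' : 1 <= a \/ 1 <= a' -> D a a' = 0.
  by move=> h; rewrite /D tail2_eq0//; case: h => /clamp_ge1 ->; rewrite subrr ?mulr0 ?mul0r subrr.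
have D1 a a' : a < 0 -> a' < 0 -> D a a' = 0.
  by move=> h h'; rewrite /D tail2_eq1// !clamp_le0 ?ltW// !subr0 mulr1 subrr.
suff H n a a' : `|D a a'| <= (3 / 4) ^+ n.
  apply/eqP; rewrite -subr_eq0 -/(D u v); apply/eqP/normr0_eq0/eqP.
  have := @cvg_geometric R 1 (3 / 4); rewrite ger0_norm ?divr_ge0// => /(_ _) c.
  have {}c : ((3 / 4) ^+ n : R) @[n --> \oo] --> (0 : R).
    rewrite (_ : (fun n => _) = geometric 1 (3 / 4)); first by apply: c; lra.
    by apply/funext => n; rewrite /geometric/= mul1r.
  rewrite eq_le normr_ge0 andbT; apply: (cvgr_to_ge c); near=> n; exact: H.
elim: n a a' => [|n IH] a a'.
  have mF : measurable (half1 @^-1` (`]a, +oo[%classic : set T1) `&` half2 @^-1` (`]a', +oo[%classic : set T1)).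
    by apply: measurableI; [exact: measurable_half1_ray|exact: (measurable_preimage_doubling (measurable_half1_ray a'))].
  have /andP[? ?] : 0 <= tail2 a a' <= 1.
    by rewrite fine_ge0//= -lee_fin -[leLHS](prob_fin lam mF); exact: probability_le1.
  have /andP[? ?] := clamp_itv a; have /andP[? ?] := clamp_itv a'.
  by rewrite expr0 ler_norml /D; apply/andP; split; nra.
have e0 : 0 <= (3 / 4) ^+ n :> R by rewrite exprn_ge0.
have [[a1|a'1]|nz] := pselect (1 <= a \/ 1 <= a').
- by rewrite D0 ?normr0 ?exprn_ge0//; left.
- by rewrite D0 ?normr0 ?exprn_ge0//; right.
(* one of the four terms of the functional equation vanishes *)
have z : D (2 * a) (2 * a') = 0 \/ D (2 * a - 1) (2 * a' - 1) = 0.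
  have [h|h] := leP 1 (2 * a); first by left; apply: D0; left.
  have [h'|h'] := leP 1 (2 * a'); first by left; apply: D0; right.
  by right; apply: D1; lra.
have := IH (2 * a) (2 * a'); have := IH (2 * a) (2 * a' - 1).
have := IH (2 * a - 1) (2 * a'); have := IH (2 * a - 1) (2 * a' - 1).
rewrite (DE a a') exprS !ler_norml => /andP[? ?] /andP[? ?] /andP[? ?] /andP[? ?].
by case: z => z; apply/andP; split; lra.
Unshelve. all: by end_near. Qed.

Lemma lam_half1 (A : set T1) : measurable A -> lam (half1 @^-1` A) = lam A.
Proof.
move: A; apply: (@rays_unique (image_measure lam measurable_half1) lam).
  have -> : image_measure lam measurable_half1 setT = lam setT by [].
  by rewrite lam_setT ltry.
move=> u; transitivity (lam (half1 @^-1` `]u, +oo[)); first by [].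
transitivity (lam `]u, +oo[); last by [].
rewrite lam_upper_ray (prob_fin lam (measurable_half1_ray u)).
congr EFin; have := tail2_clamp u (- 1); rewrite (@clamp_le0 (- 1)) ?oppr_le0// subr0 mulr1 => <-.
congr (fine (lam _)); apply/seteqP; split=> x /=; last by case.
rewrite !in_itv/= !andbT => ux; split=> //.
by have /andP[h _] := half1_itv (doubling x); apply: lt_le_trans h; rewrite oppr_lt0.
Qed.

Lemma lam_half2 (A : set T1) : measurable A -> lam (half2 @^-1` A) = lam A.
Proof.
move=> mA; rewrite -(lam_half1 mA); apply: lam_doubling.
by apply: measurable_preimage => //; exact: measurable_half1.
Qed.

(** The formula holds for pairs of rays; it is extended to one set, then to the
other, by uniqueness of finite measures. *)
Lemma halves_indep (A E : set T1) : measurable A -> measurable E ->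
  lam (half1 @^-1` A `&` half2 @^-1` E) = (lam A * lam E)%E.
Proof.
have m1 B : measurable B -> measurable (half1 @^-1` B).
  by move=> mB; apply: measurable_preimage => //; exact: measurable_half1.
have m2 B : measurable B -> measurable (half2 @^-1` B).
  by move=> mB; apply: measurable_preimage => //; exact: measurable_half2.
have nn (B : set T1) : 0 <= fine (lam B) by rewrite fine_ge0.
have stage1 (v : R) (B : set T1) : measurable B ->
    lam (half1 @^-1` B `&` half2 @^-1` `]v, +oo[) = (lam `]v, +oo[ * lam B)%E.
  have mV : measurable (`]v, +oo[%classic : set T1) by exact: measurable_itv.
  rewrite (prob_fin lam mV); move: B.
  apply: (@rays_unique (image_measure (mrestr lam (m2 _ mV)) measurable_half1)
    (mscale (NngNum (nn `]v, +oo[%classic)) lam)).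
    apply: (@le_lt_trans _ _ 1%E); last by rewrite ltry.
    apply: (probability_le1 lam); apply: measurableI; last exact: (m2 _ mV).
    exact: (m1 setT).
  move=> u; transitivity (lam (half1 @^-1` `]u, +oo[ `&` half2 @^-1` `]v, +oo[)); first by [].
  transitivity ((fine (lam `]v, +oo[%classic))%:E * lam `]u, +oo[%classic)%E; last by [].
  rewrite (@prob_fin _ _ _ lam (_ `&` _)); last first.
    by apply: measurableI; [apply: m1|apply: m2]; exact: measurable_itv.
  rewrite !lam_upper_ray -EFinM; congr EFin.
  by rewrite mulrC; exact: tail2_clamp.
move=> mA; rewrite setIC (prob_fin lam mA); move: E.
apply: (@rays_unique (image_measure (mrestr lam (m1 _ mA)) measurable_half2)
    (mscale (NngNum (nn A)) lam)).
  apply: (@le_lt_trans _ _ 1%E); last by rewrite ltry.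
  apply: (probability_le1 lam); apply: measurableI; last exact: (m1 _ mA).
  exact: (m2 setT).
move=> v; transitivity (lam (half1 @^-1` A `&` half2 @^-1` `]v, +oo[)).
  by rewrite setIC.
rewrite stage1// muleC.
transitivity ((fine (lam A))%:E * lam `]v, +oo[%classic)%E; last by [].
by rewrite -prob_fin.
Qed.

End splitting.

(** * Poisson clusters in the unit square *)

Section poisson_process.
Context {R : realType}.
Local Notation T1 := (measurableTypeR R).
Local Notation lam := (@lam R).

Definition pcumul n : R := \sum_(0 <= j < n) expR (-1) / j`!%:R.

Lemma pcumul_cvg : pcumul n @[n --> \oo] --> (1 : R).
Proof.
have -> : pcumul = fun n => expR (-1) * series (exp_coeff 1) n.
  apply/funext => n; rewrite /pcumul seriesEnat mulr_sumr.
  by apply: eq_bigr => i _; rewrite /exp_coeff /= expr1n mul1r.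
rewrite [X in _ --> X](_ : 1 = expR (-1) * expR 1); last by rewrite -expRD addNr expR0.
by apply: cvgMr; exact: is_cvg_series_exp_coeff.
Qed.

Lemma pcumulS n : pcumul n.+1 = pcumul n + expR (-1) / n`!%:R.
Proof. by rewrite /pcumul big_nat_recr. Qed.

Lemma pcumul_le n n' : (n <= n')%N -> pcumul n <= pcumul n'.
Proof.
move=> nn; rewrite /pcumul [leRHS](big_cat_nat _ nn)//= lerDl.
by apply: sumr_ge0 => i _; rewrite divr_ge0 ?expR_ge0.
Qed.

Lemma pcumul_lt1 n : pcumul n < 1.
Proof.
have h : pcumul n < pcumul n.+1.
  by rewrite pcumulS ltrDl divr_gt0 ?expR_gt0// ltr0n fact_gt0.
apply: (lt_le_trans h); apply: (cvgr_to_ge pcumul_cvg); near=> k.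
by apply: pcumul_le; near: k; exact: nbhs_infty_ge.
Unshelve. all: by end_near. Qed.

(** A Poisson variable of parameter 1, as a function of a uniform variable. *)
Definition pois (u : T1) : nat := xget 0%N [set n | pcumul n <= u < pcumul n.+1].

Lemma poisE n u : pcumul n <= u < pcumul n.+1 -> pois u = n.
Proof.
move=> nu; rewrite /pois; case: xgetP => [k _ /= ku|/(_ n)//].
case: (ltngtP k n) => // kn; have := pcumul_le kn.
  by move: ku nu => /andP[_ ku] /andP[un _] h; move: (lt_le_trans ku (le_trans h un)); rewrite ltxx.
by move: ku nu => /andP[un _] /andP[_ ku] h; move: (lt_le_trans ku (le_trans h un)); rewrite ltxx.
Qed.

Lemma pois_ex u : 0 <= u < 1 -> exists n, pcumul n <= u < pcumul n.+1.
Proof.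
move=> /andP[u0 u1].
have ex : exists n, u < pcumul n.
  have [n _ /(_ n (leqnn _))] := cvgr_gt _ pcumul_cvg _ u1.
  by exists n.
case: (ex_minnP ex) => -[|n] un nmin.
  by move: un; rewrite /pcumul big_geq// ltNge u0.
by exists n; rewrite un andbT leNgt; apply/negP => /nmin; rewrite ltnn.
Qed.

Lemma pois_gt i u : 0 <= u < 1 -> (i < pois u)%N = (pcumul i.+1 <= u).
Proof.
move=> u01; have [n nu] := pois_ex u01; rewrite (poisE nu).
have /andP[n1 n2] := nu; apply/idP/idP => [il|ui].
  exact: le_trans (pcumul_le il) n1.
rewrite ltnNge; apply/negP => nil; have := pcumul_le (n := n.+1) (n' := i.+1) nil.
by move=> h; move: (le_lt_trans (le_trans h ui) n2); rewrite ltxx.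
Qed.

Lemma pois_set1 n : pois @^-1` [set n] `&` `[0, 1[ = `[pcumul n, pcumul n.+1[%classic.
Proof.
have p0 : 0 <= pcumul n by rewrite (le_trans _ (pcumul_le (leq0n n)))// /pcumul big_geq.
apply/seteqP; split=> x /=; rewrite !in_itv/=.
  by move=> [+ /pois_ex[k kx]]; rewrite (poisE kx) => <-.
move=> xn; split; first exact: poisE.
case/andP: xn => x1 x2; rewrite (le_trans p0 x1)/=.
exact: lt_trans x2 (pcumul_lt1 _).
Qed.

Lemma pois_out x : ~ `[0, 1[%classic x -> pois x = 0%N.
Proof.
rewrite /pois => x01; case: xgetP => // k _ /= kx.
have : (pois @^-1` [set k] `&` `[0, 1[) x by rewrite pois_set1 /= in_itv.
by case.
Qed.

Lemma measurable_pois : measurable_fun setT (pois : T1 -> nat).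
Proof.
apply: measurable_fun_nat => n.
rewrite (_ : _ @^-1` _ = `[pcumul n, pcumul n.+1[ `|`
  (if n == 0%N then ~` `[0, 1[%classic else set0)); last first.
  rewrite -pois_set1; apply/seteqP; split=> [x /= xn|x /= [[]//|]].
    have [x01|x01] := pselect (`[0, 1[%classic x); first by left.
    by right; rewrite -xn (pois_out x01) eqxx.
  by case: eqP => // -> /pois_out.
apply: measurableU; first exact: measurable_itv.
by case: ifP => // _; apply: measurableC; exact: measurable_itv.
Qed.

Lemma lam_pois n : lam (pois @^-1` [set n]) = (expR (-1) / n`!%:R)%:E.
Proof.
rewrite lamE pois_set1 lebesgue_measure_itv/= lte_fin pcumulS ltrDl.
by rewrite divr_gt0 ?expR_gt0 ?ltr0n ?fact_gt0// -EFinD addrAC subrr add0r.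
Qed.

(** A sequence of independent uniform variables drawn from one. *)
Definition nth_half m (w : T1) : T1 := half1 (iter m half2 w).

Lemma measurable_nth_half m : measurable_fun setT (nth_half m).
Proof.
apply: measurableT_comp; first exact: measurable_half1.
by apply: measurable_iter; exact: measurable_half2.
Qed.

Lemma halves_bernoulli (A E : set T1) : measurable A -> measurable E ->
  lam (half1 @^-1` A `&` half2 @^-1` E) = (lam (half1 @^-1` A) * lam E)%E.
Proof. by move=> mA mE; rewrite halves_indep// lam_half1. Qed.

(** The path event of the shift [half2] with digit [half1]. *)
Definition halves_in K (A : nat -> set T1) :=
  [set w | forall k, (k < K)%N -> A k (nth_half k w)].

Lemma measurable_halves_in K A : (forall k, measurable (A k)) -> measurable (halves_in K A).
Proof.
move=> mA; apply: (measurable_path_event measurable_half1 measurable_half2) => //.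
Qed.

Lemma lam_halves_in K A : (forall k, measurable (A k)) ->
  lam (halves_in K A) = (\prod_(k < K) fine (lam (A k)))%:E.
Proof.
move=> mA; rewrite [LHS](prob_path_event measurable_half1 measurable_half2)//; last first.
  exact: halves_bernoulli.
by congr EFin; apply: eq_bigr => k _; congr fine; exact: lam_half1.
Qed.

Lemma lam_nth_half k (A : set T1) : measurable A -> lam (nth_half k @^-1` A) = lam A.
Proof.
move=> mA; elim: k => [|k IH]; first exact: lam_half1.
rewrite -IH -[RHS]lam_half2; last by apply: measurable_preimage => //; exact: measurable_nth_half.
by congr (lam _); apply/seteqP; split=> w /=; rewrite /nth_half iterSr.
Qed.

Lemma lam_nth_half2 k k' (A A' : set T1) : k != k' -> measurable A -> measurable A' ->
  lam (nth_half k @^-1` A `&` nth_half k' @^-1` A') = (lam A * lam A')%E.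
Proof.
move=> kk mA mA'.
pose B j := if j == k then A else if j == k' then A' else setT.
have mB j : measurable (B j) by rewrite /B; case: ifP => // _; case: ifP.
pose K := (maxn k k').+1.
have kK : (k < K)%N by rewrite ltnS leq_maxl.
have kK' : (k' < K)%N by rewrite ltnS leq_maxr.
have -> : nth_half k @^-1` A `&` nth_half k' @^-1` A' = halves_in K B.
  apply/seteqP; split=> [w /= [wA wA'] j jK|w /= wB].
    by rewrite /B; case: eqP => [->//|_]; case: eqP => [->//|].
  split; first by have := wB k kK; rewrite /B eqxx.
  by have := wB k' kK'; rewrite /B eq_sym (negbTE kk) eqxx.
rewrite lam_halves_in// (bigD1 (Ordinal kK))//= (bigD1 (Ordinal kK'))/=; last first.
  by apply/eqP => -[] /esym/eqP; rewrite (negbTE kk).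
rewrite big1 ?mulr1; last first.
  move=> [j jK] /andP[/eqP h1 /eqP h2]; rewrite /B/=.
  case: eqP => [jk|_]; first by case: h1; apply/val_inj.
  case: eqP => [jk|_]; first by case: h2; apply/val_inj.
  by rewrite probability_setT.
by rewrite EFinM /B eqxx eq_sym (negbTE kk) eqxx -!prob_fin.
Qed.

(** The variable [v] encodes a Poisson number of independent uniform points; the
event is that all of them encode points of [E]. *)
Definition cluster_in (E : set T1) : set T1 :=
  [set v | forall i, (i < pois (half1 v))%N -> E (nth_half i (half2 v))].

Lemma cluster_inE E : cluster_in E = \bigcup_n
  (half1 @^-1` (pois @^-1` [set n]) `&` half2 @^-1` (halves_in n (fun=> E))).
Proof.
apply/seteqP; split=> [v vE|v [n _ [/= <- //]]].
by exists (pois (half1 v)).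
Qed.

Lemma measurable_pois_set1 n : measurable (pois @^-1` [set n] : set T1).
Proof. by apply: measurable_preimage => //; exact: measurable_pois. Qed.

Lemma measurable_cluster_in E : measurable E -> measurable (cluster_in E).
Proof.
move=> mE; rewrite cluster_inE; apply: bigcup_measurable => n _; apply: measurableI.
  apply: measurable_preimage; first exact: measurable_half1.
  exact: measurable_pois_set1.
apply: measurable_preimage; first exact: measurable_half2.
exact: measurable_halves_in.
Qed.

(** With [p] the measure of [E], the probability is the sum of [exp(-1) p^n / n!]. *)
Lemma lam_cluster_in E : measurable E ->
  lam (cluster_in E) = (expR (- (1 - fine (lam E))))%:E.
Proof.
move=> mE; rewrite cluster_inE measure_bigcup//; first last.
- by move=> i j _ _ [v [[/= <- _] [<- _]]].
- move=> n _; apply: measurableI.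
    by apply: measurable_preimage (measurable_pois_set1 n); exact: measurable_half1.
  apply: measurable_preimage; first exact: measurable_half2.
  exact: measurable_halves_in.
set p := fine (lam E).
transitivity (\sum_(n <oo | n \in [set: nat]) (expR (-1) * (exp_coeff p n))%:E)%E.
  apply: eq_eseriesr => n _.
  rewrite [LHS]halves_indep//; [|exact: measurable_pois_set1|exact: measurable_halves_in].
  rewrite lam_pois lam_halves_in// -EFinM prodr_const card_ord; congr EFin.
  by rewrite /exp_coeff /= -mulrA [_^-1 * _]mulrC.
apply: cvg_lim => //.
have -> : (fun n => \sum_(0 <= k < n | k \in [set: nat]) (expR (-1) * exp_coeff p k)%:E)%E =
   EFin \o (fun n => expR (-1) * series (exp_coeff p) n).
  apply/funext => n /=; rewrite (eq_bigl xpredT) => [|k]; last by rewrite in_setT.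
  by rewrite sumEFin seriesEnat mulr_sumr.
apply: cvg_EFin; first by near=> n.
rewrite opprB addrC expRD.
by apply: cvgMr; exact: is_cvg_series_exp_coeff.
Unshelve. all: by end_near. Qed.

End poisson_process.

(** * A Poisson process on the quarter plane *)

Section points.
Context {R : realType}.
Local Notation T1 := (measurableTypeR R).
Local Notation lam := (@lam R).

Definition coords (p : nat) : nat * nat * nat :=
  if unpickle p is Some c then c else (0, 0, 0)%N.

(** The uniform variable that encodes the points of the unit square with lower
left corner [(m, l)]. *)
Definition square (m l : nat) (w : T1) : T1 := nth_half l (nth_half m w).

(** A point with index [p] is the [i]-th one of the unit square with corner [(m, l)], where [(m, l, i)]
is decoded from [p]; its position in that square is encoded by [mark p w]. *)
Definition mark (p : nat) (w : T1) : T1 :=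
  let: (m, l, i) := coords p in nth_half i (half2 (square m l w)).

(** Of the indices that decode to the same triple only its code is kept, so that
every point has one index; the square contains a Poisson number of points. *)
Definition present (w : T1) (p : nat) : bool :=
  let: (m, l, i) := coords p in
  (pickle (m, l, i) == p) && (i < pois (half1 (square m l w)))%N.
Definition time (w : T1) (p : nat) : R := (coords p).1.1%:R + half1 (mark p w).
Definition height (w : T1) (p : nat) : R := (coords p).1.2%:R + half2 (mark p w).

Lemma coordsK m l i : coords (pickle (m, l, i)) = (m, l, i).
Proof. by rewrite /coords pickleK. Qed.

Lemma measurable_square m l : measurable_fun setT (square m l).
Proof. exact: (measurableT_comp (measurable_nth_half l) (measurable_nth_half m)). Qed.

Lemma measurable_mark p : measurable_fun setT (mark p).
Proof.
rewrite /mark; case: (coords p) => [[m l] i].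
apply: (measurableT_comp (measurable_nth_half i)).
exact: (measurableT_comp measurable_half2 (measurable_square m l)).
Qed.

Lemma measurable_time p : measurable_fun setT (time ^~ p).
Proof.
apply: measurable_funD => //.
exact: (measurableT_comp measurable_half1 (measurable_mark p)).
Qed.

Lemma measurable_height p : measurable_fun setT (height ^~ p).
Proof.
apply: measurable_funD => //.
exact: (measurableT_comp measurable_half2 (measurable_mark p)).
Qed.

Lemma measurable_present p : measurable [set w | present w p].
Proof.
rewrite /present; case: (coords p) => [[m l] i].
case: eqP => _ /=; last by rewrite (_ : [set _ | _] = set0)//; apply/seteqP; split.
have mf : measurable_fun setT (fun w : T1 => pois (half1 (square m l w))).
  apply: (measurableT_comp measurable_pois).
  exact: (measurableT_comp measurable_half1 (measurable_square m l)).
exact: (measurable_preimage (A := [set n | (i < n)%N]) mf).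
Qed.

Lemma time_ge0 w p : 0 <= time w p.
Proof. by rewrite addr_ge0//; case/andP: (half1_itv (mark p w)). Qed.

Lemma half2_itv (w : T1) : 0 <= half2 w <= 1.
Proof. exact: half1_itv. Qed.

Lemma height_ge w p : (coords p).1.2%:R <= height w p.
Proof. by rewrite lerDl; case/andP: (half2_itv (mark p w)). Qed.

Lemma measurable_truncn d (T : measurableType d) (f : T -> R) k :
  measurable_fun setT f -> (forall x, 0 <= f x) ->
  measurable [set x | Num.truncn (f x) = k].
Proof.
move=> mf f0; rewrite (_ : [set _ | _] = f @^-1` `[k%:R, k.+1%:R[).
  by apply: measurable_preimage => //; exact: measurable_itv.
apply/seteqP; split=> x /=; rewrite in_itv/=.
  by move=> <-; apply/truncn_itv.
by move=> h; apply: truncn_def.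
Qed.

Section void.
Variables (N : nat) (th : nat -> R).
Hypothesis N0 : (0 < N)%N.

Let NR0 : 0 < N%:R :> R. Proof. by rewrite ltr0n. Qed.

(** The part of the unit square above the profile [th], which is constant
on each cell of length [1/N]. *)
Definition void_square (m l : nat) : set T1 :=
  [set u | th (Num.truncn (N%:R * (m%:R + half1 u))) <= l%:R + half2 u].

Lemma measurable_void_square m l : measurable (void_square m l).
Proof.
have mf : measurable_fun setT (fun u : T1 => N%:R * (m%:R + half1 u)).
  apply: measurable_funM; first exact: measurable_cst.
  apply: measurable_funD; first exact: measurable_cst.
  exact (@measurable_half1 R).
have f0 (u : T1) : 0 <= N%:R * (m%:R + half1 u).
  by rewrite mulr_ge0// addr_ge0//; case/andP: (half1_itv u).
have m1 : measurable_fun setT (fun u : T1 => th (Num.truncn (N%:R * (m%:R + half1 u)))).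
  apply: (@measurable_fun_countable _ _ _ _ _ (fun u : T1 => Num.truncn (N%:R * (m%:R + half1 u))) (fun k _ => th k)) => k.
    exact: measurable_truncn.
  exact: measurable_cst.
have m2 : measurable_fun setT (fun u : T1 => l%:R + half2 u).
  apply: measurable_funD; [exact: measurable_cst|exact (@measurable_half2 R)].
have := measurable_preimage (A := [set true]) (measurable_fun_ler m1 m2).
exact.
Qed.

(** The area below the profile within one square; in each column of width [1/N]
the height of the profile is clamped between the sides of the square. *)
Lemma lam_void_square m l :
  1 - fine (lam (void_square m l)) = \sum_(k < N) clamp (th (m * N + k)%N - l%:R) / N%:R.
Proof.
have mV := measurable_void_square m l.
pose I k : set T1 := `[k%:R / N%:R, k.+1%:R / N%:R[%classic.
pose F k : set T1 := half1 @^-1` I k `&` half2 @^-1` `]-oo, th (m * N + k)%N - l%:R[.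
have mI k : measurable (I k) by exact: measurable_itv.
have mF k : measurable (F k).
  apply: measurableI; first exact: measurable_preimage measurable_half1 (mI k).
  by apply: measurable_preimage measurable_half2 _; exact: measurable_itv.
have lF k : (k < N)%N -> lam (F k) = (clamp (th (m * N + k)%N - l%:R) / N%:R)%:E.
  move=> kN; rewrite halves_indep; [|exact: mI|exact: measurable_itv].
  by rewrite lam_ray lam_cell// -EFinM mulrC.
have bE (n : nat) (u : T1) : (\big[setU/set0]_(k < n) F k) u <-> exists2 k, (k < n)%N & F k u.
  elim: n => [|n IH]; first by rewrite big_ord0; split => // -[].
  rewrite big_ord_recr/=; split=> [[/IH[k kn Fk]|Fn]|[k]].
  - by exists k => //; exact: ltnW.
  - by exists n.
  - by rewrite ltnS leq_eqVlt => /predU1P[->|kn Fk]; [right|left; apply/IH; exists k].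
have cellE k u : I k u -> Num.truncn (N%:R * (m%:R + u)) = (m * N + k)%N.
  rewrite /I /= in_itv/= ler_pdivrMr// ltr_pdivlMr// => /andP[u1 u2].
  apply: truncn_def; rewrite -addnS !natrD !natrM mulrDr (mulrC _ m%:R).
  by rewrite lerD2l ltrD2l (mulrC N%:R u) u1 u2.
have mU n : measurable (\big[setU/set0]_(k < n) F k) by apply: bigsetU_measurable => k _; exact: mF.
have null : lam (half1 @^-1` (~` `[0, 1[%classic)) = 0%E.
  rewrite lam_half1; last by apply: measurableC; exact: measurable_itv.
  by rewrite lamE setICl measure0.
have e : lam (~` void_square m l) = lam (\big[setU/set0]_(k < N) F k).
  apply/eqP; rewrite eq_le; apply/andP; split; last first.
    apply: le_measure; rewrite ?inE//; first exact: measurableC.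
    move=> u /bE[k kN [/= ku]]; rewrite in_itv/= => hu /=.
    by rewrite /void_square /= (cellE k)//; move: hu; rewrite ltrBrDl ltNge => /negP.
  have mN : measurable (half1 @^-1` (~` `[0, 1[%classic) : set T1).
    by apply: measurable_preimage measurable_half1 _; apply: measurableC; exact: measurable_itv.
  have U2 : (lam (\big[setU/set0]_(k < N) F k `|` half1 @^-1` (~` `[0%R, 1%R[%classic)) <=
      lam (\big[setU/set0]_(k < N) F k) + lam (half1 @^-1` (~` `[0%R, 1%R[%classic)))%E.
    exact: (measureU2 lam (mU N) mN).
  rewrite null adde0 in U2.
  apply: le_trans U2.
  apply: le_measure; rewrite ?inE.
  - exact: measurableC.
  - exact: measurableU.
  move=> u /= uV; have [u01|u01] := pselect (`[0, 1[%classic (half1 u)); last by right.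
  left; apply/bE; move: u01; rewrite /= in_itv/= => /andP[u0 u1].
  pose k := Num.truncn (N%:R * half1 u).
  have ki := truncn_itv (mulr_ge0 (ler0n R N) u0).
  have Ik : I k (half1 u).
    by rewrite /I /= in_itv/= ler_pdivrMr// ltr_pdivlMr// mulrC.
  exists k.
    rewrite -(ltr_nat R); apply: le_lt_trans (_ : N%:R * half1 u < _).
      by case/andP: ki.
    by rewrite -[ltRHS]mulr1 ltr_pM2l.
  split => //=; rewrite in_itv/= ltNge; apply/negP => h; apply: uV.
  by rewrite /void_square /= (cellE k)//; move: h; rewrite lerBlDl.
have tF : trivIset setT F.
  apply/trivIsetP => i j _ _ ij; apply/seteqP; split=> // u [[iu _] [ju _]].
  have := cellE _ _ iu; rewrite (cellE _ _ ju) => /addnI ji.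
  by move: ij; rewrite ji eqxx.
have hU : lam (\big[setU/set0]_(k < N) F k) = (\sum_(k < N) lam (F k))%E.
  exact: (measure_bigsetU lam mF tF).
have : lam (~` void_square m l) = (1 - lam (void_square m l))%E := probability_setC lam mV.
rewrite e hU (prob_fin lam mV) -EFinB.
rewrite (eq_bigr (fun k : 'I_N => (clamp (th (m * N + k)%N - l%:R) / N%:R)%:E)) => [|k _]; last exact: lF.
by rewrite sumEFin => -[->].
Qed.

(** Stacking the squares [l = 0, 1, ...] of one column recovers the height of the profile. *)
Lemma sum_clamp (x : R) L : 0 <= x <= L%:R ->
  \sum_(l < L) clamp (x - l%:R) = x.
Proof.
move=> /andP[x0 xL].
have H n : \sum_(l < n) clamp (x - l%:R) = Num.min x n%:R.
  elim: n => [|n IH]; first by rewrite big_ord0 min_r.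
  rewrite big_ord_recr/= IH /clamp -natr1.
  case: (leP x n%:R) => h1; case: (leP x (n%:R + 1)) => h2; case: (leP (x - n%:R) 0) => h3;
    rewrite ?(min_l (@ler01 R)); try (case: (leP (x - n%:R) 1) => h4); lra.
by rewrite H min_l.
Qed.

Definition void_event := [set w | forall p, present w p ->
  th (Num.truncn (N%:R * time w p)) <= height w p].

Variable K : nat.
Hypothesis th0 : forall k, 0 <= th k.
Hypothesis thK : forall k, (K <= k)%N -> th k = 0.

(** The void probability of a Poisson process is the exponential of minus the area below
the profile. The squares are independent, and each is void with the
probability given by [lam_cluster_in]. *)
Lemma lam_void_event :
  measurable void_event /\
  lam void_event = (expR (- ((\sum_(0 <= k < K) th k) / N%:R)))%:E.
Proof.
have [L HL] : exists L, forall k, th k <= L%:R.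
  exists (\sum_(0 <= k < K) (Num.truncn (th k)).+1)%N => k.
  have [Kk|kK] := leqP K k; first by rewrite thK.
  apply: (le_trans (ltW (truncnS_gt _))); rewrite ler_nat.
  by rewrite (bigD1_seq k) ?mem_index_iota ?iota_uniq//= leq_addr.
have -> : void_event = halves_in K (fun m => halves_in L (fun l => cluster_in (void_square m l))).
  apply/seteqP; split=> [w wv m mK l lL i ip|w wv p].
    have := wv (pickle (m, l, i)); rewrite /present /time /height /mark coordsK eqxx /=.
    exact.
  rewrite /present /time /height /mark; case: (coords p) => [[m l] i] /= /andP[_ ip].
  have f0 (u : T1) : 0 <= N%:R * (m%:R + half1 u).
    by rewrite mulr_ge0// addr_ge0//; case/andP: (half1_itv u).
  have [mK|Km] := ltnP m K; last first.
    have h0 : 0 <= half2 (nth_half i (half2 (square m l w))).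
      by case/andP: (half2_itv (nth_half i (half2 (square m l w)))).
    rewrite thK ?addr_ge0//.
    rewrite truncn_ge_nat//; apply: le_trans (_ : m%:R <= _); first by rewrite ler_nat.
    rewrite mulrDr (le_trans (_ : _ <= N%:R * m%:R))//.
      by rewrite ler_peMl// ler1n.
    by rewrite lerDl mulr_ge0//; case/andP: (half1_itv (nth_half i (half2 (square m l w)))).
  have [lL|Ll] := ltnP l L; first exact: (wv m mK l lL i ip).
  apply: le_trans (HL _) _; apply: le_trans (_ : l%:R <= _); first by rewrite ler_nat.
  by rewrite lerDl; case/andP: (half2_itv (nth_half i (half2 (square m l w)))).
have mC m l : measurable (cluster_in (void_square m l)).
  by apply: measurable_cluster_in; exact: measurable_void_square.
have mH m : measurable (halves_in L (fun l => cluster_in (void_square m l))).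
  exact: measurable_halves_in.
split; first exact: measurable_halves_in.
rewrite lam_halves_in//; congr EFin.
rewrite (eq_bigr (fun m : 'I_K => expR (- ((\sum_(k < N) th (m * N + k)%N) / N%:R)))); last first.
  move=> m _; rewrite lam_halves_in//=.
  rewrite (eq_bigr (fun l : 'I_L => expR (- (\sum_(k < N) clamp (th (m * N + k)%N - l%:R) / N%:R)))); last first.
    move=> l _; rewrite lam_cluster_in; last exact: measurable_void_square.
    by rewrite /= lam_void_square.
  rewrite -expR_sum sumrN; congr expR; congr (- _).
  rewrite exchange_big/= mulr_suml; apply: eq_bigr => k _.
  by rewrite -mulr_suml sum_clamp// th0 HL.
rewrite -expR_sum sumrN -mulr_suml; congr expR; congr (- (_ / _)).
have H n : \sum_(m < n) \sum_(k < N) th (m * N + k)%N = \sum_(0 <= k < n * N) th k.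
  elim: n => [|n IH]; first by rewrite big_ord0 mul0n big_geq.
  rewrite big_ord_recr/= IH mulSn addnC [RHS](@big_cat_nat _ _ _ (n * N))//=; last by rewrite leq_addr.
  congr (_ + _); rewrite -{2}[(n * N)%N]add0n [(n * N + N)%N]addnC big_addn addnK.
  by rewrite big_mkord; apply: eq_bigr => k _; rewrite addnC.
rewrite H [LHS](@big_cat_nat _ _ _ K)//=; last by rewrite leq_pmulr.
suff -> : \sum_(K <= k < K * N) th k = 0 by rewrite addr0.
by rewrite big_nat_cond big1// => k /andP[/andP[Kk _] _]; exact: thK.
Qed.

End void.

End points.

(** * Almost sure properties of the Poisson process *)

Section almost_sure.
Context {R : realType}.
Local Notation T1 := (measurableTypeR R).
Local Notation lam := (@lam R).

(** Almost sure properties of the Poisson process are obtained from bounds on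
probabilities, without first proving the measurability of the event. *)
Lemma negligible_small (A : set T1) :
  (forall e : R, 0 < e -> exists V, [/\ measurable V, A `<=` V & (lam V <= e%:E)%E]) ->
  lam.-negligible A.
Proof.
move=> H.
have [V HV] : exists V : nat -> set T1, forall n,
    [/\ measurable (V n), A `<=` V n & (lam (V n) <= (n.+1%:R^-1)%:E)%E].
  have H' n : exists V, [/\ measurable V, A `<=` V & (lam V <= (n.+1%:R^-1)%:E)%E].
    by apply: H; rewrite invr_gt0.
  by exists (fun n => projT1 (cid (H' n))) => n; exact: projT2 (cid (H' n)).
have mV : measurable (\bigcap_n V n) by apply: bigcapT_measurable => n; case: (HV n).
exists (\bigcap_n V n); split=> //; last first.
  by move=> x Ax n _; case: (HV n) => _ + _; apply.
apply/eqP; rewrite -measure_le0; apply/lee_addgt0Pr => e e0; rewrite add0e.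
pose n := Num.truncn e^-1.
have ne : n.+1%:R^-1 <= e.
  by rewrite -[leRHS]invrK lef_pV2 ?posrE ?invr_gt0// ltW// truncnS_gt.
apply: (@le_trans _ _ (lam (V n))).
  by apply: le_measure; rewrite ?inE//; [case: (HV n)|move=> x; apply].
by case: (HV n) => _ _ h; apply: (le_trans h); rewrite lee_fin.
Qed.

Lemma ae_of_small (P : T1 -> Prop) :
  (forall e : R, 0 < e -> exists V, [/\ measurable V, ~` P `<=` V & (lam V <= e%:E)%E]) ->
  {ae lam, forall w, P w}.
Proof. exact: negligible_small. Qed.

Lemma lam_mark p (A : set T1) : measurable A -> lam (mark p @^-1` A) = lam A.
Proof.
move=> mA; rewrite /mark; case: (coords p) => [[m l] i].
have mi : measurable (nth_half i @^-1` A).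
  exact: measurable_preimage (measurable_nth_half i) mA.
have mh : measurable (half2 @^-1` (nth_half i @^-1` A)).
  exact: measurable_preimage measurable_half2 mi.
transitivity (lam (nth_half m @^-1` (nth_half l @^-1` (half2 @^-1` (nth_half i @^-1` A))))) => //.
rewrite lam_nth_half; last exact: measurable_preimage (measurable_nth_half l) mh.
by rewrite lam_nth_half// lam_half2// lam_nth_half.
Qed.

Lemma ae_mark p (A : set T1) : measurable A -> lam (~` A) = 0%E ->
  {ae lam, forall w, A (mark p w)}.
Proof.
move=> mA A0; exists (mark p @^-1` (~` A)); split=> //.
- by apply: measurable_preimage (measurable_mark p) _; exact: measurableC.
- by rewrite lam_mark//; exact: measurableC.
Qed.

Lemma ae_interior (f : T1 -> T1) p : measurable_fun setT f ->
  (forall A, measurable A -> lam (f @^-1` A) = lam A) ->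
  {ae lam, forall w, 0 < f (mark p w) < 1}.
Proof.
move=> mf lf; have mI : measurable (`]0, 1[%classic : set T1) by exact: measurable_itv.
have h := @ae_mark p (f @^-1` `]0, 1[%classic) (measurable_preimage mf mI).
have : lam (~` (f @^-1` `]0, 1[%classic)) = 0%E.
  transitivity (lam (f @^-1` (~` `]0, 1[%classic))) => //.
  rewrite lf; last exact: measurableC.
  rewrite lamE (_ : _ `&` _ = [set 0]) ?lebesgue_measure_set1//.
  apply/seteqP; split=> x /=; rewrite !in_itv/=.
    by move=> [/negP + /andP[x0 x1]]; rewrite x1 andbT -leNgt => x0'; apply/eqP; rewrite eq_le x0 x0'.
  by move=> ->; rewrite ltxx lexx ltr01.
by move=> /h; apply: filterS => w /=; rewrite in_itv.
Qed.

Lemma lam_marks p q (A A' : set T1) : coords p <> coords q ->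
  measurable A -> measurable A' ->
  lam (mark p @^-1` A `&` mark q @^-1` A') = (lam A * lam A')%E.
Proof.
rewrite /mark; case: (coords p) => [[m l] i]; case: (coords q) => [[m' l'] i'] pq mA mA'.
have mi j (B : set T1) : measurable B -> measurable (half2 @^-1` (nth_half j @^-1` B)).
  by move=> mB; apply: measurable_preimage measurable_half2 _; apply: measurable_preimage (measurable_nth_half j) mB.
have li j (B : set T1) : measurable B -> lam (half2 @^-1` (nth_half j @^-1` B)) = lam B.
  move=> mB; rewrite lam_half2 ?lam_nth_half//.
  exact: measurable_preimage (measurable_nth_half j) mB.
have ml j (B : set T1) : measurable B -> measurable (nth_half j @^-1` B).
  by move=> mB; apply: measurable_preimage (measurable_nth_half j) mB.
have [mm|mm] := eqVneq m m'; last first.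
  transitivity (lam (nth_half m @^-1` (nth_half l @^-1` (half2 @^-1` (nth_half i @^-1` A))) `&`
     nth_half m' @^-1` (nth_half l' @^-1` (half2 @^-1` (nth_half i' @^-1` A'))))) => //.
  rewrite lam_nth_half2//; [|by apply: ml; exact: mi|by apply: ml; exact: mi].
  by rewrite !lam_nth_half ?li//; exact: mi.
subst m'; have [ll|ll] := eqVneq l l'; last first.
  transitivity (lam (nth_half m @^-1` (nth_half l @^-1` (half2 @^-1` (nth_half i @^-1` A)) `&`
     nth_half l' @^-1` (half2 @^-1` (nth_half i' @^-1` A'))))) => //.
  rewrite lam_nth_half; last by apply: measurableI; apply: ml; exact: mi.
  by rewrite lam_nth_half2 ?li//; exact: mi.
subst l'; have ii : i != i' by apply/eqP => ii; apply: pq; rewrite ii.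
transitivity (lam (nth_half m @^-1` (nth_half l @^-1` (half2 @^-1`
   (nth_half i @^-1` A `&` nth_half i' @^-1` A'))))) => //.
have mII : measurable (nth_half i @^-1` A `&` nth_half i' @^-1` A').
  by apply: measurableI; exact: ml.
have m2 : measurable (half2 @^-1` (nth_half i @^-1` A `&` nth_half i' @^-1` A')).
  exact: measurable_preimage measurable_half2 mII.
by rewrite lam_nth_half ?lam_nth_half ?lam_half2 ?lam_nth_half2//; exact: ml.
Qed.

Lemma present_coords (w : T1) p : present w p -> pickle (coords p) = p.
Proof. by rewrite /present; case: (coords p) => [[m l] i] /andP[/eqP]. Qed.

(** Two independent uniform variables lie in the same one of [N] cells with
probability [1/N]. *)
Lemma ae_times_neq p q : coords p <> coords q ->
  {ae lam, forall w, half1 (mark p w) <> half1 (mark q w)}.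
Proof.
move=> pq.
have h01 := ae_interior p measurable_half1 (@lam_half1 R).
suff H : lam.-negligible [set w | half1 (mark p w) = half1 (mark q w) /\ 0 < half1 (mark p w) < 1].
  have H' : {ae lam, forall w, ~ (half1 (mark p w) = half1 (mark q w) /\ 0 < half1 (mark p w) < 1)}.
    by apply: negligibleS H => w /=; rewrite notK.
  by apply: filterS2 h01 H' => w w01 + e; apply.
apply: negligible_small => e e0.
pose N := (Num.truncn e^-1).+1.
have NR0 : 0 < N%:R :> R by rewrite ltr0n.
have Ne : N%:R^-1 <= e.
  by rewrite -[leRHS]invrK lef_pV2 ?posrE ?invr_gt0// ltW// truncnS_gt.
pose I k : set T1 := half1 @^-1` `[k%:R / N%:R, k.+1%:R / N%:R[%classic.
have mI k : measurable (I k).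
  by apply: measurable_preimage measurable_half1 _; exact: measurable_itv.
have lI k : (k < N)%N -> lam (I k) = (N%:R^-1)%:E.
  by move=> kN; rewrite lam_half1 ?lam_cell//; exact: measurable_itv.
(* each of the [N] events has probability [1 / N^2] *)
pose F k := mark p @^-1` I k `&` mark q @^-1` I k.
have mF k : measurable (F k).
  by apply: measurableI; [apply: measurable_preimage (measurable_mark p) (mI k)|apply: measurable_preimage (measurable_mark q) (mI k)].
exists (\big[setU/set0]_(k < N) F k); split.
- by apply: bigsetU_measurable => k _; exact: mF.
- move=> w /= [xy /andP[x0 x1]]; rewrite -bigcup_mkord.
  have ki := truncn_itv (mulr_ge0 (ler0n R N) (ltW x0)).
  exists (Num.truncn (N%:R * half1 (mark p w))).
    rewrite /= -(ltr_nat R); apply: le_lt_trans (_ : N%:R * half1 (mark p w) < _).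
      by case/andP: ki.
    by rewrite -[ltRHS]mulr1 ltr_pM2l.
  by split; rewrite /I /= in_itv/= -?xy ler_pdivrMr// ltr_pdivlMr// [_ * N%:R]mulrC.
- have sub : (lam (\big[setU/set0]_(k < N) F k) <= \sum_(k < N) lam (F k))%E.
    apply: (@content_subadditive _ _ _ lam) => [k _||]; [exact: mF| |by []].
    by apply: bigsetU_measurable => k _; exact: mF.
  apply: (le_trans sub).
  rewrite (eq_bigr (fun k : 'I_N => (N%:R^-1 * N%:R^-1)%:E)) => [|k _]; last first.
    by rewrite lam_marks// !lI// EFinM.
  rewrite sumEFin lee_fin sumr_const card_ord -[leLHS]mulr_natl mulrA divff ?mul1r//.
  by rewrite lt0r_neq0.
Qed.

(** An empty cell is void up to any height. *)
Lemma ae_cell N k : (0 < N)%N ->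
  {ae lam, forall w : T1, exists p, in_cell (present w) (time w) N k p}.
Proof.
move=> N0; apply: ae_of_small => e e0.
have NR0 : 0 < N%:R :> R by rewrite ltr0n.
(* an empty cell is void up to height [j], with probability [exp(- 1 / e)] *)
pose j := N%:R * e^-1.
have j0 : 0 < j by rewrite mulr_gt0 ?invr_gt0.
pose th k' := if k' == k then j else 0.
have [||mV lV] := @lam_void_event R N th N0 k.+1.
- by move=> k'; rewrite /th; case: ifP => // _; rewrite ltW.
- by move=> k'; rewrite /th; case: eqP => // -> ; rewrite ltnn.
exists (void_event N th); split => //.
  move=> w /= wP p pp; rewrite /th; case: eqP => [pk|_]; last first.
    by apply: le_trans (height_ge w p).
  by case: wP; exists p; rewrite /in_cell pp pk eqxx.
rewrite lV lee_fin.
have -> : \sum_(0 <= k' < k.+1) th k' = j.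
  rewrite big_nat_recr//= big_nat_cond big1 ?add0r => [|k' /andP[/andP[_ kk] _]].
    by rewrite /th eqxx.
  by rewrite /th ltn_eqF.
have -> : j / N%:R = e^-1 by rewrite /j mulrAC divff ?mul1r// lt0r_neq0.
rewrite expRN -[leRHS]invrK lef_pV2 ?posrE ?expR_gt0 ?invr_gt0//.
by have := expR_ge1Dx e^-1; lra.
Qed.

(** Otherwise there would be no point of height at most 1 over [m, m + j], an event of
probability [exp(-j)] for every [j]. *)
Lemma ae_large (m : nat) :
  {ae lam, forall w : T1, exists p, [/\ present w p, m%:R <= time w p & height w p <= 1]}.
Proof.
apply: ae_of_small => e e0.
pose j := (Num.truncn e^-1).+1.
pose th k' : R := if (m <= k' < m + j)%N then 1 else 0.
have [||mV lV] := @lam_void_event R 1 th (ltn0Sn 0) (m + j)%N.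
- by move=> k'; rewrite /th; case: ifP.
- by move=> k' h; rewrite /th ltnNge h andbF.
exists (void_event 1 th); split => //.
  move=> w /= wP p pp; rewrite /th mul1r; case: ifP => [/andP[pk _]|_]; last first.
    by apply: le_trans (height_ge w p).
  rewrite leNgt; apply/negP => h; apply: wP; exists p; split => //; last exact: ltW.
  apply: (@le_trans _ _ (Num.truncn (time w p))%:R); first by rewrite ler_nat.
  by rewrite truncn_le time_ge0.
rewrite lV lee_fin divr1.
have -> : \sum_(0 <= k' < m + j) th k' = j%:R.
  rewrite (@big_cat_nat _ _ _ m)//= ?leq_addr// big_nat_cond big1 ?add0r => [|k' /andP[/andP[_ kk] _]]; last first.
    by rewrite /th leqNgt kk.
  rewrite big_nat_cond (eq_bigr (fun=> 1)) => [|k' /andP[h _]]; last by rewrite /th h.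
  by rewrite -big_nat_cond big_const_nat iter_addr addr0 addKn.
rewrite expRN -[leRHS]invrK lef_pV2 ?posrE ?expR_gt0 ?invr_gt0//.
by have := expR_ge1Dx (j%:R : R); have := truncnS_gt e^-1; rewrite -/j; lra.
Qed.

End almost_sure.

Section summability.
Context {R : realType}.
Local Notation T1 := (measurableTypeR R).
Local Notation lam := (@lam R).

Lemma ler_sum_sub (T : eqType) (s1 s2 : seq T) (F : T -> R) :
  uniq s1 -> uniq s2 -> {subset s1 <= s2} -> (forall x, 0 <= F x) ->
  \sum_(x <- s1) F x <= \sum_(x <- s2) F x.
Proof.
move=> u1 u2 sub F0.
have -> : \sum_(x <- s1) F x = \sum_(x <- s2 | x \in s1) F x.
  rewrite -[RHS]big_filter; apply: perm_big; apply: uniq_perm => //.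
    exact: filter_uniq.
  move=> x; rewrite mem_filter; case e : (x \in s1) => //=.
  by rewrite sub.
by rewrite big_mkcond; apply: ler_sum => x _; case: ifP.
Qed.

(** Markov's inequality for [2^X], where [X] is a Poisson variable of parameter 1;
its expectation is [exp 1]. *)
Lemma pcumul_tail n : 1 - pcumul n <= expR (-1) * expR 2 / 2 ^+ n :> R.
Proof.
have L1 : (fun k => pcumul k - pcumul n : R) @ \oo --> 1 - pcumul n.
  by apply: cvgB; [exact: pcumul_cvg|exact: cvg_cst].
have L2 : (fun _ : nat => expR (-1) * expR 2 / 2 ^+ n : R) @ \oo --> expR (-1) * expR 2 / 2 ^+ n.
  exact: cvg_cst.
apply: (ler_cvg_to L1 L2); near=> k; have nk : (n <= k)%N by near: k; exact: nbhs_infty_ge.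
rewrite /pcumul (big_cat_nat _ nk)//= addrAC subrr add0r.
have e2 : series (exp_coeff 2) k <= expR 2 :> R.
  apply: nondecreasing_cvgn_le; last exact: is_cvg_series_exp_coeff.
  apply/nondecreasing_seqP => j; rewrite /series /= big_nat_recr//= lerDl.
  by rewrite /exp_coeff/= divr_ge0// exprn_ge0.
rewrite -mulr_sumr -mulrA ler_pM2l ?expR_gt0// ler_pdivlMr ?exprn_gt0//.
apply: le_trans e2; rewrite seriesEnat /= [leRHS](big_cat_nat _ nk)//= mulr_suml.
apply: ler_wpDl.
  by apply: sumr_ge0 => j _; rewrite /exp_coeff/= divr_ge0// exprn_ge0.
rewrite [leLHS]big_nat [leRHS]big_nat; apply: ler_sum => j /andP[nj _].
rewrite /exp_coeff/= mulrC ler_pM2r ?invr_gt0 ?ltr0n ?fact_gt0//.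
by rewrite ler_weXn2l// ler1n.
Unshelve. all: by end_near. Qed.

(** A square has an [i]-th point with geometrically small probability, so that
sums over points reduce to sums over squares. *)
Lemma lam_present p : (lam [set w | present w p] <=
  (expR (-1) * expR 2 / 2 ^+ (coords p).2)%:E)%E.
Proof.
have mp := @measurable_present R p; move: mp.
rewrite /present; case: (coords p) => [[m l] i] /= mp.
have mA : measurable [set u : T1 | (i < pois u)%N].
  exact: (measurable_preimage (A := [set n | (i < n)%N]) measurable_pois).
have mB : measurable (half1 @^-1` [set u : T1 | (i < pois u)%N]).
  exact: measurable_preimage measurable_half1 mA.
have mC : measurable (nth_half l @^-1` (half1 @^-1` [set u : T1 | (i < pois u)%N])).
  exact: measurable_preimage (measurable_nth_half l) mB.
apply: (@le_trans _ _ (lam (nth_half m @^-1` (nth_half l @^-1` (half1 @^-1` [set u : T1 | (i < pois u)%N]))))).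
  apply: le_measure; rewrite ?inE//; last by move=> w /= /andP[].
  exact: measurable_preimage (measurable_nth_half m) mC.
rewrite !lam_nth_half ?lam_half1// lamE.
have -> : [set u : T1 | (i < pois u)%N] `&` `[0, 1[ = `[pcumul i.+1, 1[%classic.
  have p0 : 0 <= pcumul i.+1 :> R by apply: sumr_ge0 => j _; rewrite divr_ge0 ?expR_ge0.
  apply/seteqP; split=> u /=; rewrite !in_itv/=.
    by move=> [+ u01]; rewrite pois_gt// => ->; case/andP: u01.
  move=> /andP[u0 u1]; have u01 : 0 <= u < 1 by rewrite (le_trans p0 u0).
  by split => //; rewrite pois_gt.
rewrite lebesgue_measure_itv/= lte_fin pcumul_lt1 -EFinB lee_fin.
apply: (le_trans (pcumul_tail _)).
rewrite ler_pM2l ?mulr_gt0 ?expR_gt0// lef_pV2 ?posrE ?exprn_gt0//.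
by rewrite ler_weXn2l// ler1n.
Qed.

Variable beta : R.
Hypothesis beta01 : 0 < beta < 1.

Let b1 : 1 < beta^-1.
Proof. by case/andP: beta01 => b0 b1; rewrite invf_gt1. Qed.

(** The expectation of the sum is finite, being at most a constant times the sum of
[l^(-1/beta)] over [l >= 1], for each column of squares. Points in the lowest
squares have no lower bound on their height; there are finitely many of them in
a strip, and [sum_of_upper] adds them. *)
Lemma ae_sum_upper (M : nat) : {ae lam, forall w : T1, exists C : R, forall K,
  \sum_(0 <= p < K | present w p && ((coords p).1.1 < M)%N && (0 < (coords p).1.2)%N)
    (coords p).1.2%:R `^ (- beta^-1) <= C}.
Proof.
pose g (p : nat) : R :=
  if ((coords p).1.1 < M)%N && (0 < (coords p).1.2)%N then (coords p).1.2%:R `^ (- beta^-1) else 0.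
have g0 p : 0 <= g p by rewrite /g; case: ifP => // _; exact: powR_ge0.
pose A (p : nat) : set T1 := [set w | present w p].
have mA p : measurable (A p) by exact: measurable_present.
pose f (p : nat) (w : T1) : \bar R := ((g p)%:E * (\1_(A p) w)%:E)%E.
have f0 p w : (0 <= f p w)%E by rewrite mule_ge0// lee_fin.
have mf p : measurable_fun setT (f p).
  by apply: emeasurable_funM => //; apply/measurable_EFinP.
pose e0 : R := expR (-1) * expR 2.
have e00 : 0 <= e0 by rewrite mulr_ge0 ?expR_ge0.
pose h (c : nat * nat * nat) : R := if (c.1.1 < M)%N && (0 < c.1.2)%N then
  c.1.2%:R `^ (- beta^-1) * (e0 / 2 ^+ c.2) else 0.
have h0 c : 0 <= h c.
  by rewrite /h; case: ifP => // _; rewrite mulr_ge0 ?powR_ge0// divr_ge0// exprn_ge0.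
have intf p : (\int[lam]_w f p w <= (if pickle (coords p) == p then h (coords p) else 0)%:E)%E.
  rewrite ge0_integralZl_EFin//; last by apply/measurable_EFinP.
  rewrite integral_indic// setIT; case: eqP => pp; last first.
    rewrite (_ : A p = set0) ?measure0 ?mule0//.
    by apply/seteqP; split=> // w /= /present_coords.
  rewrite /g /h; case: ifP => _; last by rewrite mul0e.
  by rewrite [leRHS]EFinM; apply: lee_wpmul2l; [rewrite lee_fin powR_ge0|exact: lam_present].
have [Cz HCz] := zeta_bounded b1.
(* [M] columns of squares, the sum over [l] of [l^(-1/beta)], and a geometric series over [i] *)
pose D : R := M%:R * Cz * (e0 * 2).
have Cz0 : 0 <= Cz by have := HCz 0%N; rewrite big_geq.
have bound K : \sum_(0 <= p < K) (if pickle (coords p) == p then h (coords p) else 0) <= D.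
  rewrite -big_mkcond -big_filter -(big_map coords xpredT h).
  set s1 := [seq coords p | p <- _].
  pose L := (\max_(c <- s1) maxn c.1.2 c.2).+1.
  pose s2 := [seq (x, i) | x <- [seq (m, l) | m <- iota 0 M, l <- iota 1 L], i <- iota 0 L].
  have us1 : uniq s1.
    rewrite map_inj_in_uniq ?filter_uniq ?iota_uniq// => p q.
    by rewrite !mem_filter => /andP[/eqP pp _] /andP[/eqP qq _] e; rewrite -pp -qq e.
  have us2 : uniq s2.
    apply: allpairs_uniq; [|exact: iota_uniq|by move=> [? ?] [? ?]].
    by apply: allpairs_uniq; [exact: iota_uniq|exact: iota_uniq|move=> [? ?] [? ?]].
  rewrite (bigID (fun c => (c.1.1 < M)%N && (0 < c.1.2)%N))/= [X in _ + X]big1 ?addr0; last first.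
    by move=> c /negbTE cc; rewrite /h cc.
  rewrite -big_filter.
  apply: (le_trans (ler_sum_sub _ us2 _ h0)).
  - exact: filter_uniq.
  - move=> [[m l] i]; rewrite mem_filter /= => /andP[/andP[mM l0] cs].
    have : (maxn l i < L)%N.
      rewrite ltnS /=.
      exact: (@leq_bigmax_seq _ s1 xpredT (fun c : nat * nat * nat => maxn c.1.2 c.2) _ cs isT).
    rewrite gtn_max => /andP[lL iL].
    apply/allpairsP; exists ((m, l), i); split => //; last by rewrite mem_iota.
    by apply/allpairsP; exists (m, l); split => //; rewrite mem_iota ?add0n ?mM ?l0 ?add1n ?ltnS ?(ltnW lL).
  rewrite big_allpairs big_allpairs /=.
  have geo : \sum_(i <- iota 0 L) (e0 / 2 ^+ i) <= e0 * 2.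
    rewrite -mulr_sumr ler_wpM2l//.
    have H n : \sum_(i <- iota 0 n) (2 ^+ i)^-1 = 2 - 2 * (2 ^+ n)^-1 :> R.
      elim: n => [|n IH]; first by rewrite big_nil expr0; lra.
      rewrite -addn1 iotaD big_cat/= IH big_seq1 add0n addn1 exprS invfM; lra.
    by rewrite H gerBl mulr_ge0// invr_ge0 exprn_ge0.
  apply: (@le_trans _ _ (\sum_(m <- iota 0 M) \sum_(l <- iota 1 L) (l%:R `^ (- beta^-1) * (e0 * 2)))).
    apply: ler_sum => m _; apply: ler_sum => l _.
    apply: le_trans (ler_wpM2l (powR_ge0 _ _) geo).
    rewrite mulr_sumr; apply: ler_sum => i _; rewrite /h; case: ifP => // _.
    by rewrite mulr_ge0 ?powR_ge0// divr_ge0// exprn_ge0.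
  rewrite big_const_seq iter_addr addr0 count_predT size_iota -[leLHS]mulr_natl /D -mulrA.
  rewrite ler_wpM2l// -mulr_suml ler_wpM2r ?mulr_ge0//.
  by apply: le_trans (HCz L.+1); rewrite /index_iota subn1.
have intS : (\int[lam]_w (\sum_(p <oo) f p w) < +oo)%E.
  rewrite integral_nneseries//; apply: (@le_lt_trans _ _ D%:E); last by rewrite ltry.
  apply: lime_le; first by apply: is_cvg_nneseries => p _ _; exact: integral_ge0.
  near=> K; apply: (@le_trans _ _ (\sum_(0 <= p < K) (if pickle (coords p) == p then h (coords p) else 0)%:E)%E).
    by apply: lee_sum => p _; exact: intf.
  by rewrite sumEFin lee_fin.
have mS : measurable_fun setT (fun w => (\sum_(p <oo) f p w)%E).
  by apply: ge0_emeasurable_sum => // p w _ _; exact: f0.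
have S0 w : (0 <= \sum_(p <oo) f p w)%E by exact: nneseries_ge0.
have iS : lam.-integrable setT (fun w => (\sum_(p <oo) f p w)%E).
  apply/integrableP; split => //.
  by under eq_integral do rewrite gee0_abs//.
apply: filterS (integrable_ae measurableT iS) => w /(_ I) fw.
exists (fine (\sum_(p <oo) f p w)%E) => K.
rewrite -lee_fin fineK//.
apply: le_trans (nneseries_lim_ge K _) => //.
rewrite -sumEFin /f; rewrite big_mkcond; apply: lee_sum => p _.
rewrite /g indicE /A; case: (boolP (present w p)) => pp /=.
  by rewrite mem_set// mule1; case: ifP.
by rewrite memNset ?mule0//; exact/negP.
Unshelve. all: by end_near. Qed.

End summability.

Section good.
Context {R : realType}.
Local Notation T1 := (measurableTypeR R).
Local Notation lam := (@lam R).
Variable beta : R.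
Hypothesis beta01 : 0 < beta < 1.

Lemma sum_of_upper (w : T1) : (forall M : nat, exists C : R, forall K,
  \sum_(0 <= p < K | present w p && ((coords p).1.1 < M)%N && (0 < (coords p).1.2)%N)
    (coords p).1.2%:R `^ (- beta^-1) <= C) ->
  forall m, exists C : R, forall K,
    \sum_(0 <= p < K | strip (present w) (time w) m p) height w p `^ (- beta^-1) <= C.
Proof.
move=> H m; have [C HC] := H m.
have b0 : 0 <= beta^-1 by rewrite invr_ge0 ltW//; case/andP: beta01.
(* finitely many points: [m] squares, each carrying a Poisson number *)
pose low p := [&& present w p, ((coords p).1.1 < m)%N & ((coords p).1.2 == 0)%N].
have [K1 HK1] : exists K1, forall p, low p -> (p < K1)%N.
  exists (\max_(m' < m) \max_(i < pois (half1 (square m' 0 w))) pickle (m' : nat, 0%N, i : nat)).+1.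
  move=> p /and3P[+ +]; rewrite /present.
  case: (coords p) => [[m' l] i] /= /andP[/eqP <- ip] mm /eqP l0; subst l.
  rewrite ltnS; apply: leq_trans (@leq_bigmax_cond _ xpredT (fun m' : 'I_m => \max_(i < pois (half1 (square m' 0 w))) pickle (m' : nat, 0%N, i : nat)) (Ordinal mm) isT) => /=.
  exact: (@leq_bigmax_cond _ xpredT (fun i : 'I_(pois (half1 (square m' 0 w))) => pickle (m', 0%N, i : nat)) (Ordinal ip) isT).
have F0 p : 0 <= height w p `^ (- beta^-1) by exact: powR_ge0.
exists (C + \sum_(0 <= p < K1 | low p) height w p `^ (- beta^-1)) => K.
have -> : \sum_(0 <= p < K | strip (present w) (time w) m p) height w p `^ (- beta^-1) =
   \sum_(0 <= p < K | strip (present w) (time w) m p && (0 < (coords p).1.2)%N) height w p `^ (- beta^-1) +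
   \sum_(0 <= p < K | strip (present w) (time w) m p && ((coords p).1.2 == 0)%N) height w p `^ (- beta^-1).
  rewrite (bigID (fun p => 0 < (coords p).1.2)%N)/=; congr (_ + _).
  by apply: eq_bigl => p; rewrite -leqNgt leqn0.
have time_m p : time w p < m%:R -> ((coords p).1.1 < m)%N.
  rewrite -(ltr_nat R); apply: le_lt_trans; rewrite lerDl.
  by case/andP: (half1_itv (mark p w)).
apply: lerD.
  apply: le_trans (HC K); rewrite big_mkcond [leRHS]big_mkcond; apply: ler_sum => p _.
  rewrite /strip; case: ifP => [/andP[/andP[pp /time_m ->] l0]|_].
    by rewrite pp l0 /= ler_powRN ?ltr0n// height_ge.
  by case: ifP => // _; exact: powR_ge0.
have sum_low : \sum_(0 <= p < maxn K K1 | low p) height w p `^ (- beta^-1) <=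
    \sum_(0 <= p < K1 | low p) height w p `^ (- beta^-1).
  rewrite (big_cat_nat _ (leq_maxr K K1))//= big_nat_cond [X in _ + X]big_nat_cond.
  rewrite [X in _ + X]big1 ?addr0 -?big_nat_cond// => p /andP[/andP[Kp _] /HK1].
  by rewrite ltnNge Kp.
apply: le_trans sum_low.
rewrite [leRHS](big_cat_nat _ (leq_maxl K K1))//= -[leLHS]addr0; apply: lerD; last exact: sumr_ge0.
rewrite big_mkcond [leRHS]big_mkcond; apply: ler_sum => p _.
rewrite /strip /low; case: ifP => [/andP[/andP[pp /time_m ->] l0]|_].
  by rewrite pp l0.
by case: ifP.
Qed.

Lemma ae_good_config :
  {ae lam, forall w : T1, good_config beta (present w) (time w) (height w)}.
Proof.
have a1 : {ae lam, forall w, forall p, 0 < half1 (mark p w) < 1}.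
  by apply: ae_foralln => p; exact: ae_interior measurable_half1 (@lam_half1 R).
have a2 : {ae lam, forall w, forall p, 0 < half2 (mark p w) < 1}.
  by apply: ae_foralln => p; exact: ae_interior measurable_half2 (@lam_half2 R).
have a3 : {ae lam, forall w : T1, forall m : nat, exists C : R, forall K,
  \sum_(0 <= p < K | present w p && ((coords p).1.1 < m)%N && (0 < (coords p).1.2)%N)
    (coords p).1.2%:R `^ (- beta^-1) <= C}.
  by apply: ae_foralln => m; exact: ae_sum_upper.
have a4 : {ae lam, forall w : T1, forall p q, coords p <> coords q ->
    half1 (mark p w) <> half1 (mark q w)}.
  apply: ae_foralln => p; apply: ae_foralln => q.
  have [pq|pq] := pselect (coords p = coords q); first by apply: aeW.
  by apply: filterS (ae_times_neq pq) => w.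
have a5 : {ae lam, forall w : T1, forall N k, (0 < N)%N ->
    exists p, in_cell (present w) (time w) N k p}.
  apply: ae_foralln => N; apply: ae_foralln => k.
  have [N0|N0] := posnP N; first by rewrite N0; apply: aeW.
  by apply: filterS (ae_cell k N0) => w.
have a6 : {ae lam, forall w : T1, forall m : nat, exists p,
    [/\ present w p, m%:R <= time w p & height w p <= 1]}.
  by apply: ae_foralln => m; exact: ae_large.
near=> w; have h1 p : 0 < half1 (mark p w) < 1 by move: p; near: w.
have h2 p : 0 < half2 (mark p w) < 1 by move: p; near: w.
split.
- by move=> p _; rewrite ltr_wpDl//; case/andP: (h1 p).
- by move=> p _; rewrite ltr_wpDl//; case/andP: (h2 p).
- by apply: sum_of_upper; near: w.
- move=> p q pp qq e; apply: contrapT => pq.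
  have cpq : coords p <> coords q.
    by move=> cpq; apply: pq; rewrite -(present_coords pp) -(present_coords qq) cpq.
  have : half1 (mark p w) <> half1 (mark q w) by move: p q cpq {pp qq e pq}; near: w.
  apply; move: e; rewrite /time => e.
  have /andP[p0 p1] := h1 p; have /andP[q0 q1] := h1 q.
  have mm : (coords p).1.1 = (coords q).1.1.
    have tp : Num.truncn (time w p) = (coords p).1.1.
      by apply: truncn_def; rewrite /time lerDl ltW//= -natr1 ltrD2l.
    have tq : Num.truncn (time w q) = (coords q).1.1.
      by apply: truncn_def; rewrite /time lerDl ltW//= -natr1 ltrD2l.
    by rewrite -tp -tq /time e.
  by move: e; rewrite mm; apply: addrI.
- by move=> N k; move: N k; near: w.
- by move=> m; move: m; near: w.
Unshelve. all: by end_near. Qed.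

(** Bad samples will be replaced by [w0], so that the coupled walks converge
everywhere and the limit has continuous paths for every sample. *)
Lemma exists_good_sample : exists G : set T1, exists w0 : T1,
  [/\ measurable G, lam (~` G) = 0%E, G w0 &
      forall w, G w -> good_config beta (present w) (time w) (height w)].
Proof.
have [N [mN N0 NG]] := ae_good_config.
have [w0 w0N] : exists w0, ~ N w0.
  apply: contrapT => h; have : lam N = 1%E.
    rewrite -lam_setT; congr (lam _); apply/seteqP; split=> // w _.
    by apply: contrapT => Nw; apply: h; exists w.
  by rewrite N0 => /esym/eqP; rewrite onee_eq0.
exists (~` N), w0; split => //; first exact: measurableC.
  by rewrite setCK.
by move=> w Nw; apply: contrapT => h; apply: Nw; exact: NG.
Qed.

End good.

(** * Digits of the tower *)

(** A digit consists of a sojourn time and a label. *)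
Definition digit_walk {R : realType} (g : nat -> R) (d : nat -> nat * nat) (n : nat) : R :=
  layout (fun k => (d k).1%:R) (fun k => g (d k).2) (iota 0 n) n%:R.

Section tower_digits.
Context {R : realType}.
Local Notation T1 := (measurableTypeR R).
Local Notation leb := (@lebesgue_measure R).
Local Notation lam := (@lam R).
Local Notation tower := (T1 * T1 * nat)%type.
Variables (B : interval_partition R Zplus) (J : set nat) (C : interval_partition R J).

Definition sojourn (x : T1) : nat := (block_index B x).-1.+1.

(** From [(x, r)] the orbit first spends [r + 1] steps in the column of [x],
then visits the columns of [S x], [S^2 x] and so on. The sojourn time in the column over
[B_i] is [i], the number of its levels. *)
Definition tower_digits (y : tower) (k : nat) : nat * nat :=
  (if k == 0%N then y.2.+1 else sojourn (iter k (block_map B) y.1.1),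
   block_index C (iter k (block_map C) y.1.2)).

Lemma digit_walk_ge (g : nat -> R) d n K : (n <= K)%N -> (forall k, (0 < (d k).1)%N) ->
  layout (fun k => (d k).1%:R) (fun k => g (d k).2) (iota 0 K) n%:R = digit_walk g d n.
Proof.
move=> nK d0; rewrite -(subnKC nK) iotaD layout_saturated//.
rewrite -[leLHS](_ : \sum_(k <- iota 0 n) 1 = _).
  by apply: ler_sum => k _; rewrite ler1n.
by rewrite big_const_seq iter_addr addr0 count_predT size_iota.
Qed.

Lemma tower_digits_gt0 y k : (0 < (tower_digits y k).1)%N.
Proof. by rewrite /tower_digits /=; case: ifP. Qed.

(** By induction on the number of steps. A step above the base shortens the
current interval by 1; a step from the base uses it up and shifts the
digits. *)
Lemma tower_birkhoff (g : nat -> R) n y :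
  birkhoff_sum (tower_map B C) (fun y => g (block_index C y.1.2)) n y =
  digit_walk g (tower_digits y) n.
Proof.
elim: n y => [|n IH] [[x1 x2] r]; first by rewrite /birkhoff_sum big_ord0.
rewrite /birkhoff_sum big_ord_recl /=.
under eq_bigr do rewrite -iterS iterSr.
have := IH (tower_map B C (x1, x2, r)); rewrite /birkhoff_sum => ->.
case: r => [|r] /=.
  rewrite /digit_walk /= min_l; last by rewrite ler1n.
  rewrite mulr1 -natr1 addrK max_l//; congr (_ + _).
  rewrite -[iota 1 n]/(iota (1 + 0) n) iotaDl layout_map.
  apply: eq_layout => k _ /=; rewrite /tower_digits /= -!iterSr//=.
  by case: k.
rewrite -(@digit_walk_ge _ _ _ n.+1)//; last exact: tower_digits_gt0.
rewrite /digit_walk /= addrA; congr (_ + _).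
  have e : Num.min r.+2%:R n.+1%:R = 1 + Num.min r.+1%:R n%:R :> R.
    by rewrite -(natr1 r.+1) -(natr1 n) -addr_minl addrC.
  by rewrite e mulrDr mulr1.
have -> : n.+1%:R - r.+2%:R = n%:R - r.+1%:R :> R by rewrite -!natr1; lra.
apply: eq_layout => k; rewrite mem_iota => /andP[k0 _]; rewrite /tower_digits /=;
 by case: k k0.
Qed.

Lemma measurable_sojourn : measurable_fun setT sojourn.
Proof.
exact: (measurableT_comp (f := fun i : nat => i.-1.+1) _ (measurable_block_index B)).
Qed.

Lemma measurable_tower_digits k v : measurable [set y | tower_digits y k = v].
Proof.
have mS : measurable_fun setT (fun y : tower => sojourn (iter k (block_map B) y.1.1)).
  apply: (measurableT_comp measurable_sojourn).
  apply: (measurableT_comp (f := iter k (block_map B : T1 -> T1))).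
    exact: measurable_iter (measurable_block_map B).
  exact: (measurableT_comp measurable_fst measurable_fst).
have mC : measurable_fun setT (fun y : tower => block_index C (iter k (block_map C) y.1.2)).
  apply: (measurableT_comp (measurable_block_index C)).
  apply: (measurableT_comp (f := iter k (block_map C : T1 -> T1))).
    exact: measurable_iter (measurable_block_map C).
  exact: (measurableT_comp measurable_snd measurable_fst).
have m1 : measurable [set y : tower | (if k == 0%N then y.2.+1 else sojourn (iter k (block_map B) y.1.1)) = v.1].
  case: (k == 0%N); last exact: (measurable_preimage mS (A := [set v.1])).
  have m2 : measurable_fun setT (fun y : tower => y.2) by exact: measurable_snd.
  exact: (measurable_preimage m2 (A := [set r | r.+1 = v.1])).
have m3 := measurable_preimage mC (A := [set v.2]) I.
rewrite (_ : [set y | _] = [set y : tower | (if k == 0%N then y.2.+1 else sojourn (iter k (block_map B) y.1.1)) = v.1]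
  `&` (fun y : tower => block_index C (iter k (block_map C) y.1.2)) @^-1` [set v.2]).
  exact: measurableI.
apply/seteqP; split=> y /=; rewrite /tower_digits; first by move=> <-.
by case: v {m1 m3} => v1 v2 /= [-> ->].
Qed.

(** The common law of the digits of the tower and of the coupled digits. The
factor [setT] accounts for the deterministic first sojourn time. *)
Definition digit_prob K (v : nat -> nat * nat) : R :=
  if v 0%N is (1%N, _) then
    (\prod_(k < K) fine (lam (if k == 0%N :> nat then setT else sojourn @^-1` [set (v k).1]))) *
    (\prod_(k < K) fine (lam (block_index C @^-1` [set (v k).2])))
  else 0.

Lemma nu0_cylinder K v : (0 < K)%N ->
  nu0 B [set y | forall k, (k < K)%N -> tower_digits y k = v k] = (digit_prob K v)%:E.
Proof.
move=> K0; rewrite nu0E.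
pose A1 k : set nat := if k == 0%N then setT else [set i | i.-1.+1 = (v k).1].
pose A2 k : set nat := [set (v k).2].
pose D1 := path_event (block_index B) (block_map B : T1 -> T1) K A1.
pose D2 := path_event (block_index C) (block_map C : T1 -> T1) K A2.
have mD1 : measurable (D1 : set T1).
  apply: (measurable_path_event (measurable_block_index B) (measurable_block_map B)).
  by move=> k.
have mD2 : measurable (D2 : set T1).
  apply: (measurable_path_event (measurable_block_index C) (measurable_block_map C)).
  by move=> k.
have mI : measurable (`[0, 1[%classic : set T1) by exact: measurable_itv.
have [v1|v1] := eqVneq (v 0%N).1 1%N; last first.
  rewrite (_ : _ `&` L0 = set0); last first.
    apply/seteqP; split=> // [[[x1 x2] r]] /= [yv [_ /= r0]].
    have := yv 0%N K0; rewrite /tower_digits /= r0 => /(congr1 fst)/= e.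
    by move: v1; rewrite -e.
  rewrite measure0 /digit_prob; case: (v 0%N) v1 => a b /=.
  by case: a => [|[|a]].
rewrite (_ : _ `&` L0 = ((D1 `&` `[0, 1[) `*` (D2 `&` `[0, 1[)) `*` [set 0%N]); last first.
  apply/seteqP; split=> [[[x1 x2] r] /= [yv [[/= x1I x2I] /= r0]]|[[x1 x2] r] /= [[[xD1 x1I] [xD2 x2I]] r0]].
    split => //; split; split => // k kK; have := yv k kK; rewrite /tower_digits /=.
      by rewrite /A1; case: eqP => // k0 /(congr1 fst).
    by move=> /(congr1 snd).
  split; last by split => //; split.
  move=> k kK; rewrite /tower_digits /=; have := xD1 k kK; have := xD2 k kK.
  rewrite /A1 /A2 /=; case: eqP => [k0|_] -> /=; last by rewrite /sojourn => ->; case: (v k).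
  by move=> _; rewrite r0 k0; case: (v 0%N) v1 => a b /= ->.
rewrite nu_level; last 2 first.
- by apply: measurableX; exact: measurableI.
- by move=> [x1 x2] /= [[_ x1I] [_ x2I]]; split.
rewrite /rho/= /mrestr (_ : _ `&` Sigma = (D1 `&` `[0, 1[) `*` (D2 `&` `[0, 1[)); last first.
  by apply/seteqP; split=> [[x1 x2] /= [[[? ?] [? ?]] _]//|[x1 x2] /= [[? ?] [? ?]]]; split.
apply: etrans (product_measure1E leb leb _ _) _; do ?exact: measurableI.
transitivity (lam D1 * lam D2)%E => //.
have -> : lam D1 = (\prod_(k < K) fine (lam (block_index B @^-1` A1 k)))%:E.
  apply: (prob_path_event (P := lam) (measurable_block_index B) (measurable_block_map B)) => // A E mA.
  exact: block_digit_indep.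
have -> : lam D2 = (\prod_(k < K) fine (lam (block_index C @^-1` A2 k)))%:E.
  apply: (prob_path_event (P := lam) (measurable_block_index C) (measurable_block_map C)) => // A E mA.
  exact: block_digit_indep.
rewrite -EFinM /digit_prob; congr EFin.
case: (v 0%N) v1 => a b /= ->; congr (_ * _).
by apply: eq_bigr => k _; rewrite /A1; case: eqP.
Qed.

End tower_digits.

(** * Changing samples on null sets, and passing from distribution functions to laws *)

Section cdf_to_pmf.
Context d (T : measurableType d) {R : realType} (P : probability T R).
Variables (X : nat -> T -> nat) (F : nat -> R).
Hypothesis mX : forall k i, measurable [set w | (X k w <= i)%N].
Hypothesis X_le : forall K (i : nat -> nat),
  P [set w | forall k, (k < K)%N -> (X k w <= i k)%N] = (\prod_(k < K) F (i k))%:E.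

Definition cdf_step i : R := F i - (if i is i'.+1 then F i' else 0).

Lemma measurable_eq_event k i : measurable [set w | X k w = i].
Proof.
have [->|i0] := posnP i.
  rewrite (_ : [set _ | _] = [set w | (X k w <= 0)%N])//.
  by apply/seteqP; split=> w /=; rewrite leqn0 => /eqP.
rewrite (_ : [set _ | _] = [set w | (X k w <= i)%N] `\` [set w | (X k w <= i.-1)%N]).
  exact: measurableD.
apply/seteqP; split=> w /= => [->|[h1 h2]]; first by split => //; lia.
by apply/eqP; move/negP: h2; lia.
Qed.

(** Inequalities are turned into equalities one coordinate at a time: the event
[X = n + 1] is the difference of [X <= n + 1] and [X <= n]. *)
Lemma prob_eq_event K (i : nat -> nat) :
  P [set w | forall k, (k < K)%N -> X k w = i k] = (\prod_(k < K) cdf_step (i k))%:E.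
Proof.
(* equalities for the first [j] coordinates, inequalities for the others *)
pose E j i := [set w | forall k, (k < K)%N -> if (k < j)%N then X k w = i k else (X k w <= i k)%N].
have mE j i' : measurable (E j i').
  apply: (@measurable_forall_lt _ _ _ (fun k w => if (k < j)%N then X k w = i' k else (X k w <= i' k)%N)) => k.
  by case: (k < j)%N; [exact: measurable_eq_event|exact: mX].
suff H j : (j <= K)%N -> forall i, P (E j i) =
    (\prod_(0 <= k < j) cdf_step (i k) * \prod_(j <= k < K) F (i k))%:E.
  rewrite -(big_mkord xpredT (fun k => cdf_step (i k))).
  have := H K (leqnn K) i; rewrite [X in _ * X]big_geq// mulr1 => <-.
  congr (P _); apply/seteqP; split=> w wE k kK; first by rewrite kK; exact: wE.
  by have := wE k kK; rewrite kK.
elim: j => [|j IH] jK i'.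
  rewrite [X in X * _]big_geq// mul1r big_mkord.
  have -> : E 0%N i' = [set w | forall k, (k < K)%N -> (X k w <= i' k)%N] by [].
  exact: X_le.
have jK' := ltnW jK.
have kS k : (k < j.+1)%N = (k == j) || (k < j)%N by rewrite ltnS leq_eqVlt.
have split_prod (i2 : nat -> nat) : \prod_(j <= k < K) F (i2 k) = F (i2 j) * \prod_(j.+1 <= k < K) F (i2 k).
  by rewrite big_ltn.
have eqE i1 i2 a b : (forall k, (a <= k < b)%N -> i1 k = i2 k :> nat) ->
    \prod_(a <= k < b) F (i1 k) = \prod_(a <= k < b) F (i2 k).
  by move=> h; rewrite big_nat [RHS]big_nat; apply: eq_bigr => k /h ->.
case e : (i' j) => [|n].
  have -> : E j.+1 i' = E j i'.
    apply/seteqP; split=> w wE k kK; have := wE k kK; rewrite kS.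
      by case: eqP => [->|_] //=; rewrite ltnn => ->.
    by case: eqP => [->|_] //=; rewrite ltnn e leqn0 => /eqP.
  by rewrite IH// split_prod big_nat_recr//= -mulrA /cdf_step e subr0.
pose i2 k := if k == j then n else i' k.
have -> : E j.+1 i' = E j i' `\` E j i2.
  apply/seteqP; split=> w.
    move=> wE; split=> [k kK|wE2].
      have := wE k kK; rewrite kS; case: eqP => [->|_]//=.
      by rewrite ltnn => ->.
    by have := wE2 j jK; have := wE j jK; rewrite ltnSn ltnn /i2 eqxx e => ->; rewrite ltnn.
  move=> [wE wE2] k kK; rewrite kS; case: eqP => [kj|kj] /=; last first.
    by have := wE k kK.
  have Xj : (X j w <= n.+1)%N by have := wE j jK; rewrite ltnn e.
  rewrite kj e; apply/eqP; rewrite eqn_leq Xj /= ltnNge; apply/negP => Xn.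
  apply: wE2 => k' k'K; have := wE k' k'K; rewrite /i2.
  by case: eqP => [->|//]; rewrite ltnn.
have sub : E j i2 `<=` E j i'.
  move=> w wE k kK; have := wE k kK; rewrite /i2; case: eqP => [->|//].
  by rewrite ltnn e => /leq_trans; apply.
have -> : P (E j i' `\` E j i2) = (P (E j i') - P (E j i' `&` E j i2))%E.
  apply: measureD => //.
  by apply: le_lt_trans (probability_le1 P (mE j i')) _; rewrite ltry.
rewrite setIidr// !IH// -EFinB; congr EFin.
rewrite !split_prod big_nat_recr//= /cdf_step e /i2 eqxx.
rewrite (eqE (fun k => if k == j then n else i' k) i'); last first.
  by move=> k /andP[jk _]; case: eqP => // kj; move: jk; rewrite kj ltnn.
have -> : \prod_(0 <= k < j) (F (if k == j then n else i' k) - match (if k == j then n else i' k) with | 0%N => 0 | i'0.+1 => F i'0 end) =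
   \prod_(0 <= k < j) cdf_step (i' k).
  by rewrite big_nat [RHS]big_nat; apply: eq_bigr => k /andP[_ kj]; rewrite ltn_eqF.
by rewrite /cdf_step; ring.
Qed.

End cdf_to_pmf.

Section regularize.
Context {R : realType}.
Local Notation T1 := (measurableTypeR R).
Local Notation lam := (@lam R).
Variables (G : set T1) (x0 : T1).
Hypothesis mG : measurable G.
Hypothesis G1 : lam (~` G) = 0%E.

(** The identity up to a null set, with all its values in [G]. *)
Definition regular (x : T1) : T1 := if x \in G then x else x0.

Lemma measurable_regular : measurable_fun setT regular.
Proof.
move=> _ E mE; rewrite setTI.
rewrite (_ : _ @^-1` _ = (G `&` E) `|` (~` G `&` [set _ | E x0])); last first.
  apply/seteqP; split=> x; rewrite /regular /=.
    have [Gx|Gx] := pselect (G x); first by rewrite mem_set// => ?; left.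
    by rewrite memNset// => ?; right.
  by move=> [[Gx Ex]|[Gx Ex]]; [rewrite mem_set|rewrite memNset].
apply: measurableU; first exact: measurableI.
apply: measurableI; first exact: measurableC.
have [Ex|Ex] := pselect (E x0).
  by rewrite (_ : [set _ | _] = setT)//; apply/seteqP; split.
by rewrite (_ : [set _ | _] = set0)//; apply/seteqP; split.
Qed.

Lemma regular_in x : G x0 -> G (regular x).
Proof. by rewrite /regular; case: ifPn => // /set_mem. Qed.

Lemma lam_regular E : measurable E -> lam (regular @^-1` E) = lam E.
Proof.
move=> mE; have mrE : measurable (regular @^-1` E) by exact: measurable_preimage measurable_regular mE.
have H (A : set T1) : measurable A -> lam A = lam (A `&` G).
  move=> mA; apply/eqP; rewrite eq_le; apply/andP; split; last first.
    by apply: le_measure; rewrite ?inE//; exact: measurableI.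
  have U2 : (lam ((A `&` G) `|` ~` G) <= lam (A `&` G) + lam (~` G))%E.
    by apply: (measureU2 lam); [exact: measurableI|exact: measurableC].
  rewrite G1 adde0 in U2; apply: le_trans U2; apply: le_measure; rewrite ?inE//.
    by apply: measurableU; [exact: measurableI|exact: measurableC].
  by move=> x Ax; have [Gx|Gx] := pselect (G x); [left|right].
rewrite (H _ mrE) (H _ mE); congr (lam _); apply/seteqP; split=> x [] /=; rewrite /regular => + Gx;
  by rewrite mem_set.
Qed.

End regularize.

(** * The coupled digits *)

Section coupling.
Context {R : realType}.
Local Notation T1 := (measurableTypeR R).
Local Notation leb := (@lebesgue_measure R).
Local Notation lam := (@lam R).
Variables (beta c : R).
Variables (B : interval_partition R Zplus) (J : set nat) (C : interval_partition R J).
Hypothesis beta01 : 0 < beta < 1.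
Hypothesis c0 : 0 < c.

Definition block_length i : R := fine (leb (B i)).

Hypothesis asymp : block_length i / (c * i%:R `^ (- beta - 1)) @[i --> \oo] --> (1 : R).

Lemma block_length_ge0 i : 0 <= block_length i.
Proof. by rewrite /block_length fine_ge0. Qed.

Lemma lam_sojourn v : lam (sojourn B @^-1` [set v]) = (cdf_step (cumul block_length) v)%:E.
Proof.
case: v => [|v].
  rewrite /cdf_step /cumul big_geq// subr0 (_ : _ @^-1` _ = set0) ?measure0//.
  by apply/seteqP; split=> x.
have -> : cdf_step (cumul block_length) v.+1 = block_length v.+1.
  by rewrite /cdf_step cumulS addrAC subrr add0r.
have v1 : Zplus v.+1 by [].
rewrite /block_length -(lam_block B v1) -prob_fin; last exact: measurable_block_index_set1.
rewrite !lamE; congr (leb _); apply/seteqP; split=> x /= [].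
  move=> + xI; have [] := block_index_unit B xI; rewrite /Zplus /= /sojourn.
  by case: (block_index B x) => // n _ _ /= [->].
by rewrite /sojourn => ->.
Qed.

Lemma leb_block j : Zplus j -> leb (B j) = (block_length j)%:E.
Proof.
move=> j0; rewrite -(lam_block B j0) /block_length -(lam_block B j0) -prob_fin//.
exact: measurable_block_index_set1.
Qed.

Lemma cumul_block_cvg : cumul block_length i @[i --> \oo] --> (1 : R).
Proof.
have h := lam_blocks B (@measurableT _ T1); rewrite lam_setT in h.
have cv : (\sum_(0 <= j < n | j \in Zplus) leb (setT `&` B j))%E @[n --> \oo] --> 1%E.
  by rewrite h; apply: is_cvg_nneseries.
rewrite -cvg_shiftS in cv.
have cv' : fine (\sum_(0 <= j < n.+1 | j \in Zplus) leb (setT `&` B j))%E @[n --> \oo] --> (1 : R).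
  exact: fine_cvg cv.
apply: cvg_trans cv'; apply: near_eq_cvg; near=> n => /=.
rewrite big_mkcond big_nat_recl//= memNset; last by rewrite /Zplus /= ltnn.
rewrite add0e (eq_bigr (fun i => (block_length i.+1)%:E)) => [|i _]; last first.
  by rewrite mem_set// setTI leb_block.
by rewrite sumEFin /= /cumul big_add1.
Unshelve. all: by end_near. Qed.

Variables (G : set T1) (w0 : T1).
Hypothesis mG : measurable G.
Hypothesis G1 : lam (~` G) = 0%E.
Hypothesis Gw0 : G w0.
Hypothesis good : forall w, G w -> good_config beta (present w) (time w) (height w).

Local Notation sample := (regular G w0).

Lemma good_sample w : good_config beta (present (sample w)) (time (sample w)) (height (sample w)).
Proof. by apply: good; exact: regular_in. Qed.

Definition cell_point n (w : T1) k : nat :=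
  first (present w) (time w) (height w) (ncells beta n) k.

Definition cell_sojourn n (w : T1) k : nat :=
  quantile block_length (height w (cell_point n w k) / (ncells beta n)%:R).

Lemma cell_pointP n w k :
  is_first (present (sample w)) (time (sample w)) (height (sample w)) (ncells beta n) k
    (cell_point n (sample w) k).
Proof. exact: (first_exists beta01 (good_sample w)). Qed.

Lemma measurable_in_cell N k p : measurable [set w : T1 | in_cell (present w) (time w) N k p].
Proof.
rewrite (_ : [set _ | _] = [set w | present w p] `&` [set w | Num.truncn (N%:R * time w p) = k]).
  apply: measurableI; first exact: measurable_present.
  apply: measurable_truncn; last by move=> w; rewrite mulr_ge0// time_ge0.
  by apply: measurable_funM; [exact: measurable_cst|exact: measurable_time].
apply/seteqP; split=> w; rewrite /in_cell /=; first by move=> /andP[? /eqP].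
by move=> [-> ->]; rewrite eqxx.
Qed.

Lemma measurable_is_first N k p :
  measurable [set w : T1 | is_first (present w) (time w) (height w) N k p].
Proof.
pose D q : set T1 := if (p <= q)%N then [set w | height w p <= height w q]
  else [set w | height w p < height w q].
have mD q : measurable (D q).
  have mp := @measurable_height R p; have mq := @measurable_height R q.
  rewrite /D; case: ifP => _.
    exact: (measurable_preimage (measurable_fun_ler mp mq) (A := [set true])).
  exact: (measurable_preimage (measurable_fun_ltr mp mq) (A := [set true])).
rewrite (_ : [set _ | _] = [set w | in_cell (present w) (time w) N k p] `&`
   \bigcap_q (~` [set w | in_cell (present w) (time w) N k q] `|` D q)).
  apply: measurableI; first exact: measurable_in_cell.
  apply: bigcapT_measurable => q; apply: measurableU => //.
  by apply: measurableC; exact: measurable_in_cell.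
apply/seteqP; split=> [w [pk pm]|w [pk pm]]; split=> // q.
  move=> _; have [qk|qk] := pselect (in_cell (present w) (time w) N k q); last by left.
  right; rewrite /D; case: (pm q qk) => [h|[h pq]]; first by case: ifP => // _; exact: ltW.
  by rewrite pq /= h.
move=> qk; have [//|] := pm q I; rewrite /D; case: ifP => [pq /=|_]; last by left.
by rewrite le_eqVlt => /predU1P[|]; [right|left].
Qed.

Lemma cell_pointE n w k p : cell_point n (sample w) k = p <->
  is_first (present (sample w)) (time (sample w)) (height (sample w)) (ncells beta n) k p.
Proof. by split=> [<-|/firstE//]; exact: cell_pointP. Qed.

Lemma measurable_cell_point n k p : measurable [set w : T1 | cell_point n (sample w) k = p].
Proof.
have := measurable_preimage (measurable_regular w0 mG) (measurable_is_first (ncells beta n) k p).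
by congr measurable; apply/seteqP; split=> w /=; rewrite cell_pointE.
Qed.

Lemma cell_sojourn_le n w k i : (cell_sojourn n (sample w) k <= i)%N =
  (expR (- (height (sample w) (cell_point n (sample w) k) / (ncells beta n)%:R)) <= cumul block_length i).
Proof.
apply: quantileP; [exact: block_length_ge0|exact: cumul_block_cvg|].
apply: divr_gt0; last by rewrite ltr0n.
by apply: (gc_a (good_sample w)); have [/andP[]] := cell_pointP n w k.
Qed.

Lemma measurable_cell_sojourn n k i : measurable [set w : T1 | (cell_sojourn n (sample w) k <= i)%N].
Proof.
pose D p : set T1 := [set w | expR (- (height w p / (ncells beta n)%:R)) <= cumul block_length i].
have mD p : measurable (D p).
  have mf : measurable_fun setT (fun w : T1 => expR (- (height w p / (ncells beta n)%:R))).
    apply: (measurableT_comp (@measurable_expR R)); apply: measurableT_comp => //.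
    by apply: measurable_funM; [exact: measurable_height|exact: measurable_cst].
  have mc : measurable_fun setT (fun _ : T1 => cumul block_length i) by exact: measurable_cst.
  exact: (measurable_preimage (measurable_fun_ler mf mc) (A := [set true])).
rewrite (_ : [set _ | _] = \bigcup_p ([set w | cell_point n (sample w) k = p] `&` sample @^-1` D p)).
  apply: bigcup_measurable => p _; apply: measurableI; first exact: measurable_cell_point.
  exact: measurable_preimage (measurable_regular w0 mG) (mD p).
apply/seteqP; split=> [w /=|w [p _ [/= e]]]; rewrite cell_sojourn_le.
  by move=> h; exists (cell_point n (sample w) k).
by rewrite e.
Qed.

(** The event says that in the cell number [k + 1] no point is below the height
[- N ln F(i_k)], where [F] is the distribution function of the sojourn times:
it is a void event, of probability the product of the [F(i_k)]. The cell 0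
is left free, as its point provides no sojourn time. *)
Lemma lam_cell_sojourn_le n K (i : nat -> nat) :
  lam [set w | forall k, (k < K)%N -> (cell_sojourn n (sample w) k.+1 <= i k)%N] =
  (\prod_(k < K) cumul block_length (i k))%:E.
Proof.
have F0 := cumul_ge0 block_length_ge0.
have [[k0 k0K Fk0]|pos] := pselect (exists2 k, (k < K)%N & cumul block_length (i k) <= 0).
  have Fz : cumul block_length (i k0) = 0 by apply/eqP; rewrite eq_le Fk0 F0.
  rewrite (bigD1 (Ordinal k0K))//= Fz mul0r (_ : [set _ | _] = set0) ?measure0//.
  apply/seteqP; split=> // w /(_ k0 k0K); rewrite cell_sojourn_le Fz.
  by rewrite leNgt expR_gt0.
have Fpos k : (k < K)%N -> 0 < cumul block_length (i k).
  by move=> kK; rewrite ltNge; apply/negP => h; apply: pos; exists k.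
pose N := ncells beta n.
have NR0 : 0 < N%:R :> R by rewrite ltr0n.
(* the profile below which no point may lie *)
pose th k : R := if k is k'.+1 then (if (k' < K)%N then - (N%:R * ln (cumul block_length (i k'))) else 0) else 0.
have lnF k : (k < K)%N -> ln (cumul block_length (i k)) <= 0.
  by move=> kK; apply: ln_le0; exact: (cumul_le1 block_length_ge0 cumul_block_cvg).
have th0 k : 0 <= th k.
  case: k => //= k; case: ifP => // kK.
  by rewrite oppr_ge0 pmulr_rle0//; exact: lnF.
have thK k : (K.+1 <= k)%N -> th k = 0.
  by case: k => //= k; rewrite ltnS leqNgt => /negbTE ->.
have [mV lV] := @lam_void_event R N th (ltn0Sn _) K.+1 th0 thK.
rewrite (_ : [set _ | _] = sample @^-1` void_event N th); last first.
  have key w k : (k < K)%N -> (cell_sojourn n (sample w) k.+1 <= i k)%N =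
      (th k.+1 <= height (sample w) (cell_point n (sample w) k.+1)).
    move=> kK; rewrite cell_sojourn_le /th kK -{1}(lnK (Fpos k kK)) ler_expR.
    by rewrite lerNl ler_pdivlMr// mulrC -mulrN.
  apply/seteqP; split=> w wE.
    move=> p pp; case e : (Num.truncn (N%:R * time (sample w) p)) => [|k].
      by rewrite /=; apply: le_trans (height_ge _ _).
    have [kK|Kk] := ltnP k K; last first.
      by rewrite /= ltnNge Kk /=; apply: le_trans (height_ge _ _).
    have := wE k kK; rewrite key// => h; apply: (le_trans h).
    have [_ /(_ p)] := cell_pointP n w k.+1.
    rewrite /in_cell pp e eqxx => /(_ isT) [|[]]; first exact: ltW.
    by move=> ->.
  move=> k kK; rewrite key//.
  have [/andP[pp /eqP pk] _] := cell_pointP n w k.+1.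
  by have := wE _ pp; rewrite pk.
rewrite lam_regular// lV; congr EFin.
rewrite big_nat_recl//= add0r.
have -> : - ((\sum_(0 <= k < K) (if (k < K)%N then - (N%:R * ln (cumul block_length (i k))) else 0)) / N%:R) =
    \sum_(k < K) ln (cumul block_length (i k)).
  rewrite big_mkord mulr_suml -sumrN; apply: eq_bigr => k _.
  by rewrite ltn_ord mulNr opprK mulrAC divff ?mul1r// lt0r_neq0.
rewrite expR_sum; apply: eq_bigr => k _.
by rewrite lnK// posrE Fpos.
Qed.

Lemma lam_cell_sojourn n K (v : nat -> nat) :
  lam [set w | forall k, (k < K)%N -> cell_sojourn n (sample w) k.+1 = v k] =
  (\prod_(k < K) cdf_step (cumul block_length) (v k))%:E.
Proof.
apply: (@prob_eq_event _ _ _ lam (fun k w => cell_sojourn n (sample w) k.+1)).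
  by move=> k i; exact: measurable_cell_sojourn.
by move=> K' i; exact: lam_cell_sojourn_le.
Qed.

(** Iterates of the map on the second coordinate supply the label of the point
number [i], as they supply the labels of the tower. *)
Definition label (i : nat) (w : T1) : nat := block_index C (iter i (block_map C) w).

Lemma measurable_label i : measurable_fun setT (label i).
Proof.
apply: (measurableT_comp (measurable_block_index C)).
exact: measurable_iter (measurable_block_map C).
Qed.

(** Labels of distinct points are independent, whatever the order in which the
points are listed; the order depends on the Poisson process. *)
Lemma lam_labels K (iota_ : nat -> nat) (u : nat -> nat) :
  {in gtn K &, injective iota_} ->
  lam [set w | forall k, (k < K)%N -> label (iota_ k) w = u k] =
  (\prod_(k < K) fine (lam (block_index C @^-1` [set u k])))%:E.
Proof.
move=> inj.
pose s := [seq iota_ k | k <- iota 0 K].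
have us : uniq s.
  rewrite map_inj_in_uniq ?iota_uniq// => k l; rewrite !mem_iota !add0n /= => kK lK.
  exact: inj.
pose M := (\max_(i <- s) i).+1.
have sM i : i \in s -> (i < M)%N.
  by move=> si; rewrite ltnS; exact: (@leq_bigmax_seq _ s xpredT id _ si isT).
pose A i : set nat := if i \in s then [set u (index i s)] else setT.
have As k : (k < K)%N -> A (iota_ k) = [set u k].
  move=> kK; rewrite /A (_ : iota_ k \in s); last by apply/mapP; exists k; rewrite ?mem_iota.
  suff -> : index (iota_ k) s = k by [].
  have ks : (k < size s)%N by rewrite size_map size_iota.
  have e : nth 0%N s k = iota_ k by rewrite (nth_map 0%N) ?size_iota// nth_iota.
  by rewrite -e index_uniq.
have mA i : measurable (A i) by rewrite /A; case: ifP.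
rewrite (_ : [set _ | _] = path_event (block_index C) (block_map C : T1 -> T1) M A); last first.
  apply/seteqP; split=> w wE k kM.
    have [/mapP[j]|si] := boolP (k \in s); last by rewrite /A (negbTE si).
    rewrite mem_iota add0n /= => jK ->; rewrite As//; exact: wE.
  have := wE (iota_ k); rewrite As//; apply; apply: sM.
  by apply/mapP; exists k; rewrite ?mem_iota.
rewrite (prob_path_event (P := lam) (measurable_block_index C) (measurable_block_map C))//; last first.
  by move=> A' E mA'; exact: block_digit_indep.
congr EFin; pose h i := fine (lam (block_index C @^-1` A i)).
rewrite -(big_mkord xpredT h).
rewrite (bigID (fun i => i \in s))/= [X in _ * X]big1 ?mulr1; last first.
  by move=> i /negbTE si; rewrite /h /A si preimage_setT lam_setT.
rewrite -big_filter (perm_big s); last first.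
  apply: uniq_perm => //; first exact/filter_uniq/iota_uniq.
  move=> i; rewrite mem_filter; case e : (i \in s) => //=.
  by rewrite mem_index_iota /=; exact: sM.
rewrite big_map -(big_mkord xpredT (fun k => fine (lam (block_index C @^-1` [set u k])))).
rewrite /index_iota subn0 big_seq [RHS]big_seq; apply: eq_bigr => k; rewrite mem_iota add0n => /andP[_ kK].
by rewrite /h As.
Qed.

Local Notation unit_point := (regular (`[0, 1[%classic : set T1) (0 : T1)).

Lemma measurable_unit_itv : measurable (`[0, 1[%classic : set T1).
Proof. exact: measurable_itv. Qed.

Lemma lam_unit_compl : lam (~` `[0, 1[%classic) = 0%E.
Proof. by rewrite lamE setICl measure0. Qed.

Definition coupled_digits n (w : T1 * T1) (k : nat) : nat * nat :=
  (if k == 0%N then 1%N else cell_sojourn n (sample w.1) k,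
   label (cell_point n (sample w.1) k) (unit_point w.2)).

Lemma measurable_label_unit i u : measurable [set w : T1 | label i (unit_point w) = u].
Proof.
have m1 := measurable_preimage (measurable_label i) (A := [set u]) I.
exact: measurable_preimage (measurable_regular 0 measurable_unit_itv) m1.
Qed.

Lemma measurable_coupled_digits n k v : measurable [set w | coupled_digits n w k = v].
Proof.
have m1 : measurable [set w : T1 | (if k == 0%N then 1%N else cell_sojourn n (sample w) k) = v.1].
  case: (k == 0%N).
    have [e|e] := pselect (1%N = v.1).
      by rewrite (_ : [set _ | _] = setT)//; apply/seteqP; split.
    by rewrite (_ : [set _ | _] = set0)//; apply/seteqP; split.
  apply: (@measurable_eq_event _ _ (fun k w => cell_sojourn n (sample w) k)) => k' i.
  exact: measurable_cell_sojourn.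
rewrite (_ : [set _ | _] = fst @^-1` [set w : T1 | (if k == 0%N then 1%N else cell_sojourn n (sample w) k) = v.1] `&`
  \bigcup_p (fst @^-1` [set w : T1 | cell_point n (sample w) k = p] `&`
             snd @^-1` [set w : T1 | label p (unit_point w) = v.2])).
  apply: measurableI; first exact: measurable_preimage measurable_fst m1.
  apply: bigcup_measurable => p _; apply: measurableI.
    exact: measurable_preimage measurable_fst (measurable_cell_point n k p).
  exact: measurable_preimage measurable_snd (measurable_label_unit p v.2).
apply/seteqP; split=> [w /= <-|w [/= h1 [p _ [/= h2 h3]]]].
  by split => //; exists (cell_point n (sample w.1) k).
by rewrite /coupled_digits h1 h2 h3; case: v {m1 h1 h3}.
Qed.

Lemma cell_point_inj n w : injective (cell_point n (sample w)).
Proof.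
move=> k k' e; have [/andP[_ /eqP <-] _] := cell_pointP n w k.
by have [/andP[_ /eqP <-] _] := cell_pointP n w k'; rewrite e.
Qed.

(** Given [w.1], the cells select distinct points, and by [lam_labels] the
probability of the labels does not depend on which ones; the integral over
[w.1] then factors. *)
Lemma coupled_cylinder n K v : (0 < K)%N ->
  (lam \x lam)%E [set w | forall k, (k < K)%N -> coupled_digits n w k = v k] =
  (digit_prob B C K v)%:E.
Proof.
case: K => // K _.
have [v1|v1] := eqVneq (v 0%N).1 1%N; last first.
  rewrite (_ : [set _ | _] = set0); last first.
    apply/seteqP; split=> // w /= /(_ 0%N isT) /(congr1 fst) /= e.
    by move: v1; rewrite -e.
  rewrite measure0 /digit_prob; case: (v 0%N) v1 => a b /=.
  by case: a => [|[|a]].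
pose z := \prod_(k < K.+1) fine (lam (block_index C @^-1` [set (v k).2])).
have z0 : 0 <= z by apply: prodr_ge0 => k _; rewrite fine_ge0.
pose D := [set w : T1 | forall k, (k < K)%N -> cell_sojourn n (sample w) k.+1 = (v k.+1).1].
have mD : measurable D.
  apply: (@measurable_forall_lt _ _ _ (fun k w => cell_sojourn n (sample w) k.+1 = (v k.+1).1)) => k.
  apply: (@measurable_eq_event _ _ (fun k w => cell_sojourn n (sample w) k)) => k' i.
  exact: measurable_cell_sojourn.
rewrite /product_measure1 /=.
transitivity (\int[lam]_x (z%:E * (\1_D x)%:E))%E.
  apply: eq_integral => x _ /=; rewrite indicE.
  have [xD|xD] := pselect (D x); last first.
    rewrite memNset// mule0 (_ : xsection _ _ = set0) ?measure0//.
    apply/seteqP; split=> // y; rewrite /xsection /= inE /= => h; apply: xD => k kK.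
    by have /(congr1 fst) := h k.+1 kK.
  rewrite mem_set// mule1.
  have mL : measurable [set w : T1 | forall k, (k < K.+1)%N -> label (cell_point n (sample x) k) w = (v k).2].
    apply: (@measurable_forall_lt _ _ _ (fun k w => label (cell_point n (sample x) k) w = (v k).2)) => k.
    exact: (measurable_preimage (measurable_label _) (A := [set (v k).2]) I).
  rewrite -(@lam_labels K.+1 (cell_point n (sample x)) (fun k => (v k).2)); last first.
    by move=> k k' _ _; exact: cell_point_inj.
  rewrite -[RHS](lam_regular 0 measurable_unit_itv lam_unit_compl mL).
  congr (lam _); apply/seteqP; split=> y; rewrite /xsection /= inE /= => h k kK.
    by have /(congr1 snd) := h k kK.
  rewrite /coupled_digits /= h//; case: k kK => [|k] kK /=.
    by case: (v 0%N) v1 => a b /= ->.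
  by rewrite xD//; case: (v k.+1).
rewrite ge0_integralZl_EFin//; last by apply/measurable_EFinP.
rewrite integral_indic// setIT.
transitivity (z%:E * lam D)%E => //.
rewrite (lam_cell_sojourn n K (fun k => (v k.+1).1)) -EFinM; congr EFin.
rewrite /digit_prob; case: (v 0%N) v1 => a b /= ->; rewrite mulrC; congr (_ * _).
rewrite big_ord_recl /= lam_setT mul1r; apply: eq_bigr => k _.
by rewrite /bump /= add1n lam_sojourn.
Qed.

End coupling.

(** * The space of paths *)

Local Open Scope complex_scope.

Section complex_norm.
Context {R : realType}.
Implicit Types z : R[i].

Lemma norm_le_ReIm z : `|z| <= (`|complex.Re z| + `|complex.Im z|)%:C.
Proof.
rewrite normc_def lecE/= eqxx/=.
rewrite -[leRHS]ger0_norm ?addr_ge0// -sqrtr_sqr ler_wsqrtr//.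
rewrite sqrrD !real_normK ?num_real// lerD2r lerDl.
by rewrite mulrn_wge0// mulr_ge0.
Qed.

Lemma complex_gt0 (e : R[i]) : 0 < e -> exists2 e' : R, 0 < e' & e = e'%:C.
Proof.
case: e => a b; rewrite ltcE /= => /andP[/eqP -> a0].
by exists a.
Qed.

Lemma ltc_real (x y : R) : (x%:C < y%:C :> R[i]) = (x < y).
Proof. by rewrite ltcE /= eqxx. Qed.

Lemma lec_real (x y : R) : (x%:C <= y%:C :> R[i]) = (x <= y).
Proof. by rewrite lecE /= eqxx. Qed.

End complex_norm.

Section path_space.
Context {R : realType}.
Local Notation C := (R[i]^o).
Local Notation path_space := {family @segments0 R, R -> C}.

(** Uniform closeness on a segment; these relations generate the topology of the
path space. *)
Definition close_on (T e : R) (f g : R -> C) :=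
  forall t, 0 <= t <= T -> `|f t - g t| <= e%:C :> R[i].

Lemma close_sym T e f g : close_on T e f g -> close_on T e g f.
Proof. by move=> h t /h; rewrite distrC. Qed.

Lemma close_trans T e e' f g h : close_on T e f g -> close_on T e' g h -> close_on T (e + e') f h.
Proof.
move=> fg gh t tT; apply: le_trans (ler_distD (g t) _ _) _.
by rewrite rmorphD; apply: lerD; [exact: fg|exact: gh].
Qed.

Lemma path_cvg (F : nat -> path_space) (g : path_space) :
  (forall T e : R, 0 < e -> \forall n \near \oo, close_on T e (F n) g) ->
  F @ \oo --> g.
Proof.
move=> H; apply/fam_cvgP => A [T /= T0 <-] P /uniform_nbhs[E [entE EP]].
move: entE; rewrite -entourage_ballE => -[e /= e0 eE].
have [e' e'0 ee'] := complex_gt0 e0.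
have e2 : 0 < e' / 2 by rewrite divr_gt0.
suff : \forall n \near \oo, P (F n) by [].
apply: filterS (H T _ e2) => n Fn; apply: EP => t /=; rewrite in_itv/= => tT.
apply: eE => /=; rewrite -ball_normE /=.
have := Fn t tT; rewrite distrC => h; apply: le_lt_trans h _.
by rewrite ee' ltc_real ltr_pdivrMr// ltr_pMr// ltr1n.
Qed.

Lemma path_nbhs (g : path_space) (T e : R) : 0 <= T -> 0 < e ->
  nbhs g [set f | close_on T e g f].
Proof.
move=> T0 e0.
have entE : entourage [set xy : C * C | ball xy.1 e%:C xy.2].
  by rewrite -entourage_ballE; exists e%:C => //=; rewrite ltc_real.
have segT : segments0 `[0, T]%classic by exists T.
apply: filterS (fam_nbhs g entE segT) => f /= h t tT.
by have := h t; rewrite in_itv/= => /(_ tT); rewrite -ball_normE /= => /ltW.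
Qed.

Definition radius (j : nat) : R := j.+1%:R^-1.

Lemma radius_gt0 j : 0 < radius j. Proof. by rewrite invr_gt0. Qed.

(** Every point has the countable base of neighbourhoods given by the segments
[[0, j]] with radius [1/(j + 1)]. *)
Lemma open_close (U : set path_space) (g : path_space) : open U -> U g ->
  exists j : nat, [set f | close_on j%:R (radius j) g f] `<=` U.
Proof.
move=> oU Ug; apply: contrapT => H.
have [F HF] : exists F : nat -> path_space, forall j, close_on j%:R (radius j) g (F j) /\ ~ U (F j).
  have H' j : exists f : path_space, close_on j%:R (radius j) g f /\ ~ U f.
    apply: contrapT => h; apply: H; exists j => f fj.
    by apply: contrapT => Uf; apply: h; exists f.
  by exists (fun j => projT1 (cid (H' j))) => j; exact: projT2 (cid (H' j)).
have cF : F @ \oo --> g.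
  apply: path_cvg => T e e0; near=> j => t /andP[t0 tT].
  rewrite distrC; apply: le_trans ((HF j).1 t _) _.
    rewrite t0 (le_trans tT)//; near: j.
    exact: nbhs_infty_ger.
  rewrite lec_real /radius; near: j.
  have := @cvg_harmonic R; move/cvgrPdist_le => /(_ e e0).
  by apply: filterS => j /=; rewrite sub0r normrN ger0_norm// invr_ge0.
have : \forall n \near \oo, U (F n) by apply: cF; exact: open_nbhs_nbhs.
by move=> [n _ /(_ n (leqnn n))]; have [_] := HF n.
Unshelve. all: by end_near. Qed.

(** The path space is neither second countable nor Hausdorff, so that
the usual argument through a metric is replaced by this one: [Z w] is in [U] if and only if,
for some [k], the approximations [Z_ n w] are eventually in the interior of the set of paths
whose [k]-th neighbourhood is contained in [U]. *)
Lemma borel_rv_limit d (W : measurableType d) (Z_ : nat -> W -> path_space)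
    (Z : W -> path_space) :
  (forall n, borel_rv (Z_ n)) -> (forall w, (Z_ n w) @[n --> \oo] --> Z w) ->
  borel_rv Z.
Proof.
move=> bZ cZ U oU.
pose V k := [set g : path_space | [set f | close_on k%:R (radius k) g f] `<=` U]^°.
have oV k : open (V k) by exact: open_interior.
have -> : Z @^-1` U = \bigcup_k \bigcup_n0 \bigcap_(n in [set n | (n0 <= n)%N]) (Z_ n @^-1` V k).
  apply/seteqP; split=> [w Uw|w [k _ [n0 _ wV]]].
    have [j Hj] := open_close oU Uw.
    (* [radius k] is half of [radius j] *)
    pose k := (2 * j).+1; exists k => //.
    have Vk : V k (Z w).
      apply: filterS (path_nbhs (Z w) (ler0n R k) (radius_gt0 k)) => g Zg f gf.
      apply: Hj => t /andP[t0 tj].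
      have tk : 0 <= t <= k%:R by rewrite t0 (le_trans tj)// ler_nat /k; lia.
      apply: le_trans (close_trans Zg gf tk) _.
      have -> : radius k = radius j / 2.
        have e : k.+1%:R = 2 * j.+1%:R :> R by rewrite -natrM; congr _%:R; rewrite /k; lia.
        by rewrite /radius e invfM mulrC.
      by rewrite lec_real; lra.
    have [n0 _ Hn0] : \forall n \near \oo, V k (Z_ n w).
      by apply: cZ; exact: open_nbhs_nbhs.
    by exists n0.
  have h : \forall n \near \oo, close_on k%:R (radius k) (Z w) (Z_ n w).
    by apply: (cZ w); exact: path_nbhs (ler0n R k) (radius_gt0 k).
  have [n1 _ Hn1] := h.
  have Vn := wV (maxn n0 n1) (leq_maxl _ _).
  apply: (interior_subset Vn); apply: close_sym.
  by apply: Hn1; exact: leq_maxr.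
apply: bigcup_measurable => k _; apply: bigcup_measurable => n0 _.
apply: bigcap_measurable => [|n _]; last exact: bZ.
by exists n0 => /=.
Qed.

(** Measurability is automatic, in any space, for variables with countably many values. *)
Lemma borel_rv_countable d (W : measurableType d) (X : topologicalType) (Cn : countType)
    (f : W -> Cn) (h : Cn -> X) : (forall j, measurable (f @^-1` [set j])) ->
  borel_rv (h \o f).
Proof.
move=> mf U oU.
have -> : (h \o f) @^-1` U = \bigcup_n [set w | exists2 j, unpickle n = Some j & f w = j /\ U (h j)].
  apply/seteqP; split=> [w /= Uw|w [n _ [j _ [/= <-]]]//].
  by exists (pickle (f w)) => //=; exists (f w) => //; rewrite pickleK.
apply: bigcup_measurable => n _; case e : (unpickle n) => [j|]; last first.
  by rewrite (_ : [set _ | _] = set0)//; apply/seteqP; split=> // w [].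
have [Uj|Uj] := pselect (U (h j)).
  rewrite (_ : [set _ | _] = f @^-1` [set j])//.
  by apply/seteqP; split=> [w [i [<-] [/= -> _]]|w /= ->]//; exists j.
by rewrite (_ : [set _ | _] = set0)//; apply/seteqP; split=> // w [i [<-] [_]].
Qed.

Lemma borel_rv_measurable d (W : measurableType d) (X : topologicalType) (Z : W -> X)
    (F : X -> R) : borel_rv Z -> continuous F -> measurable_fun setT (F \o Z).
Proof.
move=> bZ cF; apply: (measurability _ (RGenOpens.measurableE R)) => //.
move=> _ [_ [a [b ->] <-]]; rewrite setTI.
apply: (bZ (F @^-1` `]a, b[%classic)).
by move/continuousP: cF; apply; exact: interval_open.
Qed.

End path_space.

(** * Paths driven by digits *)

Section expectations.
Context {R : realType}.

Lemma bounded_integrable d (W : measurableType d) (P : probability W R) (f : W -> R) (M : R) :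
  measurable_fun setT f -> (forall w, `|f w| <= M) -> P.-integrable setT (EFin \o f).
Proof.
move=> mf fM; apply: (@le_integrable _ _ _ P setT measurableT _ (cst M%:E)) => //.
- exact/measurable_EFinP.
- by move=> w _ /=; rewrite lee_fin (le_trans (fM w))// ler_norm.
- by apply: finite_measure_integrable_cst; exact: measurableT.
Qed.

Lemma expectation_cvg d (W : measurableType d) (P : probability W R)
    (f_ : nat -> W -> R) (f : W -> R) (M : R) :
  (forall n, measurable_fun setT (f_ n)) -> (forall n w, `|f_ n w| <= M) ->
  (forall w, f_ n w @[n --> \oo] --> f w) ->
  (\int[P]_w (f_ n w)%:E)%E @[n --> \oo] --> (\int[P]_w (f w)%:E)%E.
Proof.
move=> mf fM ff.
have mff : measurable_fun setT f.
  by apply: (@measurable_fun_cvg _ _ _ _ f_) => // w _; exact: ff.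
have [] := @dominated_convergence _ W R P setT measurableT
  (fun n => EFin \o f_ n) (EFin \o f) (cst M%:E).
- by move=> n; exact/measurable_EFinP.
- exact/measurable_EFinP.
- by apply: aeW => w _; apply: cvg_EFin; [near=> n|exact: ff].
- exact: finite_measure_integrable_cst.
- by apply: aeW => w n _ /=; rewrite lee_fin.
by move=> _ _.
Unshelve. all: by end_near. Qed.

Lemma integral_countable d (W : measurableType d) (P : probability W R) (C : countType)
    (X : W -> C) (g : C -> R) (M : R) :
  (forall c, measurable (X @^-1` [set c])) -> (forall c, `|g c| <= M) ->
  (\int[P]_w (g (X w))%:E =
   \sum_(n <oo) (if pickle_inv n is Some c then (g c)%:E * P (X @^-1` [set c]) else 0))%E.
Proof.
move=> mX gM; pose F n : set W := [set w | pickle (X w) = n].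
have FE n : F n = if pickle_inv n is Some c then X @^-1` [set c] else set0.
  apply/seteqP; split=> [w <-|w]; first by rewrite pickleK_inv.
  have := pickle_invK (T := C) n; rewrite /oapp.
  by case: (pickle_inv n) => // c <- /= wc; rewrite /F /= wc.
have mF n : measurable (F n) by rewrite FE; case: (pickle_inv n).
have UF : \bigcup_n F n = setT by apply/seteqP; split=> // w _; exists (pickle (X w)).
have tF : trivIset setT F by move=> i j _ _ [w [<- <-]].
have mg : measurable_fun setT (g \o X).
  by apply: (@measurable_fun_countable _ _ _ _ C X (fun c _ => g c)) => // c; exact: measurable_cst.
have ig : P.-integrable (\bigcup_n F n) (EFin \o (g \o X)).
  by rewrite UF; apply: (bounded_integrable P mg) => w; exact: gM.
rewrite -UF [LHS](integral_bigcup tF mF ig); apply: eq_eseriesr => n _.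
rewrite (FE n); case: (pickle_inv n) => [c|]; last by rewrite integral_set0.
rewrite -integral_cst//; by apply: eq_integral => w /set_mem /= ->.
Qed.

(** A digit path depends on finitely many digits up to a small error, which
reduces expectations of continuous functionals of paths to this case. *)
Lemma eq_law_countable (C : countType) d (W : measurableType d) (P : probability W R) (X : W -> C)
    d' (W' : measurableType d') (P' : probability W' R) (X' : W' -> C) (g : C -> R) (M : R) :
  (forall c, measurable (X @^-1` [set c])) -> (forall c, measurable (X' @^-1` [set c])) ->
  (forall c, P (X @^-1` [set c]) = P' (X' @^-1` [set c])) -> (forall c, `|g c| <= M) ->
  (\int[P]_w (g (X w))%:E = \int[P']_w (g (X' w))%:E)%E.
Proof.
move=> mX mX' XX gM; rewrite (integral_countable P mX gM) (integral_countable P' mX' gM).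
by apply: eq_eseriesr => n _; case: (pickle_inv n) => // c; rewrite XX.
Qed.

End expectations.

Section digit_paths.
Context {R : realType}.
Local Notation C := (R[i]^o).
Local Notation path_space := {family @segments0 R, R -> C}.
Variable gamma : nat -> R[i].

Definition complex_walk (d : nat -> nat * nat) (m : nat) : R[i] :=
  digit_walk (fun j => complex.Re (gamma j)) d m +i* digit_walk (fun j => complex.Im (gamma j)) d m.

(** The process [L_n] of the theorem, as a function of the digits. *)
Definition digit_path (n : nat) (d : nat -> nat * nat) : path_space :=
  fun t => complex_walk d (Num.truncn (n%:R * t)) / n%:R.

Lemma eq_complex_walk d d' m : (forall k, (k < m)%N -> d k = d' k) ->
  complex_walk d m = complex_walk d' m.
Proof.
move=> dd; rewrite /complex_walk /digit_walk.
by congr (_ +i* _); apply: eq_layout => k; rewrite mem_iota add0n => /andP[_ km]; rewrite dd.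
Qed.

(** Replacing the digits of rank at least [K] by a default one leaves countably
many possible values. *)
Definition cut (K : nat) (d : nat -> nat * nat) (k : nat) : nat * nat :=
  nth (1, 0)%N (mkseq d K) k.

Lemma digit_path_cut n d : (digit_path n (cut K d)) @[K --> \oo] --> digit_path n d.
Proof.
apply: path_cvg => T e e0; near=> K => t /andP[t0 tT].
rewrite /digit_path (@eq_complex_walk (cut K d) d) ?subrr ?normr0 ?lec_real ?ltW//.
move=> k kt; rewrite /cut nth_mkseq//; apply: (leq_trans kt).
apply: (@leq_trans (Num.truncn (n%:R * T))).
  by apply: le_truncn; rewrite ler_wpM2l.
by near: K; exact: nbhs_infty_ge.
Unshelve. all: by end_near. Qed.

Lemma prefixE (V : Type) (E : V -> nat -> nat * nat) K s :
  [set w | mkseq (E w) K = s] =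
  if size s == K then [set w | forall k, (k < K)%N -> E w k = nth (1, 0)%N s k] else set0.
Proof.
case: eqP => sK; apply/seteqP; split=> w //=.
- by move=> <- k kK; rewrite nth_mkseq.
- move=> wE; apply: (@eq_from_nth _ (1, 0)%N); rewrite size_mkseq// => k kK.
  by rewrite nth_mkseq// wE.
- by move=> e; apply: sK; rewrite -e size_mkseq.
Qed.

Section law.
Context dW (W : measurableType dW) (D : W -> nat -> nat * nat).
Hypothesis mD : forall k v, measurable [set w | D w k = v].

Lemma measurable_prefix K s : measurable [set w | mkseq (D w) K = s].
Proof.
rewrite (_ : [set _ | _] = if size s == K then
  [set w | forall k, (k < K)%N -> D w k = nth (1, 0)%N s k] else set0); last exact: prefixE.
by case: ifP => // _; apply: measurable_forall_lt.
Qed.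

Lemma borel_digit_path n : borel_rv (fun w => digit_path n (D w)).
Proof.
apply: (@borel_rv_limit _ _ _ (fun K w => digit_path n (cut K (D w)))); last first.
  by move=> w; exact: digit_path_cut.
move=> K; apply: (@borel_rv_countable _ _ _ _ (fun w => mkseq (D w) K)
  (fun s => digit_path n (nth (1, 0)%N s))).
by move=> s; exact: measurable_prefix.
Qed.

End law.

(** Equality holds for the cut digits, which take countably many values whose probabilities
are those of cylinders, and passes to the limit by dominated convergence. *)
Lemma eq_law_digit_path d (W : measurableType d) (P : probability W R) (D : W -> nat -> nat * nat)
    d' (W' : measurableType d') (P' : probability W' R) (D' : W' -> nat -> nat * nat) :
  (forall k v, measurable [set w | D w k = v]) ->
  (forall k v, measurable [set w | D' w k = v]) ->
  (forall K v, (0 < K)%N -> P [set w | forall k, (k < K)%N -> D w k = v k] =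
               P' [set w | forall k, (k < K)%N -> D' w k = v k]) ->
  forall n (F : path_space -> R), continuous F -> (exists M : R, forall x, `|F x| <= M) ->
  (\int[P]_w (F (digit_path n (D w)))%:E = \int[P']_w (F (digit_path n (D' w)))%:E)%E.
Proof.
move=> mD mD' DD n F cF [M FM].
have step K : (\int[P]_w (F (digit_path n (cut K.+1 (D w))))%:E =
    \int[P']_w (F (digit_path n (cut K.+1 (D' w))))%:E)%E.
  pose g (s : seq (nat * nat)) := F (digit_path n (nth (1, 0)%N s)).
  apply: (@eq_law_countable _ _ _ _ P (fun w => mkseq (D w) K.+1) _ _ P'
    (fun w => mkseq (D' w) K.+1) g M) => [s|s|s|s]; last exact: FM.
  - exact: measurable_prefix.
  - exact: measurable_prefix.
  by rewrite [X in P X]prefixE [X in P' X]prefixE; case: ifP => _; [exact: DD|rewrite !measure0].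
have lim e (V : measurableType e) (Q : probability V R) (E : V -> nat -> nat * nat) :
    (forall k v, measurable [set w | E w k = v]) ->
    (\int[Q]_w (F (digit_path n (cut K.+1 (E w))))%:E)%E @[K --> \oo] -->
    (\int[Q]_w (F (digit_path n (E w)))%:E)%E.
  move=> mE; apply: (@expectation_cvg _ _ _ Q (fun K w => F (digit_path n (cut K.+1 (E w)))) _ M) => //.
  - move=> K; apply: (@borel_rv_measurable _ _ _ _ (fun w => digit_path n (cut K.+1 (E w)))) => //.
    apply: (@borel_rv_countable _ _ _ _ (fun w => mkseq (E w) K.+1)
      (fun s => digit_path n (nth (1, 0)%N s))).
    by move=> s; exact: measurable_prefix.
  - move=> w; apply: (@cvg_comp _ _ _ (fun K => digit_path n (cut K.+1 (E w))) F); last exact: cF.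
    apply: (@cvg_comp _ _ _ S (fun K => digit_path n (cut K (E w)))); last exact: digit_path_cut.
    by move=> A [N _ NA]; exists N => // m /= Nm; apply: NA; exact: leqW.
have L1 := lim _ _ P D mD; have L2 := lim _ _ P' D' mD'.
rewrite (_ : (fun K => _) = (fun K => (\int[P']_w (F (digit_path n (cut K.+1 (D' w))))%:E)%E)) in L1; last first.
  by apply/funext => K; exact: step.
exact: (cvg_unique _ L1 L2).
Qed.

End digit_paths.

(** * The limit path *)

Section complex_parts.
Context {R : realType}.
Implicit Types z : R[i].

Lemma ReIm_divn z n :
  z / n%:R = (complex.Re z / n%:R) +i* (complex.Im z / n%:R).
Proof.
rewrite -(rmorph_nat (@real_complex R)) -(fmorphV (@real_complex R)).
by case: z => a b; rewrite /real_complex_def; simpc.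
Qed.

Lemma normr_ReIm_le z : `|z| = 1 -> `|complex.Re z| <= 1 /\ `|complex.Im z| <= 1.
Proof.
rewrite normc_def => /eqP; rewrite eq_complex /= eqxx andbT => /eqP z1.
by split; rewrite -sqrtr_sqr -[leRHS]z1 ler_wsqrtr// ?lerDl ?lerDr sqr_ge0.
Qed.

Lemma ReB z z' : complex.Re (z - z') = complex.Re z - complex.Re z'.
Proof. by case: z; case: z'. Qed.

Lemma ImB z z' : complex.Im (z - z') = complex.Im z - complex.Im z'.
Proof. by case: z; case: z'. Qed.

End complex_parts.

Section uniform_limit.
Context {R : realType}.

Lemma uniform_limit (F : nat -> R -> R) :
  (forall T e : R, 0 < e -> exists n0, forall n n', (n0 <= n)%N -> (n0 <= n')%N ->
    forall t, 0 <= t <= T -> `|F n t - F n' t| <= e) ->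
  forall T e : R, 0 < e ->
    \forall n \near \oo, forall t, 0 <= t <= T -> `|F n t - limn (F^~ t)| <= e.
Proof.
move=> cF T e e0; have [n0 Hn0] := cF T e e0.
exists n0 => // n /= n0n t tT.
have cv : F^~ t @ \oo --> limn (F^~ t).
  apply: R_complete; apply: cauchy_exP => d d0.
  have d2 : 0 < d / 2 by rewrite divr_gt0.
  have [m0 Hm0] := cF T (d / 2) d2; exists (F m0 t).
  exists m0 => // m /= m0m; rewrite -ball_normE /=.
  by apply: le_lt_trans (Hm0 _ _ (leqnn _) m0m _ tT) _; lra.
apply/ler_addgt0Pl => d d0.
have [m _ Hm] : \forall m \near \oo, `|limn (F^~ t) - F m t| <= d.
  by move/cvgrPdist_le : cv; exact.
have := Hm (maxn m n0) (leq_maxl _ _); rewrite distrC => h.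
have := Hn0 n (maxn m n0) n0n (leq_maxr _ _) t tT => h'.
rewrite -(subrKA (F (maxn m n0) t)) addrC; apply: le_trans (ler_normD _ _) _.
exact: lerD.
Qed.

End uniform_limit.

Section coupling.
Context {R : realType}.
Local Notation T1 := (measurableTypeR R).
Local Notation lam := (@lam R).
Local Notation path_space := {family @segments0 R, R -> R[i]^o}.
Variables (beta c : R).
Variables (B : interval_partition R Zplus) (J : set nat) (C : interval_partition R J).
Variable gamma : nat -> R[i].
Hypothesis beta01 : 0 < beta < 1.
Hypothesis c0 : 0 < c.
Hypothesis asymp : block_length B i / (c * i%:R `^ (- beta - 1)) @[i --> \oo] --> (1 : R).
Hypothesis gamma1 : forall j, J j -> `|gamma j| = 1.
Variables (G : set T1) (w0 : T1).
Hypothesis mG : measurable G.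
Hypothesis G1 : lam (~` G) = 0%E.
Hypothesis Gw0 : G w0.
Hypothesis good : forall w, G w -> good_config beta (present w) (time w) (height w).

Local Notation sample := (regular G w0).
Local Notation unit_point := (regular (`[0, 1[%classic : set T1) (0 : T1)).
Local Notation digits := (coupled_digits beta B C G w0).
Local Notation W := (T1 * T1)%type.

Definition label_value (h : R[i] -> R) (w : W) (p : nat) : R :=
  h (gamma (label C p (unit_point w.2))).

Definition coupled_walk (h : R[i] -> R) (n : nat) (w : W) (t : R) : R :=
  config_walk beta (block_length B) (present (sample w.1)) (time (sample w.1))
    (height (sample w.1)) n (label_value h w) t.

(** Dividing space and time by [n] turns a walk driven by digits into the walk of
the configuration. *)
Lemma digit_walk_coupled (h : R[i] -> R) n w t : (0 < n)%N ->
  digit_walk (h \o gamma) (digits n w) (Num.truncn (n%:R * t)) / n%:R =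
  coupled_walk h n w t.
Proof.
move=> n0; have nV : 0 < n%:R^-1 :> R by rewrite invr_gt0 ltr0n.
rewrite /coupled_walk /config_walk /walk [X in layout _ _ _ X]mulrC /digit_walk.
rewrite [LHS]mulrC -layout_scale//; apply: eq_layout => k _ //=.
rewrite /cell_weight /cell_sojourn; case: eqP => _; first by rewrite mulr1.
by rewrite mulrC.
Qed.

Lemma digits_gt0 n w k : (0 < n)%N -> (0 < (digits n w k).1)%N.
Proof.
move=> n0; rewrite /=; case: eqP => // /eqP k0.
have := cell_weight_gt0 beta01 (block_length_ge0 B) (cumul_block_cvg B)
  (good_sample Gw0 good w.1) k n0.
rewrite /cell_weight (negbTE k0) => h; rewrite lt0n; apply/eqP => e.
by move: h; rewrite /cell_sojourn/cell_point in e; rewrite e mul0r ltxx.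
Qed.

Lemma label_in p (w : T1) : J (label C p (unit_point w)).
Proof.
suff : (`[0, 1[%classic : set R) (iter p (block_map C) (unit_point w)).
  by move=> /(block_index_unit C)[].
elim: p => [|p IH]; last exact: block_map_unit.
by apply: regular_in; rewrite /= in_itv/= lexx ltr01.
Qed.

Lemma label_value_Re w p : `|label_value (@complex.Re R) w p| <= 1.
Proof. by have [] := normr_ReIm_le (gamma1 (label_in p w.2)). Qed.

Lemma label_value_Im w p : `|label_value (@complex.Im R) w p| <= 1.
Proof. by have [] := normr_ReIm_le (gamma1 (label_in p w.2)). Qed.

Definition limit_walk (h : R[i] -> R) (w : W) (t : R) : R :=
  limn (fun n => coupled_walk h n w t).

(** Real and imaginary parts are treated separately, as walks with real labels
in [[-1, 1]]. *)
Definition limit_path (w : W) : path_space :=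
  fun t => limit_walk (@complex.Re R) w t +i* limit_walk (@complex.Im R) w t.

Section component.
Variable h : R[i] -> R.
Hypothesis h1 : forall w p, `|label_value h w p| <= 1.

Lemma limit_walk_close w (T e : R) : 0 < e ->
  \forall n \near \oo, forall t, 0 <= t <= T ->
    `|coupled_walk h n w t - limit_walk h w t| <= e.
Proof.
move=> e0; apply: uniform_limit e0 => {}T {}e e0.
have [n0 Hn0] := config_walk_cauchy beta01 c0 (block_length_ge0 B) asymp
  (cumul_block_cvg B) (good_sample Gw0 good w.1) T e0.
by exists n0 => n n' nn nn' t tT; apply: Hn0.
Qed.

(** Sojourn times are at least 1, so that the walks at both times can be written
with the same number of intervals. *)
Lemma digit_walk_lip g (d : nat -> nat * nat) m m' : (forall k, (0 < (d k).1)%N) ->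
  (forall k, `|g (d k).2| <= 1 :> R) ->
  `|digit_walk g d m - digit_walk g d m'| <= `|m%:R - m'%:R|.
Proof.
move=> d0 g1; pose K := maxn m m'.
rewrite -(@digit_walk_ge _ g d m K) ?leq_maxl// -(@digit_walk_ge _ g d m' K) ?leq_maxr//.
apply: le_trans (layout_lip _ _ _ _ _ _) _ => //.
by rewrite big1 ?mulr0 ?addr0// => k _; rewrite subrr normr0.
Qed.

Lemma limit_walk_lip w t t' : 0 <= t -> 0 <= t' ->
  `|limit_walk h w t - limit_walk h w t'| <= `|t - t'|.
Proof.
wlog tt' : t t' / t <= t' => [H t0 t'0|t0 t'0].
  by have [tt'|/ltW tt'] := leP t t'; [exact: H|rewrite distrC [leRHS]distrC; exact: H].
apply/ler_addgt0Pl => e e0; have e3 : 0 < e / 3 by rewrite divr_gt0.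
(* a level at which rounding the times and replacing the limit cost at most [e] *)
have [n [n0 cn ne]] : exists n, [/\ (0 < n)%N,
    forall s, 0 <= s <= t' -> `|coupled_walk h n w s - limit_walk h w s| <= e / 3 &
    n%:R^-1 <= e / 3].
  have near1 : \forall n \near \oo, n.+1%:R^-1 <= e / 3 :> R.
    have := @cvg_harmonic R; move/cvgrPdist_le => /(_ _ e3).
    by apply: filterS => j /=; rewrite sub0r normrN ger0_norm// invr_ge0.
  have [n1 _ H1] := near1; have [n2 _ H2] := limit_walk_close w t' e3.
  exists (maxn n1 n2).+1; split=> //; last by apply: H1; exact: leq_maxl.
  by apply: H2; rewrite /= leqW// leq_maxr.
have nR : 0 < n%:R :> R by rewrite ltr0n.
have step : `|coupled_walk h n w t - coupled_walk h n w t'| <= t' - t + n%:R^-1.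
  rewrite -!digit_walk_coupled// -mulrBl normrM normfV (ger0_norm (ltW nR)) ler_pdivrMr//.
  apply: le_trans (@digit_walk_lip _ (digits n w) _ _ _ _) _.
  - by move=> k; exact: digits_gt0.
  - by move=> k; exact: h1.
  rewrite distrC ger0_norm; last first.
    by rewrite subr_ge0 ler_nat le_truncn// ler_wpM2l.
  rewrite mulrDl mulVf ?gt_eqF// mulrBl.
  have := truncn_le (n%:R * t'); rewrite mulr_ge0// => h1'.
  have := truncnS_gt (n%:R * t); rewrite -natr1 => h2.
  move: h1' h2; lra.
rewrite [leRHS]addrC; have := cn t; rewrite t0 tt' => /(_ isT) c1.
have := cn t'; rewrite t'0 lexx => /(_ isT) c2.
rewrite (distrC t) (ger0_norm (_ : 0 <= t' - t)) ?subr_ge0//.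
move: c1 c2 step; rewrite !ler_norml => /andP[a1 a2] /andP[b1 b2] /andP[d1 d2].
by apply/andP; split; lra.
Qed.

Lemma limit_walk_const w1 (t e : R) : 0 <= t -> 0 < e -> exists K, forall w2 j,
  J j -> (forall p, (p < K)%N -> label C p (unit_point w2) = j) ->
  `|limit_walk h (w1, w2) t - h (gamma j) * t| <= e.
Proof.
move=> t0 e0; have e2 : 0 < e / 2 by rewrite divr_gt0.
have [K HK] := config_walk_const beta01 c0 (block_length_ge0 B) asymp
  (cumul_block_cvg B) (good_sample Gw0 good w1) t0 e2.
exists K => w2 j Jj lj; pose w := (w1, w2) : W.
have [n1 Hn1] := HK (label_value h w) (h (gamma j)) (h1 w) (fun p pK => congr1 (h \o gamma) (lj p pK)).
have [n2 _ Hn2] := limit_walk_close w t e2.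
have a := Hn1 (maxn n1 n2) (leq_maxl _ _).
have := Hn2 (maxn n1 n2) (leq_maxr _ _) t; rewrite t0 lexx => /(_ isT) b.
move: a b; rewrite /coupled_walk /= !ler_norml => /andP[a1 a2] /andP[b1 b2].
by apply/andP; split; lra.
Qed.

End component.

Lemma limit_path_close w (T e : R) : 0 < e ->
  \forall n \near \oo, close_on T e (digit_path gamma n (digits n w)) (limit_path w).
Proof.
move=> e0; have e2 : 0 < e / 2 by rewrite divr_gt0.
near=> n => t tT; apply: le_trans (norm_le_ReIm _) _; rewrite lec_real.
have n0 : (0 < n)%N by near: n; exact: nbhs_infty_gt.
rewrite /digit_path ReIm_divn ReB ImB /= !digit_walk_coupled//.
rewrite [leRHS](splitr e); apply: lerD; move: t tT; near: n.
- exact: limit_walk_close label_value_Re _ _ _ e2.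
- exact: limit_walk_close label_value_Im _ _ _ e2.
Unshelve. all: by end_near. Qed.

Lemma limit_path_cvg w : digit_path gamma n (digits n w) @[n --> \oo] --> limit_path w.
Proof. by apply: path_cvg => T e e0; exact: limit_path_close. Qed.

End coupling.

(** * Evaluation of paths, Birkhoff sums and null sets of products *)

Section evaluation.
Context {R : realType}.
Local Notation path_space := {family @segments0 R, R -> R[i]^o}.

Lemma continuous_evaluation (t : R) : 0 <= t ->
  continuous (fun f : path_space => f t : R[i]^o).
Proof.
move=> t0 f A /nbhs_ballP[e /= /complex_gt0[e' e'0 ->] eA].
have e2 : 0 < e' / 2 by rewrite divr_gt0.
apply: filterS (path_nbhs f t0 e2) => g fg; apply: eA; rewrite -ball_normE /=.
apply: le_lt_trans (fg t _) _; first by rewrite t0 lexx.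
by rewrite ltc_real ltr_pdivrMr// ltr_pMr// ltr1n.
Qed.

Lemma borel_rv_comp d (W : measurableType d) (X X' : topologicalType) (f : X -> X')
    (Z : W -> X) : continuous f -> borel_rv Z -> borel_rv (f \o Z).
Proof.
by move=> cf bZ U oU; apply: (bZ (f @^-1` U)); move/continuousP : cf; exact.
Qed.

Lemma cvg_in_distribution_comp (X X' : topologicalType) (f : X -> X')
    d (W : measurableType d) (mu : probability W R) (Z_ : nat -> W -> X)
    d' (W' : measurableType d') (P : probability W' R) (Z : W' -> X) :
  continuous f -> cvg_in_distribution mu Z_ P Z ->
  cvg_in_distribution mu (fun n => f \o Z_ n) P (f \o Z).
Proof.
move=> cf [bZ_ bZ cE]; split; [by move=> n; exact: borel_rv_comp|exact: borel_rv_comp|].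
move=> F cF [M FM]; apply: (cE (F \o f)); last by exists M => x; exact: FM.
by move=> x; apply: continuous_comp; [exact: cf|exact: cF].
Qed.

Lemma lipschitz_within_continuous (f : R -> R[i]^o) (k : R) : 0 < k ->
  (forall t t', 0 <= t -> 0 <= t' -> `|f t - f t'| <= (k * `|t - t'|)%:C :> R[i]) ->
  {within `[0, +oo[, continuous f}.
Proof.
move=> k0 lf; apply/subspace_continuousP => t /=; rewrite in_itv/= andbT => t0.
move=> A /nbhs_ballP[e /= /complex_gt0[e' e'0 ->] eA].
have ek : 0 < e' / k by rewrite divr_gt0.
suff : \forall s \near nbhs t, 0 <= s -> A (f s).
  by apply: filterS => s h; rewrite /= in_itv/= andbT.
exists (e' / k) => //= s; rewrite /ball_ /= => ts s0; apply: eA; rewrite -ball_normE /=.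
apply: le_lt_trans (lf _ _ t0 s0) _.
by rewrite ltc_real mulrC -ltr_pdivlMr.
Qed.

End evaluation.

Section birkhoff.
Context {R : realType}.
Local Notation T1 := (measurableTypeR R).
Local Notation tower := (T1 * T1 * nat)%type.
Variables (B : interval_partition R Zplus) (J : set nat) (C : interval_partition R J).
Variable gamma : nat -> R[i].

Lemma birkhoff_complex n (y : tower) :
  birkhoff_sum (tower_map B C) (observable C gamma) n y =
  complex_walk gamma (tower_digits B C y) n.
Proof.
rewrite /complex_walk -!tower_birkhoff /birkhoff_sum /observable.
elim/big_ind3 : _ => //.
- move=> z a b z' a' b' -> -> ; by simpc.
- by move=> k _; case: (gamma _).
Qed.

End birkhoff.

Section fubini.
Context {R : realType}.
Local Notation T1 := (measurableTypeR R).
Local Notation lam := (@lam R).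

(** By Fubini, almost every section of a null set is null. *)
Lemma ae_product_section (Q : T1 * T1 -> Prop) :
  {ae (lam \x lam)%E, forall w, Q w} ->
  exists w1 : T1, {ae lam, forall w2, Q (w1, w2)}.
Proof.
move=> [N [mN N0 QN]].
have m0 := measurable_fun_xsection lam mN.
have : (\int[lam]_x `|(lam \o xsection N) x| = 0)%E.
  rewrite -[RHS]N0; apply: eq_integral => x _ /=.
  by rewrite gee0_abs.
move=> /(ae_eq_integral_abs lam measurableT m0)[N' [mN' N'0 HN']].
have [w1 Nw1] : exists w1, ~ N' w1.
  apply: contrapT => H; have : lam setT = 0%E.
    rewrite -N'0; congr (lam _); apply/seteqP; split=> // x _.
    by apply: contrapT => Nx; apply: H; exists x.
  by rewrite lam_setT => /eqP; rewrite onee_eq0.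
exists w1; exists (xsection N w1); split.
- exact: measurable_xsection.
- by apply: contrapT => H; apply: Nw1; apply: HN' => /= /(_ I).
- by move=> w2 /= Qw2; rewrite /xsection /= inE; apply: QN.
Qed.

End fubini.

(** * Convergence in distribution and nonconstancy *)

Section conclusion.
Context {R : realType}.
Local Notation T1 := (measurableTypeR R).
Local Notation lam := (@lam R).
Local Notation leb := (@lebesgue_measure R).
Local Notation path_space := {family @segments0 R, R -> R[i]^o}.
Variables (beta c : R).
Variables (B : interval_partition R Zplus) (J : set nat) (C : interval_partition R J).
Variable gamma : nat -> R[i].
Hypothesis beta01 : 0 < beta < 1.
Hypothesis c0 : 0 < c.
Hypothesis asymp : block_length B i / (c * i%:R `^ (- beta - 1)) @[i --> \oo] --> (1 : R).
Hypothesis gamma1 : forall j, J j -> `|gamma j| = 1.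
Variables (G : set T1) (w0 : T1).
Hypothesis mG : measurable G.
Hypothesis G1 : lam (~` G) = 0%E.
Hypothesis Gw0 : G w0.
Hypothesis good : forall w, G w -> good_config beta (present w) (time w) (height w).

Local Notation unit_point := (regular (`[0, 1[%classic : set T1) (0 : T1)).
Local Notation digits := (coupled_digits beta B C G w0).
Local Notation limit := (limit_path beta B C gamma G w0).

Lemma limit_path_lip w t t' : 0 <= t -> 0 <= t' ->
  `|limit w t - limit w t'| <= (2 * `|t - t'|)%:C :> R[i].
Proof.
move=> t0 t'0; apply: le_trans (norm_le_ReIm _) _; rewrite lec_real ReB ImB /limit_path /=.
rewrite mulr2n mulrDl mul1r; apply: lerD.
- exact: (limit_walk_lip beta01 c0 asymp Gw0 good (label_value_Re C gamma1)).
- exact: (limit_walk_lip beta01 c0 asymp Gw0 good (label_value_Im C gamma1)).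
Qed.

(** The coupled paths converge at every sample, and for each [n] they have
the law of the Birkhoff sums. *)
Lemma path_converges :
  cvg_in_distribution (X := path_space) (nu0 B)
    (fun n y => digit_path gamma n (tower_digits B C y)) (lam \x lam)%E limit.
Proof.
have mD n := measurable_coupled_digits B C beta01 mG Gw0 good n.
have cvF w := @limit_path_cvg _ _ _ B J C gamma beta01 c0 asymp gamma1 G w0 Gw0 good w.
have bX n : borel_rv (X := path_space) (fun w => digit_path gamma n (digits n w)).
  exact: (borel_digit_path gamma (mD n) n).
have bL : borel_rv (X := path_space) limit by exact: (borel_rv_limit bX).
split=> // [n|F cF bF].
  exact: (borel_digit_path gamma (measurable_tower_digits B C) n).
have [M FM] := bF.
have eE n : (\int[nu0 B]_y (F (digit_path gamma n (tower_digits B C y)))%:E =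
    \int[(lam \x lam)%E]_w (F (digit_path gamma n (digits n w)))%:E)%E.
  apply: eq_law_digit_path cF bF; [exact: measurable_tower_digits|exact: (mD n)|].
  by move=> K v K0; rewrite nu0_cylinder// -(coupled_cylinder B C beta01 mG G1 Gw0 good n v K0).
under eq_fun do rewrite eE.
apply: (@expectation_cvg _ _ _ _ (fun n w => F (digit_path gamma n (digits n w))) (F \o limit) M) => //.
- by move=> n; apply: (borel_rv_measurable (bX n)).
- by move=> w; apply: (@cvg_comp _ _ _ (fun n => digit_path gamma n (digits n w)) F); [exact: cvF|exact: cF].
Qed.

Lemma label_run_gt0 K j : (0 < leb (C j))%E -> J j ->
  (0 < lam [set w | forall p, (p < K)%N -> label C p (unit_point w) = j])%E.
Proof.
move=> Cj Jj; pose E := [set w : T1 | forall p, (p < K)%N -> label C p w = j].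
have mE : measurable E.
  apply: (@measurable_forall_lt _ _ _ (fun p w => label C p w = j)) => p.
  exact: (measurable_preimage (measurable_label C p) (A := [set j]) I).
rewrite [ltRHS](lam_regular 0 measurable_unit_itv lam_unit_compl mE).
rewrite /E (@lam_labels _ _ C K id (fun=> j))//.
rewrite lte_fin prodr_gt0// => k _; apply: fine_gt0.
rewrite (lam_block C Jj) Cj /=.
rewrite -(lam_block C Jj).
by apply: le_lt_trans (probability_le1 _ _) (ltry _); exact: measurable_block_index_set1.
Qed.

(** By Fubini a constant limit would be constant in [w.2] for some fixed [w.1];
runs of the labels [i] and [j] of sufficient length then bring the constant arbitrarily
close to both [gamma i * t] and [gamma j * t]. *)
Lemma limit_not_constant (t : R) :
  (forall j, J j -> (0 < leb (C j))%E) ->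
  ~ (forall i j, J i -> J j -> gamma i = gamma j) ->
  0 < t -> ~ as_constant (lam \x lam)%E (fun w => limit w t).
Proof.
move=> Cpos gneq t0 [z /ae_product_section[w1 aew1]]; apply: gneq.
have key (h : R[i] -> R) (hL : forall w, h (limit w t) = limit_walk beta B C gamma G w0 h w t)
    (h1 : forall w p, `|label_value C gamma h w p| <= 1) j : J j -> h (gamma j) * t = h z.
  move=> Jj; apply/eqP; rewrite -subr_eq0 -normr_le0; apply/ler_addgt0Pl => e e0.
  have [K HK] := limit_walk_const beta01 c0 asymp Gw0 good h1 w1 (ltW t0) e0.
  (* runs of the label [j] have positive probability, so one of them avoids the null set *)
  have [w2 [lw2 Lw2]] : exists w2 : T1,
      (forall p, (p < K)%N -> label C p (unit_point w2) = j) /\ limit (w1, w2) t = z.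
    apply: contrapT => H; move: aew1 => [N [mN N0 HN]].
    have := label_run_gt0 K (Cpos _ Jj) Jj; rewrite ltNge => /negP; apply.
    rewrite -N0; apply: le_measure; rewrite ?inE//.
      by apply: measurable_forall_lt => p; exact: measurable_label_unit.
    move=> w2 lw2; apply: HN => /= Lw2; apply: H; by exists w2.
  by have := HK w2 j Jj lw2; rewrite -hL Lw2 distrC addr0.
move=> i j Ji Jj.
have tn : t != 0 by rewrite gt_eqF.
have eRe := key (@complex.Re R) (fun=> erefl) (label_value_Re C gamma1).
have eIm := key (@complex.Im R) (fun=> erefl) (label_value_Im C gamma1).
have /(mulIf tn) := etrans (eRe i Ji) (esym (eRe j Jj)).
have /(mulIf tn) := etrans (eIm i Ji) (esym (eIm j Jj)).
by case: (gamma i) => a b; case: (gamma j) => a' b' /= -> ->.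
Qed.

End conclusion.

Theorem proposition4p1 (R : realType) (beta c : R)
    (B : interval_partition R Zplus)
    (J : set nat) (C : interval_partition R J) (gamma : nat -> R[i]) :
  0 < beta < 1 ->
  0 < c ->
  fine (@lebesgue_measure R (B i)) / (c * i%:R `^ (- beta - 1))
    @[i --> \oo] --> (1 : R) ->
  (J = Zplus \/
   exists2 N : nat, (0 < N)%N & J = [set j | (1 <= j <= N)%N]) ->
  (forall j, J j -> `|gamma j| = 1) ->
  let S n := birkhoff_sum (tower_map B C) (observable C gamma) n in
  exists (d : measure_display) (W : measurableType d) (P : probability W R)
    (L : R -> W -> R[i]^o),
    [/\ forall t : R, 0 <= t -> borel_rv (L t),
        forall w, {within `[0, +oo[, continuous (L^~ w)},
        cvg_in_distribution (X := path_space R) (nu0 B)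
          (fun n y t => S (Num.truncn (n%:R * t)) y / n%:R) P
          (fun w t => L t w) &
        (forall j, J j -> (0 < @lebesgue_measure R (C j))%E) ->
        ~ (forall i j, J i -> J j -> gamma i = gamma j) ->
        (forall t : R, 0 < t -> ~ as_constant P (L t)) /\
        exists Z : W -> R[i]^o,
          cvg_in_distribution (nu0 B) (fun n y => S n y / n%:R) P Z /\
          ~ as_constant P Z].
Proof.
move=> beta01 c0 asymp _ gamma1 S.
have [G [w0 [mG G1 Gw0 good]]] := exists_good_sample beta01.
have cvL := path_converges C beta01 c0 asymp gamma1 mG G1 Gw0 good.
pose limit := limit_path beta B C gamma G w0.
have SE n y : S n y = complex_walk gamma (tower_digits B C y) n by exact: birkhoff_complex.
exists _, (measurableTypeR R * measurableTypeR R)%type, (lam \x lam)%E, (fun t w => limit w t).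
split.
- move=> t t0; have [_ bL _] := cvL.
  exact: (borel_rv_comp (continuous_evaluation t0) bL).
- move=> w; apply: (@lipschitz_within_continuous _ _ 2) => // t t' t0 t'0.
  exact: (limit_path_lip C beta01 c0 asymp gamma1 Gw0 good).
- rewrite (_ : (fun n y t => _) = (fun n y => digit_path gamma n (tower_digits B C y)))//.
  by apply/funext => n; apply/funext => y; apply/funext => t; rewrite SE.
- move=> Cpos gneq; have nc t := limit_not_constant beta01 c0 asymp gamma1 Gw0 good Cpos gneq (t := t).
  split=> //; exists (fun w => limit w 1); split; last exact: nc.
  rewrite (_ : (fun n y => _) = (fun n => (fun f : path_space R => f 1 : R[i]^o) \o
    (fun y => digit_path gamma n (tower_digits B C y)))).
    exact: (cvg_in_distribution_comp (continuous_evaluation ler01) cvL).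
  by apply/funext => n; apply/funext => y /=; rewrite /digit_path mulr1 natrK SE.
Qed.
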